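(* Let $\phi : \mathbb{D} \to \mathbb{D}$ be an analytic self-map whose image is contained in a polygon $\mathbf{P}$ with vertices on the unit circle. Then there exist constants $\alpha, \beta > 0$, with $\beta$ depending only on $\mathbf{P}$, such that for every $n \geq 1$: $$a_n(C_\phi) \leq \alpha\, e^{-\beta\sqrt{n}}.$$
   Context: $\mathbb{D}$ is the open unit disk. For an analytic $\phi : \mathbb{D} \to \mathbb{D}$, $C_\phi : H^2 \to H^2$, $C_\phi(f) = f\circ\phi$, is the composition operator on the Hardy space $H^2$ of the disk (always bounded). The approximation numbers of a bounded operator $T$ are $a_n(T) = \inf\{\|T - R\| : \mathrm{rank}\,(R) < n\}$, $n = 1,2,\ldots$ A polygon with vertices on the unit circle is the (inscribed, convex) polygonal region whose vertices are finitely many (at least three) distinct points of the unit circle. *)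

(* Defs.v *)
From Stdlib Require Import Reals.
From Coquelicot Require Import Coquelicot.

Open Scope R_scope.

(** The open unit disk. *)

Definition disk : Type := {z : C | Cmod z < 1}.

Definition disk_val (z : disk) : C := proj1_sig z.

Coercion disk_val : disk >-> C.

Definition analytic (f : disk -> C) : Prop :=
  forall w : disk, exists (a : nat -> C) (r : R),
    0 < r /\
    forall z : disk, Cmod (z - w) < r ->
      @is_pseries C_AbsRing C_NormedModule a (z - w)%C (f z).

(** The Hardy space [H^2]. *)

Definition H2_coef (f : disk -> C) (a : nat -> C) : Prop :=
  ex_series (fun n => Cmod (a n) ^ 2) /\
  forall z : disk, @is_pseries C_AbsRing C_NormedModule a (disk_val z) (f z).

Definition H2 (f : disk -> C) : Prop := exists a : nat -> C, H2_coef f a.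

(* Taylor coefficients are unique, so the infimum below is over a singleton
   when [f] is in [H^2], and over the empty set, with value [p_infty],
   otherwise. *)
Definition H2_norm (f : disk -> C) : Rbar :=
  Rbar_glb (fun y : Rbar => exists a : nat -> C,
    H2_coef f a /\ y = Finite (sqrt (Series (fun n => Cmod (a n) ^ 2)))).

(** Operators on [H^2] are given by maps on all functions on the disk; only
    their values on [H^2] matter. *)

Definition operator : Type := (disk -> C) -> (disk -> C).

Definition op_sub (T S : operator) : operator :=
  fun f z => (T f z - S f z)%C.

(* The value is [p_infty] if [T] is unbounded or does not map [H^2] into
   itself. *)
Definition op_norm (T : operator) : Rbar :=
  Rbar_lub (fun y : Rbar => exists f : disk -> C,
    H2 f /\ Rbar_le (H2_norm f) 1 /\ y = H2_norm (T f)).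

Definition bounded_operator (T : operator) : Prop :=
  (forall f : disk -> C, H2 f -> H2 (T f)) /\
  (forall (c d : C) (f g : disk -> C), H2 f -> H2 g -> forall z : disk,
     T (fun w => c * f w + d * g w)%C z = (c * T f z + d * T g z)%C) /\
  Rbar_lt (op_norm T) p_infty.

(* The range of [T] is spanned by [k < n] of its elements,
   [T (h 1), ..., T (h k)]; the sum is empty for [k = 0]. *)
Definition rank_lt (T : operator) (n : nat) : Prop :=
  exists (k : nat) (h : nat -> disk -> C),
    (k < n)%nat /\
    (forall i : nat, H2 (h i)) /\
    forall f : disk -> C, H2 f -> exists c : nat -> C, forall z : disk,
      T f z = sum_n_m (fun i => (c i * T (h i) z)%C) 1 k.

Definition approx_number (n : nat) (T : operator) : Rbar :=
  Rbar_glb (fun y : Rbar => exists S : operator,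
    bounded_operator S /\ rank_lt S n /\ y = op_norm (op_sub T S)).

Definition composition_operator (phi : disk -> disk) : operator :=
  fun f z => f (phi z).

(** Polygons inscribed in the unit circle. *)

(* The convex hull of the [m + 1] points [v 0, ..., v m]. *)
Definition convex_hull (m : nat) (v : nat -> C) (z : C) : Prop :=
  exists t : nat -> R,
    (forall i : nat, (i <= m)%nat -> 0 <= t i) /\
    sum_n t m = 1 /\
    z = sum_n (fun i => (RtoC (t i) * v i)%C) m.

(* Distinct points of the circle are in convex position, so they are exactly
   the vertices of their convex hull, whatever their order. *)
Definition inscribed_polygon (P : C -> Prop) : Prop :=
  exists (m : nat) (v : nat -> C),
    (2 <= m)%nat /\
    (forall i : nat, (i <= m)%nat -> Cmod (v i) = 1) /\
    (forall i j : nat, (i <= m)%nat -> (j <= m)%nat -> v i = v j -> i = j) /\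
    forall z : C, P z <-> convex_hull m v z.

(* Main.v *)
Require Import Defs.
From Stdlib Require Import Reals.
From Coquelicot Require Import Coquelicot.
From Stdlib Require Import Arith Lra Lia Classical ClassicalEpsilon FunctionalExtensionality List.

Open Scope R_scope.

(** Write [u] for [gap v w = 1 - conj v * w], whose modulus is the distance from [w] to the vertex [v].
    A point [w] of the disk that lies in the polygon satisfies [Re u >= c |u|] at every vertex, because
    the angles of the polygon are less than pi, and [1 - |w|^2 >= c |u|] at some vertex, because the
    polygon meets the circle only at its vertices ([polygon_corners]). Hence a function [f] of norm at
    most 1 in the Hardy space satisfies [|f(w)|^2 <= 1 / (1 - |w|^2) <= 1 / (c |u|)] there
    ([point_evaluation]).

    Since the angles are less than pi, even a power [|u| ^ (-1 - s)] with some [s > 0] is majorized on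
    the polygon by the real part of a function [K] holomorphic on the disk, built in [corner_kernel] from
    resolvents of [u]. If [|F|^2 <= Re K] on the image of [phi], then the squared norm of [F] composed
    with [phi] is at most [Re K] at [phi(0)]: this is the mean value property of [Re K] composed with
    [phi] ([hardy_majorant]). It gives the boundedness of the operators involved, and the exponent
    beyond [-1] leaves a factor [|u| ^ s] to spare, so that the points within [2 ^ (-M)] of a vertex
    contribute only a geometrically small amount in [M].

    At the other points of the polygon, the Blaschke product [B] that has an [M]-fold zero at each of the
    distances [2 ^ (-k)], [k < M], from each of the [m + 1] vertices is geometrically small in [M]
    ([blaschke_corner_le]). Removing the zeros one after the other writes [f] as an element of a space of
    dimension [(m + 1) M^2] plus [B g], where [g] is no larger than [f] and both parts are linear in [f]
    ([deflate]). Composing the first part with [phi] is an operator of rank at most [(m + 1) M^2], and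
    its distance to the composition operator is that of [B g] to 0, geometrically small in [M]
    ([approximation_error]). With [M] of the order of [sqrt (n / (m + 1))] this is the estimate. The rate
    involves only [m] and [c]; the map [phi] enters through the values of the kernels at [phi(0)].

    All holomorphic functions are handled through their power series at 0. That a bounded, locally
    analytic function is the sum of such a series is [local_to_global]. Integrals over circles are
    replaced by means over the points [r * zeta ^ j], where [zeta = (3 + 4 i) / 5] is not a root of
    unity: the mean of [F (r zeta^j)] times the conjugate of [zeta ^ (j m)] tends to the coefficient of
    index [m] of [F], times [r ^ m] ([fourier_mean]). Cauchy's estimates, the uniqueness of coefficients
    and [hardy_majorant] all follow from this. *)

(** * Finite sums, limits and series of complex numbers *)

Fixpoint csum (a : nat -> C) (n : nat) : C :=
  match n with O => RtoC 0 | S k => (csum a k + a k)%C end.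

Fixpoint rsum (a : nat -> R) (n : nat) : R :=
  match n with O => 0 | S k => rsum a k + a k end.

Lemma csum_ext a b n : (forall k, (k < n)%nat -> a k = b k) -> csum a n = csum b n.
Proof.
  induction n as [|n IH]; intros H; simpl; auto.
  rewrite IH, H; auto.
Qed.

Lemma csum_plus a b n : csum (fun k => a k + b k)%C n = (csum a n + csum b n)%C.
Proof. induction n as [|n IH]; simpl; [|rewrite IH]; ring. Qed.

Lemma csum_scal c a n : csum (fun k => c * a k)%C n = (c * csum a n)%C.
Proof. induction n as [|n IH]; simpl; [|rewrite IH]; ring. Qed.

Lemma csum_zero n : csum (fun _ => RtoC 0) n = RtoC 0.
Proof. induction n as [|n IH]; simpl; [|rewrite IH]; ring. Qed.

Lemma csum_exchange (x : nat -> nat -> C) n m :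
  csum (fun i => csum (x i) m) n = csum (fun j => csum (fun i => x i j) n) m.
Proof.
  induction n as [|n IH]; simpl.
  - now rewrite csum_zero.
  - now rewrite IH, <- csum_plus.
Qed.

Lemma csum_Re a n : Re (csum a n) = rsum (fun k => Re (a k)) n.
Proof. induction n as [|n IH]; simpl; [|rewrite <- IH]; reflexivity. Qed.

Lemma csum_shift a n : csum a (S n) = (a O + csum (fun k => a (S k)) n)%C.
Proof.
  induction n as [|n IH]; [simpl; ring|].
  change (csum a (S (S n))) with (csum a (S n) + a (S n))%C.
  rewrite IH. simpl. ring.
Qed.

Lemma rsum_ext a b n : (forall k, (k < n)%nat -> a k = b k) -> rsum a n = rsum b n.
Proof.
  induction n as [|n IH]; intros H; simpl; auto.
  rewrite IH, H; auto.
Qed.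

Lemma rsum_le a b n : (forall k, (k < n)%nat -> a k <= b k) -> rsum a n <= rsum b n.
Proof.
  induction n as [|n IH]; intros H; simpl; [lra|].
  apply Rplus_le_compat; auto.
Qed.

Lemma rsum_plus a b n : rsum (fun k => a k + b k) n = rsum a n + rsum b n.
Proof. induction n as [|n IH]; simpl; [|rewrite IH]; ring. Qed.

Lemma rsum_scal c a n : rsum (fun k => c * a k) n = c * rsum a n.
Proof. induction n as [|n IH]; simpl; [|rewrite IH]; ring. Qed.

Lemma rsum_const c n : rsum (fun _ => c) n = INR n * c.
Proof. induction n as [|n IH]; [simpl; ring|]. rewrite S_INR. simpl. rewrite IH. ring. Qed.

Lemma rsum_nonneg a n : (forall k, (k < n)%nat -> 0 <= a k) -> 0 <= rsum a n.
Proof.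
  intros H. rewrite <- (Rmult_0_r (INR n)), <- rsum_const. now apply rsum_le.
Qed.

Lemma rsum_mono a n m : (forall k, 0 <= a k) -> (n <= m)%nat -> rsum a n <= rsum a m.
Proof.
  intros H. induction 1 as [|m _ IH]; [lra|]. simpl. specialize (H m). lra.
Qed.

Lemma rsum_term_le a n k : (forall j, (j < n)%nat -> 0 <= a j) -> (k < n)%nat -> a k <= rsum a n.
Proof.
  induction n as [|n IH]; intros H Hk; [lia|]. simpl.
  destruct (Nat.eq_dec k n) as [->|Hne].
  - assert (0 <= rsum a n) by (apply rsum_nonneg; auto). lra.
  - assert (a k <= rsum a n) by (apply IH; auto; lia).
    assert (0 <= a n) by auto. lra.
Qed.

Lemma rsum_geom q n : (1 - q) * rsum (fun k => q ^ k) n = 1 - q ^ n.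
Proof. induction n as [|n IH]; simpl; [|rewrite Rmult_plus_distr_l, IH]; ring. Qed.

Lemma csum_geom (q : C) n : ((1 - q) * csum (fun k => q ^ k) n = 1 - q ^ n)%C.
Proof.
  induction n as [|n IH]; simpl; [ring|].
  rewrite Cmult_plus_distr_l, IH. ring.
Qed.

Lemma Cmod_csum_le a n : Cmod (csum a n) <= rsum (fun k => Cmod (a k)) n.
Proof.
  induction n as [|n IH]; simpl; [rewrite Cmod_0; lra|].
  eapply Rle_trans; [apply Cmod_triangle|]. lra.
Qed.

Lemma Cmod_minus_sym (x y : C) : Cmod (x - y) = Cmod (y - x).
Proof. rewrite <- Cmod_opp. f_equal. ring. Qed.

Definition clim (u : nat -> C) (l : C) : Prop :=
  forall eps, 0 < eps -> exists N, forall n, (N <= n)%nat -> Cmod (u n - l) < eps.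

Lemma clim_ext u v l : (forall n, u n = v n) -> clim u l -> clim v l.
Proof.
  intros H Hu eps He. destruct (Hu eps He) as [N HN]. exists N.
  intros n Hn. rewrite <- H. auto.
Qed.

Lemma clim_const l : clim (fun _ => l) l.
Proof.
  intros eps He. exists O. intros n _. replace (l - l)%C with (RtoC 0) by ring.
  now rewrite Cmod_0.
Qed.

Lemma clim_plus u v l m : clim u l -> clim v m -> clim (fun n => u n + v n)%C (l + m)%C.
Proof.
  intros Hu Hv eps He.
  destruct (Hu (eps / 2)) as [N HN]; [lra|].
  destruct (Hv (eps / 2)) as [M HM]; [lra|].
  exists (max N M). intros n Hn.
  replace (u n + v n - (l + m))%C with ((u n - l) + (v n - m))%C by ring.
  eapply Rle_lt_trans; [apply Cmod_triangle|].
  specialize (HN n ltac:(lia)). specialize (HM n ltac:(lia)). lra.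
Qed.

Lemma clim_scal c u l : clim u l -> clim (fun n => c * u n)%C (c * l)%C.
Proof.
  intros Hu eps He. pose proof (Cmod_ge_0 c) as Hc.
  destruct (Hu (eps / (Cmod c + 1))) as [N HN].
  { apply Rdiv_lt_0_compat; lra. }
  exists N. intros n Hn. specialize (HN n Hn).
  replace (c * u n - c * l)%C with (c * (u n - l))%C by ring.
  rewrite Cmod_mult. apply Rle_lt_trans with ((Cmod c) * (eps / (Cmod c + 1))).
  - apply Rmult_le_compat_l; lra.
  - apply Rmult_lt_reg_r with (Cmod c + 1); [lra|]. field_simplify; lra.
Qed.

Lemma clim_unique u l m : clim u l -> clim u m -> l = m.
Proof.
  intros Hl Hm. destruct (Req_dec (Cmod (l - m)) 0) as [H|H].
  - apply Cmod_eq_0 in H. replace l with (m + (l - m))%C by ring. rewrite H. ring.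
  - assert (0 < Cmod (l - m)) by (pose proof (Cmod_ge_0 (l - m)); lra).
    destruct (Hl (Cmod (l - m) / 2)) as [N HN]; [lra|].
    destruct (Hm (Cmod (l - m) / 2)) as [M HM]; [lra|].
    specialize (HN (max N M) ltac:(lia)). specialize (HM (max N M) ltac:(lia)).
    rewrite Cmod_minus_sym in HN.
    pose proof (Cmod_triangle (l - u (max N M)) (u (max N M) - m)) as T.
    replace (l - u (max N M) + (u (max N M) - m))%C with (l - m)%C in T by ring. lra.
Qed.

Lemma clim_Cmod_le u l M : clim u l -> (forall n, Cmod (u n) <= M) -> Cmod l <= M.
Proof.
  intros Hu H. apply Rnot_lt_le. intros Hlt.
  destruct (Hu (Cmod l - M)) as [N HN]; [lra|].
  specialize (HN N (le_n N)). specialize (H N). rewrite Cmod_minus_sym in HN.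
  pose proof (Cmod_triangle (l - u N) (u N)) as T.
  replace (l - u N + u N)%C with l in T by ring. lra.
Qed.

Lemma Re_le_Cmod (z : C) : Re z <= Cmod z.
Proof. eapply Rle_trans; [apply Rle_abs|]. apply re_le_Cmod. Qed.

Lemma clim_Re_ge u l M : clim u l -> (forall n, M <= Re (u n)) -> M <= Re l.
Proof.
  intros Hu H. apply Rnot_lt_le. intros Hlt.
  destruct (Hu (M - Re l)) as [N HN]; [lra|].
  specialize (HN N (le_n N)). specialize (H N).
  pose proof (Re_le_Cmod (u N - l)%C) as T.
  replace (Re (u N - l)%C) with (Re (u N) - Re l) in T by (unfold Re; simpl; ring). lra.
Qed.

Lemma clim_incr u l : clim u l -> clim (fun n => u (S n)) l.
Proof.
  intros Hu eps He. destruct (Hu eps He) as [N HN]. exists N. intros n Hn.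
  apply HN. lia.
Qed.

Lemma clim_decr u l : clim (fun n => u (S n)) l -> clim u l.
Proof.
  intros Hu eps He. destruct (Hu eps He) as [N HN]. exists (S N). intros n Hn.
  destruct n as [|n]; [lia|]. apply HN. lia.
Qed.

Lemma clim_csum (u : nat -> nat -> C) (l : nat -> C) n :
  (forall k, (k < n)%nat -> clim (fun N => u N k) (l k)) ->
  clim (fun N => csum (u N) n) (csum l n).
Proof.
  induction n as [|n IH]; intros H; simpl; [apply clim_const|].
  apply clim_plus; auto.
Qed.

Definition cser (a : nat -> C) (l : C) : Prop := clim (csum a) l.

(** For non-negative terms this is convergence, in the form that comparison produces. *)
Definition bounded_sums (b : nat -> R) : Prop := exists M, forall n, rsum b n <= M.

Lemma bounded_sums_tail b : (forall n, 0 <= b n) -> bounded_sums b ->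
  forall eps, 0 < eps -> exists N, forall n, (N <= n)%nat -> rsum b n - rsum b N < eps.
Proof.
  intros Hb [M HM] eps He.
  destruct (completeness (fun x => exists n, x = rsum b n)) as [s [Hs1 Hs2]].
  - exists M. intros x [n ->]. auto.
  - exists 0. now exists O.
  - destruct (classic (exists N, s - eps < rsum b N)) as [[N HN]|Hno].
    + exists N. intros n Hn. assert (rsum b n <= s) by (apply Hs1; eauto). lra.
    + exfalso. assert (s <= s - eps); [|lra]. apply Hs2. intros x [n ->].
      apply Rnot_lt_le. intros H. apply Hno. eauto.
Qed.

Lemma bounded_sums_scal c b : 0 <= c -> bounded_sums b -> bounded_sums (fun n => c * b n).
Proof.
  intros Hc [M HM]. exists (c * M). intros n. rewrite rsum_scal.
  apply Rmult_le_compat_l; auto.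
Qed.

Lemma csum_tail_le (a : nat -> C) b N n : (forall k, Cmod (a k) <= b k) -> (N <= n)%nat ->
  Cmod (csum a n - csum a N) <= rsum b n - rsum b N.
Proof.
  intros H. induction 1 as [|n Hn IH].
  - replace (csum a N - csum a N)%C with (RtoC 0) by ring. rewrite Cmod_0. lra.
  - simpl. replace (csum a n + a n - csum a N)%C with ((csum a n - csum a N) + a n)%C by ring.
    eapply Rle_trans; [apply Cmod_triangle|]. specialize (H n). lra.
Qed.

Lemma clim_complete (u : nat -> C) :
  (forall eps, 0 < eps -> exists N, forall n, (N <= n)%nat -> Cmod (u n - u N) < eps) ->
  exists l, clim u l.
Proof.
  intros H.
  assert (HR : forall p : C -> R, (forall x y, Rabs (p x - p y) <= Cmod (x - y)) ->
             exists l, is_lim_seq (fun n => p (u n)) (Finite l)).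
  { intros p Hp. apply ex_lim_seq_cauchy_corr. intros eps.
    destruct (H (eps / 2)) as [N HN]; [destruct eps; simpl; lra|].
    exists N. intros n m Hn Hm.
    eapply Rle_lt_trans; [apply Hp|].
    pose proof (Cmod_triangle (u n - u N) (u N - u m)) as T.
    replace (u n - u N + (u N - u m))%C with (u n - u m)%C in T by ring.
    rewrite (Cmod_minus_sym (u N)) in T.
    pose proof (HN n Hn). pose proof (HN m Hm). lra. }
  destruct (HR Re) as [lr Hr].
  { intros x y. replace (Re x - Re y) with (Re (x - y)%C) by (unfold Re; simpl; ring).
    apply re_le_Cmod. }
  destruct (HR Im) as [li Hi].
  { intros x y. eapply Rle_trans; [|apply Rmax_Cmod].
    eapply Rle_trans; [|apply Rmax_r]. right. f_equal. }
  exists (lr, li). intros eps He.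
  assert (He2 : 0 < eps / 2) by lra.
  apply is_lim_seq_spec in Hr. apply is_lim_seq_spec in Hi.
  destruct (Hr (mkposreal _ He2)) as [N HN]. destruct (Hi (mkposreal _ He2)) as [M HM].
  exists (max N M). intros n Hn.
  specialize (HN n ltac:(lia)). specialize (HM n ltac:(lia)). simpl in HN, HM.
  set (x := (u n - (lr, li))%C).
  assert (E : x = (RtoC (Re (u n) - lr) + Ci * RtoC (Im (u n) - li))%C).
  { unfold x, Re, Im. destruct (u n). apply injective_projections; simpl; ring. }
  rewrite E. eapply Rle_lt_trans; [apply Cmod_triangle|].
  rewrite Cmod_mult, Cmod_Ci, !Cmod_R. lra.
Qed.

Lemma cser_ex (a : nat -> C) b : (forall n, Cmod (a n) <= b n) -> bounded_sums b -> exists l, cser a l.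
Proof.
  intros H Hb. apply clim_complete. intros eps He.
  assert (H0 : forall n, 0 <= b n).
  { intros n. eapply Rle_trans; [apply Cmod_ge_0|apply H]. }
  destruct (bounded_sums_tail b H0 Hb eps He) as [N HN]. exists N. intros n Hn.
  eapply Rle_lt_trans; [now apply csum_tail_le|auto].
Qed.

(** Naming a sum by choice lets coefficients that are themselves infinite series appear in
    formulas. *)
Definition ctot (a : nat -> C) : C := epsilon (inhabits (RtoC 0)) (cser a).

Lemma ctot_spec a b : (forall n, Cmod (a n) <= b n) -> bounded_sums b -> cser a (ctot a).
Proof. intros H Hb. unfold ctot. apply epsilon_spec. eauto using cser_ex. Qed.

Lemma cser_unique a l m : cser a l -> cser a m -> l = m.
Proof. apply clim_unique. Qed.

Lemma cser_ctot a l : cser a l -> ctot a = l.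
Proof.
  intros H. apply (cser_unique a); auto. unfold ctot. apply epsilon_spec. eauto.
Qed.

Lemma cser_ext a b l : (forall n, a n = b n) -> cser a l -> cser b l.
Proof. intros H. apply clim_ext. intros n. apply csum_ext. auto. Qed.

Lemma cser_plus a b l m : cser a l -> cser b m -> cser (fun n => a n + b n)%C (l + m)%C.
Proof.
  intros Ha Hb. eapply clim_ext; [|apply (clim_plus _ _ _ _ Ha Hb)].
  intros n. now rewrite csum_plus.
Qed.

Lemma cser_scal c a l : cser a l -> cser (fun n => c * a n)%C (c * l)%C.
Proof.
  intros Ha. eapply clim_ext; [|apply (clim_scal c _ _ Ha)].
  intros n. now rewrite csum_scal.
Qed.

Lemma cser_shift a l : cser (fun n => a (S n)) l -> cser a (a O + l)%C.
Proof.
  intros H. apply clim_decr.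
  eapply clim_ext; [|apply (clim_plus _ _ _ _ (clim_const (a O)) H)].
  intros n. cbv beta. now rewrite csum_shift.
Qed.

Lemma cser_csum (a : nat -> nat -> C) (l : nat -> C) m :
  (forall k, (k < m)%nat -> cser (a k) (l k)) ->
  cser (fun n => csum (fun k => a k n) m) (csum l m).
Proof.
  intros H.
  apply (clim_ext (fun N => csum (fun k => csum (a k) N) m)).
  - intros n. apply csum_exchange.
  - now apply (clim_csum (fun N k => csum (a k) N)).
Qed.

Lemma cser_Cmod_le a l M : cser a l -> (forall n, rsum (fun k => Cmod (a k)) n <= M) ->
  Cmod l <= M.
Proof.
  intros Ha H. apply (clim_Cmod_le _ _ _ Ha). intros n.
  eapply Rle_trans; [apply Cmod_csum_le|apply H].
Qed.

Lemma csum_finite a m n : (forall k, (m <= k)%nat -> a k = RtoC 0) -> (m <= n)%nat ->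
  csum a n = csum a m.
Proof.
  intros H. induction 1 as [|n Hn IH]; auto. simpl. rewrite IH, H by auto. ring.
Qed.

Lemma cser_finite a m : (forall k, (m <= k)%nat -> a k = RtoC 0) -> cser a (csum a m).
Proof.
  intros H eps He. exists m. intros n Hn. rewrite (csum_finite a m n H Hn).
  replace (csum a m - csum a m)%C with (RtoC 0) by ring. now rewrite Cmod_0.
Qed.

(** Dominated convergence for series: beyond a fixed index the tails are small uniformly in [K],
    and the finitely many terms before it converge one by one. *)
Lemma tannery (f : nat -> nat -> C) (g : nat -> C) (b : nat -> R) (F : nat -> C) (G : C) :
  (forall K n, Cmod (f K n) <= b n) -> bounded_sums b ->
  (forall n, clim (fun K => f K n) (g n)) ->
  (forall K, cser (f K) (F K)) -> cser g G -> clim F G.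
Proof.
  intros Hf Hb Hlim HF HG eps He.
  assert (H0 : forall n, 0 <= b n).
  { intros n. eapply Rle_trans; [apply Cmod_ge_0|apply (Hf O)]. }
  assert (Hg : forall n, Cmod (g n) <= b n).
  { intros n. apply (clim_Cmod_le _ _ _ (Hlim n)). auto. }
  destruct (bounded_sums_tail b H0 Hb (eps / 4)) as [N HN]; [lra|].
  assert (Htail : forall a l, (forall n, Cmod (a n) <= b n) -> cser a l ->
             Cmod (l - csum a N) <= eps / 4).
  { intros a l Ha Hl.
    assert (Hc : clim (fun n => csum a (n + N) - csum a N)%C (l - csum a N)%C).
    { apply (clim_plus _ (fun _ => - csum a N)%C _ (- csum a N)%C); [|apply clim_const].
      intros e Hee. destruct (Hl e Hee) as [N0 H1]. exists N0. intros n Hn. apply H1. lia. }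
    apply (clim_Cmod_le _ _ _ Hc). intros n.
    eapply Rle_trans; [apply csum_tail_le with (b := b); auto; lia|].
    left. apply HN. lia. }
  assert (Hs : clim (fun K => csum (f K) N) (csum g N)) by (apply clim_csum; auto).
  destruct (Hs (eps / 4)) as [K0 HK]; [lra|].
  exists K0. intros K Hn. specialize (HK K Hn).
  pose proof (Htail _ _ (Hf K) (HF K)) as H1.
  pose proof (Htail _ _ Hg HG) as H2. rewrite Cmod_minus_sym in H2.
  replace (F K - G)%C with ((F K - csum (f K) N) + ((csum (f K) N - csum g N) + (csum g N - G)))%C by ring.
  eapply Rle_lt_trans; [apply Cmod_triangle|].
  pose proof (Cmod_triangle (csum (f K) N - csum g N) (csum g N - G)). lra.
Qed.

(** The partial sums of the rows, as functions of the row index, are dominated by [b], so that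
    [tannery] lets the sum over the rows pass to the limit. *)
Lemma fubini (x : nat -> nat -> C) (b : nat -> R) (r c : nat -> C) s :
  (forall n K, rsum (fun k => Cmod (x n k)) K <= b n) -> bounded_sums b ->
  (forall n, cser (x n) (r n)) -> (forall k, cser (fun n => x n k) (c k)) ->
  cser r s -> cser c s.
Proof.
  intros Hx Hb Hr Hc Hs.
  apply (tannery (fun K n => csum (x n) K) r b); auto.
  - intros K n. eapply Rle_trans; [apply Cmod_csum_le|apply Hx].
  - intros K. apply (cser_csum (fun k n => x n k)). auto.
Qed.

Lemma fubini_column (x : nat -> nat -> C) (b : nat -> R) :
  (forall n K, rsum (fun k => Cmod (x n k)) K <= b n) -> bounded_sums b ->
  forall k, cser (fun n => x n k) (ctot (fun n => x n k)).
Proof.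
  intros Hx Hb k. apply ctot_spec with b; auto. intros n.
  eapply Rle_trans; [|apply (Hx n (S k))].
  apply (rsum_term_le (fun k => Cmod (x n k))); [intros; apply Cmod_ge_0|lia].
Qed.

(** * Power series and means over circles *)

Lemma clim_bounded u l : clim u l -> exists M, forall n, Cmod (u n) <= M.
Proof.
  intros H. destruct (H 1) as [N HN]; [lra|].
  exists (rsum (fun k => Cmod (u k)) N + (Cmod l + 1)). intros n.
  assert (H0 : 0 <= rsum (fun k => Cmod (u k)) N).
  { apply rsum_nonneg. intros; apply Cmod_ge_0. }
  destruct (Nat.lt_ge_cases n N) as [Hn|Hn].
  - pose proof (rsum_term_le (fun k => Cmod (u k)) N n (fun _ _ => Cmod_ge_0 _) Hn).
    pose proof (Cmod_ge_0 l). simpl in *. lra.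
  - specialize (HN n Hn). pose proof (Cmod_triangle (u n - l) l) as T.
    replace (u n - l + l)%C with (u n) in T by ring. lra.
Qed.

Lemma geom_sum_le q n : 0 <= q < 1 -> rsum (fun k => q ^ k) n <= / (1 - q).
Proof.
  intros Hq. pose proof (rsum_geom q n) as H. pose proof (pow_le q n ltac:(lra)).
  apply Rmult_le_reg_l with (1 - q); [lra|]. rewrite H, Rinv_r; lra.
Qed.

Definition pser (a : nat -> C) (z l : C) : Prop := cser (fun n => a n * z ^ n)%C l.

Lemma pser_bound a z l : pser a z l -> exists M, forall n, Cmod (a n) * Cmod z ^ n <= M.
Proof.
  intros H. destruct (clim_bounded _ _ H) as [M HM].
  exists (M + M). intros n. rewrite <- Cmod_pow, <- Cmod_mult.
  pose proof (Cmod_triangle (csum (fun n => a n * z ^ n)%C (S n))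
                (- csum (fun n => a n * z ^ n)%C n)) as T.
  rewrite Cmod_opp in T. pose proof (HM n). pose proof (HM (S n)).
  replace (csum (fun n0 : nat => (a n0 * z ^ n0)%C) (S n) +
            - csum (fun n0 : nat => (a n0 * z ^ n0)%C) n)%C with (a n * z ^ n)%C in T
    by (simpl; ring). lra.
Qed.

Lemma coef_rsum_le (a : nat -> C) M rho r n : (forall n, Cmod (a n) * rho ^ n <= M) ->
  0 <= r < rho -> rsum (fun n => Cmod (a n) * r ^ n) n <= M * / (1 - r / rho).
Proof.
  intros H Hr.
  assert (Hq : 0 <= r / rho < 1).
  { split; [apply Rdiv_le_0_compat; lra|]. apply Rmult_lt_reg_r with rho; [lra|].
    field_simplify; lra. }
  assert (0 <= M).
  { eapply Rle_trans; [|apply (H O)]. simpl. pose proof (Cmod_ge_0 (a O)). lra. }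
  eapply Rle_trans with (rsum (fun n => M * (r / rho) ^ n) n).
  - apply rsum_le. intros k _.
    replace (Cmod (a k) * r ^ k) with (Cmod (a k) * rho ^ k * (r / rho) ^ k).
    + apply Rmult_le_compat_r; [apply pow_le; lra|auto].
    + rewrite Rmult_assoc, <- Rpow_mult_distr. do 2 f_equal. field. lra.
  - rewrite rsum_scal. apply Rmult_le_compat_l; auto. now apply geom_sum_le.
Qed.

Lemma coef_bounded_sums (a : nat -> C) M rho r : (forall n, Cmod (a n) * rho ^ n <= M) ->
  0 <= r < rho -> bounded_sums (fun n => Cmod (a n) * r ^ n).
Proof. intros H Hr. eexists. intros n. eapply coef_rsum_le; eauto. Qed.

Lemma Cmod_term (a z : C) n : Cmod (a * z ^ n)%C = Cmod a * Cmod z ^ n.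
Proof. now rewrite Cmod_mult, Cmod_pow. Qed.

Lemma pser_ex (a : nat -> C) M rho z : (forall n, Cmod (a n) * rho ^ n <= M) -> Cmod z < rho ->
  pser a z (ctot (fun n => a n * z ^ n)%C).
Proof.
  intros H Hz. apply ctot_spec with (fun n => Cmod (a n) * Cmod z ^ n).
  - intros n. rewrite Cmod_term. lra.
  - apply coef_bounded_sums with M rho; auto. split; auto. apply Cmod_ge_0.
Qed.

(** The mean is over [N + 1] points, so that the divisor never vanishes. *)
Definition mean (u : nat -> C) (N : nat) : C := (RtoC (/ INR (S N)) * csum u (S N))%C.

Lemma INR_S_pos N : 0 < INR (S N).
Proof. apply lt_0_INR. lia. Qed.

Lemma mean_ext u v N : (forall j, u j = v j) -> mean u N = mean v N.
Proof. intros H. unfold mean. f_equal. apply csum_ext. auto. Qed.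

Lemma mean_plus u v N : mean (fun j => u j + v j)%C N = (mean u N + mean v N)%C.
Proof. unfold mean. rewrite csum_plus. ring. Qed.

Lemma mean_scal c u N : mean (fun j => c * u j)%C N = (c * mean u N)%C.
Proof. unfold mean. rewrite csum_scal. ring. Qed.

Lemma Re_mean u N : Re (mean u N) = / INR (S N) * rsum (fun j => Re (u j)) (S N).
Proof. unfold mean. now rewrite re_scal_l, csum_Re. Qed.

Lemma Cmod_mean_le u M N : (forall j, Cmod (u j) <= M) -> Cmod (mean u N) <= M.
Proof.
  intros H. pose proof (INR_S_pos N) as HN. unfold mean. rewrite Cmod_mult, Cmod_R, Rabs_pos_eq.
  2:{ left. now apply Rinv_0_lt_compat. }
  apply Rmult_le_reg_l with (INR (S N)); auto. rewrite <- Rmult_assoc, Rinv_r, Rmult_1_l by lra.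
  rewrite <- rsum_const. eapply Rle_trans; [apply Cmod_csum_le|]. apply rsum_le. auto.
Qed.

Lemma mean_const c N : mean (fun _ => c) N = c.
Proof.
  unfold mean. replace (csum (fun _ => c) (S N)) with (RtoC (INR (S N)) * c)%C.
  - rewrite Cmult_assoc, <- RtoC_mult, Rinv_l; [ring|]. apply not_0_INR. lia.
  - generalize (S N). intros n. induction n as [|n IH]; [simpl; ring|].
    change (csum (fun _ => c) (S n)) with (csum (fun _ => c) n + c)%C.
    rewrite <- IH, S_INR, RtoC_plus. ring.
Qed.

(** The geometric sums stay bounded by [2 / |1 - q|] while the number of points grows. *)
Lemma mean_pow_lim (q : C) : Cmod q = 1 -> q <> 1 -> clim (mean (fun j => q ^ j)%C) 0.
Proof.
  intros Hq Hne eps He.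
  assert (Hpos : 0 < Cmod (1 - q)).
  { apply Cmod_gt_0. intros H. apply Hne.
    replace q with (1 - (1 - q))%C by ring. rewrite H. ring. }
  destruct (nfloor_ex (2 / (eps * Cmod (1 - q)))) as [N [_ HN]].
  { apply Rdiv_le_0_compat; [lra|]. apply Rmult_lt_0_compat; lra. }
  exists N. intros n Hn. pose proof (INR_S_pos n) as Hn0.
  assert (Hn1 : 2 / (eps * Cmod (1 - q)) < INR (S n)).
  { eapply Rlt_le_trans; [apply HN|]. rewrite S_INR. apply le_INR in Hn. lra. }
  replace (mean (fun j => q ^ j)%C n - 0)%C with (mean (fun j => q ^ j)%C n) by ring.
  unfold mean. rewrite Cmod_mult, Cmod_R, Rabs_pos_eq by (left; now apply Rinv_0_lt_compat).
  assert (H2 : Cmod (1 - q) * Cmod (csum (fun j => q ^ j)%C (S n)) <= 2).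
  { rewrite <- Cmod_mult, csum_geom. unfold Cminus.
    eapply Rle_trans; [apply Cmod_triangle|].
    rewrite Cmod_1, Cmod_opp, Cmod_pow, Hq, pow1. lra. }
  apply Rmult_lt_reg_l with (INR (S n) * Cmod (1 - q)).
  { now apply Rmult_lt_0_compat. }
  replace (INR (S n) * Cmod (1 - q) * (/ INR (S n) * Cmod (csum (fun j => (q ^ j)%C) (S n))))
    with (Cmod (1 - q) * Cmod (csum (fun j => (q ^ j)%C) (S n))) by (field; lra).
  eapply Rle_lt_trans; [apply H2|].
  apply Rmult_lt_compat_r with (r := eps * Cmod (1 - q)) in Hn1.
  2:{ apply Rmult_lt_0_compat; lra. }
  replace (2 / (eps * Cmod (1 - q)) * (eps * Cmod (1 - q))) with 2 in Hn1 by (field; lra).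
  lra.
Qed.

(** A point of the unit circle that is not a root of unity. Means over its powers separate the
    monomials in the limit, and so do the work of integrals over circles. *)
Definition zeta : C := (3 / 5, 4 / 5).

Lemma Cmod_zeta : Cmod zeta = 1.
Proof.
  unfold Cmod, zeta. transitivity (sqrt 1); [|apply sqrt_1]. f_equal. simpl. field.
Qed.

(** The powers of [3 + 4 i] are all congruent to [3 + 4 i] modulo 5, so their imaginary parts
    do not vanish. *)
Lemma zeta_pow_neq_1 n : (1 <= n)%nat -> (zeta ^ n)%C <> 1.
Proof.
  intros Hn.
  assert (H : exists a b : Z, (zeta ^ n)%C = (IZR (5 * a + 3) / 5 ^ n, IZR (5 * b + 4) / 5 ^ n)).
  { induction Hn as [|n Hn [a [b IH]]].
    - exists 0%Z, 0%Z. rewrite Cpow_1_r. unfold zeta. apply injective_projections;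
        cbn [fst snd pow Z.mul Z.add Pos.mul Pos.add]; field.
    - exists (3 * a - 4 * b - 2)%Z, (4 * a + 3 * b + 4)%Z.
      rewrite Cpow_S, IH. unfold zeta, Cmult. cbn [fst snd pow].
      rewrite !plus_IZR, !mult_IZR, !plus_IZR, !minus_IZR, !mult_IZR.
      f_equal; field; apply pow_nonzero; lra. }
  destruct H as [a [b ->]]. intros E. apply (f_equal snd) in E. cbn [snd RtoC] in E.
  assert (H0 : IZR (5 * b + 4) = 0).
  { apply Rmult_eq_reg_r with (/ 5 ^ n); [|apply Rinv_neq_0_compat, pow_nonzero; lra].
    unfold Rdiv in E. rewrite E. ring. }
  apply eq_IZR in H0. lia.
Qed.

Lemma Cmod_zeta_pow n : Cmod (zeta ^ n)%C = 1.
Proof. now rewrite Cmod_pow, Cmod_zeta, pow1. Qed.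

Lemma zeta_conj n : (zeta ^ n * Cconj (zeta ^ n) = 1)%C.
Proof. rewrite <- Cmod2_conj, Cmod_zeta_pow. f_equal. ring. Qed.

Lemma zeta_ratio n m : (zeta ^ n * Cconj (zeta ^ m))%C = 1 -> n = m.
Proof.
  intros H.
  assert (E : (zeta ^ n = zeta ^ m)%C).
  { rewrite <- (Cmult_1_r (zeta ^ n)), <- (zeta_conj m).
    replace (zeta ^ n * (zeta ^ m * Cconj (zeta ^ m)))%C
      with (zeta ^ n * Cconj (zeta ^ m) * zeta ^ m)%C by ring.
    rewrite H. ring. }
  assert (Hw : forall p q, (p < q)%nat -> (zeta ^ p = zeta ^ q)%C -> False).
  { intros p q Hpq Epq. apply (zeta_pow_neq_1 (q - p)); [lia|].
    replace q with (p + (q - p))%nat in Epq by lia. rewrite Cpow_add_r in Epq.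
    transitivity (zeta ^ p * zeta ^ (q - p) * Cconj (zeta ^ p))%C.
    - rewrite <- (Cmult_1_l (zeta ^ (q - p))), <- (zeta_conj p) at 1. ring.
    - rewrite <- Epq. apply zeta_conj. }
  destruct (Nat.lt_trichotomy n m) as [Hl|[Hl|Hl]]; auto; exfalso; eauto.
Qed.

Definition circle_node (r : R) (j : nat) : C := (r * zeta ^ j)%C.

Lemma Cmod_circle_node r j : 0 <= r -> Cmod (circle_node r j) = r.
Proof. intros Hr. unfold circle_node. rewrite Cmod_mult, Cmod_zeta_pow, Cmod_R, Rabs_pos_eq; lra. Qed.

(** Each monomial [z ^ n] contributes the mean of a geometric sequence of ratio
    [zeta ^ n * conj (zeta ^ m)], which tends to 0 unless [n = m]; the coefficients dominate. *)
Lemma fourier_mean (b : nat -> C) (F : C -> C) M rho r m :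
  0 <= r < rho -> (forall n, Cmod (b n) * rho ^ n <= M) ->
  (forall z, Cmod z = r -> pser b z (F z)) ->
  clim (mean (fun j => F (circle_node r j) * Cconj (zeta ^ m) ^ j)%C) (b m * r ^ m)%C.
Proof.
  intros Hr Hb HF.
  set (q := fun n => (zeta ^ n * Cconj (zeta ^ m))%C).
  set (g := fun n => (b n * r ^ n * (if Nat.eq_dec n m then 1 else 0))%C).
  apply (tannery (fun K n => (b n * r ^ n * mean (fun j => q n ^ j)%C K)%C) g
           (fun n => Cmod (b n) * r ^ n)).
  - intros K n. rewrite Cmod_mult, Cmod_term, Cmod_R, Rabs_pos_eq by lra.
    rewrite <- (Rmult_1_r (Cmod (b n) * r ^ n)) at 2. apply Rmult_le_compat_l.
    + apply Rmult_le_pos; [apply Cmod_ge_0|apply pow_le; lra].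
    + apply Cmod_mean_le. intros j. unfold q.
      rewrite Cmod_pow, Cmod_mult, Cmod_conj, !Cmod_zeta_pow, Rmult_1_r, pow1. lra.
  - eapply coef_bounded_sums; eauto.
  - intros n. apply clim_scal. destruct (Nat.eq_dec n m) as [->|Hne].
    + apply (clim_ext (fun _ => RtoC 1)); [|apply clim_const]. intros K.
      rewrite (mean_ext _ (fun _ => RtoC 1)), mean_const; auto.
      intros j. unfold q. now rewrite zeta_conj, Cpow_1_l.
    + apply mean_pow_lim.
      * unfold q. rewrite Cmod_mult, Cmod_conj, !Cmod_zeta_pow. ring.
      * intros H. apply Hne. now apply zeta_ratio.
  - intros K.
    apply (cser_ext (fun n => RtoC (/ INR (S K)) *
             csum (fun j => Cconj (zeta ^ m) ^ j * (b n * circle_node r j ^ n)) (S K))%C).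
    + intros n. unfold mean. rewrite <- csum_scal, <- csum_scal, <- csum_scal.
      apply csum_ext. intros j _. unfold q, circle_node.
      rewrite !Cpow_mult_l, <- !Cpow_mult_r, (Nat.mul_comm j n). ring.
    + unfold mean. apply cser_scal.
      rewrite (csum_ext _ (fun j => Cconj (zeta ^ m) ^ j * F (circle_node r j))%C)
        by (intros; ring).
      apply (cser_csum (fun j n => Cconj (zeta ^ m) ^ j * (b n * circle_node r j ^ n))%C).
      intros j _. apply cser_scal. apply HF. apply Cmod_circle_node. lra.
  - replace (b m * r ^ m)%C with (csum g (S m)).
    + apply cser_finite. intros k Hk. unfold g. destruct (Nat.eq_dec k m); [lia|]. ring.
    + simpl. rewrite (csum_ext g (fun _ => RtoC 0)), csum_zero.
      * unfold g. destruct (Nat.eq_dec m m); [|congruence]. ring.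
      * intros k Hk. unfold g. destruct (Nat.eq_dec k m); [lia|]. ring.
Qed.

Lemma cauchy_estimate (b : nat -> C) (F : C -> C) M rho r K m :
  0 <= r < rho -> (forall n, Cmod (b n) * rho ^ n <= M) ->
  (forall z, Cmod z = r -> pser b z (F z)) ->
  (forall z, Cmod z = r -> Cmod (F z) <= K) -> Cmod (b m) * r ^ m <= K.
Proof.
  intros Hr Hb HF HK.
  replace (Cmod (b m) * r ^ m) with (Cmod (b m * r ^ m)%C)
    by (rewrite Cmod_term, Cmod_R, Rabs_pos_eq; lra).
  apply (clim_Cmod_le _ _ _ (fourier_mean b F M rho r m Hr Hb HF)).
  intros n. apply Cmod_mean_le. intros j.
  rewrite Cmod_mult, Cmod_pow, Cmod_conj, Cmod_zeta_pow, pow1, Rmult_1_r.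
  apply HK, Cmod_circle_node. lra.
Qed.

Lemma pser_circle_bound (b : nat -> C) (F : C -> C) s : 0 <= s ->
  (forall z, Cmod z <= s -> pser b z (F z)) -> exists M, forall n, Cmod (b n) * s ^ n <= M.
Proof.
  intros Hs HF. destruct (pser_bound b s (F s)) as [M HM].
  - apply HF. rewrite Cmod_R, Rabs_pos_eq; lra.
  - exists M. intros n. specialize (HM n). now rewrite Cmod_R, Rabs_pos_eq in HM by lra.
Qed.

(** The coefficients are limits of means of values, by [fourier_mean]. *)
Lemma pser_unique (a b : nat -> C) (F : C -> C) s : 0 < s ->
  (forall z, Cmod z < s -> pser a z (F z)) ->
  (forall z, Cmod z < s -> pser b z (F z)) -> forall n, a n = b n.
Proof.
  intros Hs Ha Hb n.
  destruct (pser_circle_bound a F (s / 2)) as [M HM]; [lra|intros; apply Ha; lra|].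
  destruct (pser_circle_bound b F (s / 2)) as [K HK]; [lra|intros; apply Hb; lra|].
  assert (E : (a n * (s / 4)%R ^ n = b n * (s / 4)%R ^ n)%C).
  { eapply clim_unique.
    - apply (fourier_mean a F M (s / 2) (s / 4)); auto; [lra|intros; apply Ha; lra].
    - apply (fourier_mean b F K (s / 2) (s / 4)); auto; [lra|intros; apply Hb; lra]. }
  assert (Hnz : (RtoC (s / 4) ^ n)%C <> 0).
  { apply Cpow_nz. intros H. apply RtoC_inj in H. lra. }
  apply Ceq_minus. apply Ceq_minus in E.
  destruct (classic ((a n - b n)%C = 0)) as [|Hne]; auto. exfalso.
  apply (Cmult_neq_0 _ _ Hne Hnz). rewrite <- E. ring.
Qed.

(** * From local to global power series *)

Fixpoint pascal (n k : nat) : nat :=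
  match n, k with
  | _, O => 1
  | O, S _ => 0
  | S n', S k' => pascal n' k' + pascal n' k
  end.

Lemma pascal_gt n : forall k, (n < k)%nat -> pascal n k = O.
Proof.
  induction n as [|n IH]; intros [|k] H; simpl; try lia. rewrite !IH; lia.
Qed.

(** The coefficient of [h ^ k] in [(d + h) ^ n]. *)
Definition bterm (d : C) (n k : nat) : C := (RtoC (INR (pascal n k)) * d ^ (n - k))%C.

Lemma bterm_0 d n : bterm d n 0 = (d ^ n)%C.
Proof. unfold bterm. rewrite Nat.sub_0_r. destruct n; simpl; ring. Qed.

Lemma bterm_S d n k : bterm d (S n) (S k) = (bterm d n k + d * bterm d n (S k))%C.
Proof.
  unfold bterm. cbn [pascal Nat.sub]. rewrite plus_INR, RtoC_plus.
  destruct (Nat.lt_ge_cases k n) as [H|H].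
  - replace (n - k)%nat with (S (n - S k)) by lia. rewrite Cpow_S. ring.
  - rewrite (pascal_gt n (S k)) by lia. simpl INR. ring.
Qed.

Lemma binomial_csum d h n : forall K, (n < K)%nat ->
  csum (fun k => bterm d n k * h ^ k)%C K = ((d + h) ^ n)%C.
Proof.
  induction n as [|n IH]; intros K HK; (destruct K as [|K]; [lia|]).
  - rewrite csum_shift, (csum_ext _ (fun _ => RtoC 0)).
    + rewrite csum_zero, bterm_0. simpl. ring.
    + intros k _. unfold bterm. simpl. ring.
  - rewrite csum_shift, bterm_0.
    rewrite (csum_ext _ (fun k => h * (bterm d n k * h ^ k) + d * (bterm d n (S k) * h ^ S k))%C).
    2:{ intros k _. rewrite bterm_S, !Cpow_S. ring. }
    rewrite csum_plus, !csum_scal, IH by lia.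
    assert (E : csum (fun k => bterm d n (S k) * h ^ S k)%C K = ((d + h) ^ n - d ^ n)%C).
    { rewrite <- (IH (S K)) by lia. rewrite csum_shift, bterm_0. simpl. ring. }
    rewrite E, !Cpow_S. simpl. ring.
Qed.

Lemma binomial_rsum_le (d h : C) n K :
  rsum (fun k => Cmod (bterm d n k) * Cmod h ^ k) K <= (Cmod d + Cmod h) ^ n.
Proof.
  pose proof (Cmod_ge_0 d). pose proof (Cmod_ge_0 h).
  assert (E : forall k, Cmod (bterm d n k) * Cmod h ^ k
                = Re (bterm (Cmod d) n k * Cmod h ^ k)%C).
  { intros k. unfold bterm. rewrite Cmod_term, Cmod_R, Rabs_pos_eq by apply pos_INR.
    rewrite <- !RtoC_pow, <- !RtoC_mult, re_RtoC. reflexivity. }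
  eapply Rle_trans.
  - apply (rsum_mono _ K (max K (S n))); [|lia].
    intros k. apply Rmult_le_pos; [apply Cmod_ge_0|apply pow_le; auto].
  - rewrite (rsum_ext _ _ _ (fun k _ => E k)), <- csum_Re, binomial_csum by lia.
    rewrite <- RtoC_plus, <- RtoC_pow, re_RtoC. lra.
Qed.

(** This amounts to convergence of the power series on the open disc of radius [rho]. *)
Definition geom_bounded (b : nat -> C) (rho : R) : Prop :=
  forall s, 0 <= s < rho -> exists M, forall n, Cmod (b n) * s ^ n <= M.

(** The Taylor coefficients at [d] of the sum of the power series [b]. *)
Definition recenter (b : nat -> C) (d : C) (k : nat) : C :=
  ctot (fun n => b n * bterm d n k)%C.

Lemma recenter_row_le b d h n K :
  rsum (fun k => Cmod (b n * bterm d n k * h ^ k)%C) K <= Cmod (b n) * (Cmod d + Cmod h) ^ n.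
Proof.
  rewrite (rsum_ext _ (fun k => Cmod (b n) * (Cmod (bterm d n k) * Cmod h ^ k))).
  - rewrite rsum_scal. apply Rmult_le_compat_l; [apply Cmod_ge_0|apply binomial_rsum_le].
  - intros k _. rewrite !Cmod_mult, Cmod_pow. ring.
Qed.

Lemma geom_bounded_bounded_sums b rho s : geom_bounded b rho -> 0 <= s < rho ->
  bounded_sums (fun n => Cmod (b n) * s ^ n).
Proof.
  intros Hb Hs. destruct (Hb ((s + rho) / 2)) as [M HM]; [lra|].
  apply coef_bounded_sums with M ((s + rho) / 2); auto. lra.
Qed.

Lemma recenter_spec b rho d k : geom_bounded b rho -> Cmod d < rho ->
  cser (fun n => b n * bterm d n k)%C (recenter b d k).
Proof.
  (* Convergence is read off the column of the double series at an auxiliary [h <> 0]. *)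
  intros Hb Hd. pose proof (Cmod_ge_0 d). set (h := RtoC ((rho - Cmod d) / 2)).
  assert (Hh : Cmod h = (rho - Cmod d) / 2) by (unfold h; rewrite Cmod_R, Rabs_pos_eq; lra).
  assert (Hhk : (h ^ k)%C <> 0).
  { apply Cpow_nz. intros E. apply RtoC_inj in E. lra. }
  assert (Hc : exists l, cser (fun n => b n * bterm d n k * h ^ k)%C l).
  { eexists. apply (fubini_column (fun n k => b n * bterm d n k * h ^ k)%C
      (fun n => Cmod (b n) * (Cmod d + Cmod h) ^ n)).
    - intros. apply recenter_row_le.
    - apply geom_bounded_bounded_sums with rho; auto. lra. }
  destruct Hc as [l Hl]. unfold recenter, ctot. apply epsilon_spec.
  exists (/ h ^ k * l)%C. eapply cser_ext; [|apply (cser_scal (/ h ^ k)%C _ _ Hl)].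
  intros n. cbv beta. field. auto.
Qed.

(** Expanding [(d + h) ^ n] by the binomial formula gives a double series, dominated by
    [|b n| (|d| + |h|) ^ n]; exchange the sums. *)
Lemma recenter_pser b rho d h l : geom_bounded b rho -> Cmod d + Cmod h < rho ->
  pser b (d + h)%C l -> pser (recenter b d) h l.
Proof.
  intros Hb Hdh Hl. pose proof (Cmod_ge_0 d). pose proof (Cmod_ge_0 h).
  apply (fubini (fun n k => b n * bterm d n k * h ^ k)%C
           (fun n => Cmod (b n) * (Cmod d + Cmod h) ^ n)
           (fun n => b n * (d + h) ^ n)%C); auto.
  - intros. apply recenter_row_le.
  - apply geom_bounded_bounded_sums with rho; auto. lra.
  - intros n. rewrite <- (binomial_csum d h n (S n)), <- csum_scal by lia.
    eapply cser_ext; [|apply (cser_finite (fun k => b n * (bterm d n k * h ^ k))%C (S n))].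
    + intros k. cbv beta. ring.
    + intros k Hk. unfold bterm. rewrite pascal_gt by lia. simpl. ring.
  - intros k. cbv beta. rewrite Cmult_comm.
    eapply cser_ext; [|apply (cser_scal (h ^ k)%C); apply recenter_spec with rho; auto; lra].
    intros n. cbv beta. ring.
Qed.

Lemma pser_geom_bounded b (F : C -> C) rho :
  (forall h, Cmod h < rho -> pser b h (F h)) -> geom_bounded b rho.
Proof.
  intros H s Hs. apply pser_circle_bound with F; [lra|]. intros z Hz. apply H. lra.
Qed.

Definition represents (f : C -> C) (w : C) (rho : R) (b : nat -> C) : Prop :=
  forall h, Cmod h < rho -> pser b h (f (w + h)%C).

Lemma represents_geom_bounded f w rho b : represents f w rho b -> geom_bounded b rho.
Proof. intros H. exact (pser_geom_bounded b (fun h => f (w + h)%C) rho H). Qed.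

Lemma represents_mono f w rho rho' b : rho' <= rho -> represents f w rho b -> represents f w rho' b.
Proof. intros H Hr h Hh. apply Hr. lra. Qed.

Lemma represents_unique f w rho b c : 0 < rho ->
  represents f w rho b -> represents f w rho c -> forall n, b n = c n.
Proof. intros H Hb Hc. exact (pser_unique b c (fun h => f (w + h)%C) rho H Hb Hc). Qed.

Lemma represents_recenter f w rho b d : represents f w rho b -> Cmod d < rho ->
  represents f (w + d)%C (rho - Cmod d) (recenter b d).
Proof.
  intros Hb Hd h Hh. rewrite <- Cplus_assoc. apply recenter_pser with rho.
  - now apply (represents_geom_bounded f w).
  - lra.
  - apply Hb. eapply Rle_lt_trans; [apply Cmod_triangle|]. lra.
Qed.

Lemma clim_offset u l k : clim u l -> clim (fun n => u (n + k)%nat) l.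
Proof.
  intros H eps He. destruct (H eps He) as [N HN]. exists N. intros n Hn. apply HN. lia.
Qed.

Lemma cser_drop x l k : (forall n, (n < k)%nat -> x n = RtoC 0) -> cser x l ->
  cser (fun j => x (j + k)%nat) l.
Proof.
  intros H Hx. apply (clim_ext (fun n => csum x (n + k))); [|now apply clim_offset].
  induction n as [|n IH]; simpl.
  - rewrite (csum_ext x (fun _ => RtoC 0)), csum_zero; auto.
  - now rewrite IH.
Qed.

(** Cauchy's estimate is applied twice: to the coefficient of [h ^ k] in [f (w + h)], and then to
    that coefficient as a power series in [w], whose coefficients are [a n] times binomials. *)
Lemma binomial_estimate f s r rho a n k :
  (forall z, Cmod z < 1 -> Cmod (f z) <= 1) ->
  represents f 0 s a -> 0 < r < s -> 0 < rho -> r + rho < 1 ->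
  (forall w, Cmod w = r -> exists b rho', rho < rho' /\ represents f w rho' b) ->
  (k <= n)%nat -> Cmod (a n) * INR (pascal n k) * r ^ (n - k) * rho ^ k <= 1.
Proof.
  intros Hf Ha Hr Hrho Hr1 Hw Hk.
  assert (Hga : geom_bounded a s) by now apply (represents_geom_bounded f 0).
  set (d := fun j => (a (j + k)%nat * RtoC (INR (pascal (j + k) k)))%C).
  assert (Hd : forall w, Cmod w < s -> pser d w (recenter a w k)).
  { intros w Hws. pose proof (recenter_spec a s w k Hga Hws) as Hc.
    apply cser_drop with (k := k) in Hc.
    - eapply cser_ext; [|apply Hc]. intros j. cbv beta. unfold bterm, d.
      replace (j + k - k)%nat with j by lia. ring.
    - intros i Hi. unfold bterm. rewrite pascal_gt by lia. simpl. ring. }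
  assert (Hgd : geom_bounded d s) by now apply (pser_geom_bounded d (fun w => recenter a w k)).
  destruct (Hgd ((r + s) / 2)) as [M HM]; [lra|].
  assert (Hest : Cmod (d (n - k)%nat) * r ^ (n - k) <= / rho ^ k).
  { apply (cauchy_estimate d (fun w => recenter a w k) M ((r + s) / 2)); auto; [lra|..].
    - intros w Hwr. apply Hd. lra.
    - intros w Hwr. destruct (Hw w Hwr) as [b [rho' [Hrho' Hb]]].
      assert (Ea : represents f w (s - r) (recenter a w)).
      { rewrite <- Hwr. replace w with (0 + w)%C at 1 by ring. apply represents_recenter; auto. lra. }
      assert (E : recenter a w k = b k).
      { apply (represents_unique f w (Rmin (s - r) rho')).
        - apply Rmin_glb_lt; lra.
        - eapply represents_mono; [apply Rmin_l|auto].
        - eapply represents_mono; [apply Rmin_r|auto]. }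
      rewrite E.
      destruct (represents_geom_bounded f w rho' b Hb ((rho + rho') / 2)) as [K HK]; [lra|].
      assert (Hbk : Cmod (b k) * rho ^ k <= 1).
      { apply (cauchy_estimate b (fun h => f (w + h)%C) K ((rho + rho') / 2)); auto; [lra|..].
        - intros z Hz. apply Hb. lra.
        - intros z Hz. apply Hf. eapply Rle_lt_trans; [apply Cmod_triangle|]. lra. }
      pose proof (pow_lt rho k Hrho).
      apply Rmult_le_reg_r with (rho ^ k); auto. rewrite Rinv_l by lra. auto. }
  unfold d in Hest. replace (n - k + k)%nat with n in Hest by lia.
  rewrite Cmod_mult, (Cmod_R (INR _)), Rabs_pos_eq in Hest by apply pos_INR.
  pose proof (pow_lt rho k Hrho).
  apply Rmult_le_compat_r with (r := rho ^ k) in Hest; [|lra].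
  rewrite Rinv_l in Hest by lra. auto.
Qed.

Lemma binomial_real r rho n :
  0 <= r -> 0 <= rho ->
  rsum (fun k => INR (pascal n k) * r ^ (n - k) * rho ^ k) (S n) = (r + rho) ^ n.
Proof.
  intros Hr Hrho. apply RtoC_inj.
  rewrite RtoC_pow, RtoC_plus, <- (binomial_csum r rho n (S n)) by lia.
  generalize (S n). intros K. induction K as [|K IH]; simpl; auto.
  rewrite RtoC_plus, IH. f_equal. unfold bterm. now rewrite !RtoC_mult, !RtoC_pow.
Qed.

Lemma geom_linear_bounded q n : 0 <= q < 1 -> INR (S n) * q ^ n <= / (1 - q).
Proof.
  intros Hq. eapply Rle_trans; [|apply (geom_sum_le q (S n) Hq)].
  rewrite <- rsum_const. apply rsum_le. intros k Hk.
  replace n with (k + (n - k))%nat by lia. rewrite pow_add.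
  rewrite <- (Rmult_1_r (q ^ k)) at 2. apply Rmult_le_compat_l; [apply pow_le; lra|].
  rewrite <- (pow1 (n - k)). apply pow_incr. lra.
Qed.

(** Summing [binomial_estimate] over [k] gives [|a n| (r + rho) ^ n <= n + 1], so that the series
    at 0 converges up to [r + rho0]. Beyond [s] its sum is still [f]: around the point [w] of modulus
    [r] in the same direction, its expansion and that of [f] have the same coefficients. *)
Lemma represents_extend f s r rho0 a :
  (forall z, Cmod z < 1 -> Cmod (f z) <= 1) ->
  represents f 0 s a -> 0 < r < s -> s < r + rho0 -> r + rho0 <= 1 ->
  (forall w, Cmod w = r -> exists b, represents f w rho0 b) -> represents f 0 (r + rho0) a.
Proof.
  intros Hf Ha Hr Hs H1 Hw.
  assert (Hg : geom_bounded a (r + rho0)).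
  { intros s' Hs'. set (rho := (Rmax (s' - r) 0 + rho0) / 2).
    assert (Hm : 0 <= Rmax (s' - r) 0 < rho0).
    { split; [apply Rmax_r|]. apply Rmax_lub_lt; lra. }
    assert (Hm' : s' - r <= Rmax (s' - r) 0) by apply Rmax_l.
    assert (Hq : 0 <= s' / (r + rho) < 1).
    { unfold rho in *. split; [apply Rdiv_le_0_compat; lra|].
      apply Rmult_lt_reg_r with (r + (Rmax (s' - r) 0 + rho0) / 2); [lra|].
      unfold Rdiv at 1. rewrite Rmult_assoc, Rinv_l; lra. }
    exists (/ (1 - s' / (r + rho))). intros n.
    assert (Hn : Cmod (a n) * (r + rho) ^ n <= INR (S n)).
    { rewrite <- (binomial_real r rho n) by (unfold rho; lra).
      rewrite <- rsum_scal, <- (Rmult_1_r (INR (S n))), <- rsum_const.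
      apply rsum_le. intros k Hk. rewrite <- !Rmult_assoc.
      apply (binomial_estimate f s); auto; try (unfold rho; lra); [|lia].
      intros w Hwr. destruct (Hw w Hwr) as [b Hb]. exists b, rho0. split; auto.
      unfold rho; lra. }
    eapply Rle_trans; [|apply (geom_linear_bounded _ n Hq)].
    replace (Cmod (a n) * s' ^ n) with (Cmod (a n) * (r + rho) ^ n * (s' / (r + rho)) ^ n).
    - apply Rmult_le_compat_r; auto. apply pow_le. lra.
    - rewrite Rmult_assoc, <- Rpow_mult_distr. do 2 f_equal. field. unfold rho; lra. }
  intros z Hz. rewrite Cplus_0_l.
  destruct (Rlt_le_dec (Cmod z) s) as [Hzs|Hzs].
  { replace z with (0 + z)%C at 2 by ring. auto. }
  destruct (Hg ((Cmod z + (r + rho0)) / 2)) as [M HM].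
  { pose proof (Cmod_ge_0 z). lra. }
  pose proof (pser_ex a M _ z HM ltac:(lra)) as Hl.
  set (l := ctot (fun n => (a n * z ^ n)%C)) in *.
  enough (f z = l) as -> by auto.
  set (w := (RtoC (r / Cmod z) * z)%C). set (h := (RtoC (1 - r / Cmod z) * z)%C).
  assert (Ezwh : (w + h)%C = z) by (unfold w, h; rewrite RtoC_minus; ring).
  assert (Hrz : 0 < r / Cmod z < 1).
  { split; [apply Rdiv_lt_0_compat; lra|].
    apply Rmult_lt_reg_r with (Cmod z); [lra|]. unfold Rdiv. rewrite Rmult_assoc, Rinv_l; lra. }
  assert (Hwm : Cmod w = r).
  { unfold w. rewrite Cmod_mult, Cmod_R, Rabs_pos_eq by lra. field. lra. }
  assert (Hhm : Cmod h = Cmod z - r).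
  { unfold h. rewrite Cmod_mult, Cmod_R, Rabs_pos_eq by lra. field. lra. }
  destruct (Hw w Hwm) as [b Hb].
  assert (Hc : pser (recenter a w) h l).
  { apply recenter_pser with (r + rho0); auto; [lra|]. now rewrite Ezwh. }
  assert (Ea : represents f w (s - r) (recenter a w)).
  { rewrite <- Hwm. replace w with (0 + w)%C at 1 by ring. apply represents_recenter; auto. lra. }
  assert (Hbh : pser b h (f z)) by (rewrite <- Ezwh; apply Hb; lra).
  apply (cser_unique _ _ _ Hbh). eapply cser_ext; [|apply Hc].
  intros n. cbv beta. f_equal.
  apply (represents_unique f w (Rmin (s - r) rho0)).
  - apply Rmin_glb_lt; lra.
  - eapply represents_mono; [apply Rmin_l|auto].
  - eapply represents_mono; [apply Rmin_r|auto].
Qed.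

(** Compactness of a square containing the disc; the points of the square outside the disc are
    given neighbourhoods that avoid the disc. *)
Lemma closed_disk_compact (Q : C -> R -> Prop) (R0 : R) : R0 < 1 ->
  (forall z x y, Q z x -> 0 < y <= x -> Q z y) ->
  (forall w, Cmod w <= R0 -> exists d, 0 < d /\ forall k, Cmod k < d -> Q (w + k)%C d) ->
  exists d, 0 < d /\ forall z, Cmod z <= R0 -> Q z d.
Proof.
  intros HR Hmono Hloc.
  assert (Hd : forall w : C, exists d : posreal,
    (forall k, Cmod k < 2 * d -> Q (w + k)%C d) \/ R0 + 2 * d <= Cmod w).
  { intros w. destruct (Rle_lt_dec (Cmod w) R0) as [Hw|Hw].
    - destruct (Hloc w Hw) as [d [Hd HQ]].
      assert (Hp : 0 < d / 2) by lra. exists (mkposreal _ Hp). left. simpl. intros k Hk.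
      apply Hmono with d; [apply HQ|]; lra.
    - assert (Hp : 0 < (Cmod w - R0) / 2) by lra. exists (mkposreal _ Hp). right. simpl. lra. }
  destruct (choice _ Hd) as [delta Hdelta].
  destruct (compactness_value_2d (-1) 1 (-1) 1 (fun u v => delta (u, v))) as [d Hdel].
  exists d. split; [apply cond_pos|]. intros [x y] Hz.
  pose proof (Rmax_Cmod (x, y)) as Hm. simpl in Hm.
  assert (Hx : Rabs x <= Cmod (x, y)) by (eapply Rle_trans; [apply Rmax_l|apply Hm]).
  assert (Hy : Rabs y <= Cmod (x, y)) by (eapply Rle_trans; [apply Rmax_r|apply Hm]).
  apply Rabs_le_between in Hx. apply Rabs_le_between in Hy.
  specialize (Hdel x y ltac:(lra) ltac:(lra)). apply NNPP in Hdel.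
  destruct Hdel as [u [v [_ [_ [Hxu [Hyv Hle]]]]]].
  specialize (Hdelta (u, v)). set (e := delta (u, v)) in *.
  set (k := ((x, y) - (u, v))%C).
  assert (Hk : Cmod k < 2 * e).
  { replace k with (RtoC (x - u) + Ci * RtoC (y - v))%C.
    - eapply Rle_lt_trans; [apply Cmod_triangle|].
      rewrite Cmod_mult, Cmod_Ci, !Cmod_R. lra.
    - unfold k. apply injective_projections; simpl; ring. }
  assert (Ek : ((u, v) + k = (x, y))%C) by (unfold k; ring).
  destruct Hdelta as [HQ|Huv].
  - rewrite <- Ek. apply Hmono with e; auto. split; auto. apply cond_pos.
  - pose proof (Cmod_triangle (x, y) (- k)) as T. rewrite Cmod_opp in T.
    replace ((x, y) + - k)%C with ((u, v) : C) in T
      by (rewrite <- Ek; unfold Cplus, Copp; simpl; f_equal; ring). lra.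
Qed.

Lemma uniform_radius f (R0 : R) : R0 < 1 ->
  (forall w, Cmod w < 1 -> exists rho b, 0 < rho /\ represents f w rho b) ->
  exists rho0, 0 < rho0 /\ forall w, Cmod w <= R0 -> exists b, represents f w rho0 b.
Proof.
  intros HR Hloc. apply (closed_disk_compact (fun w rho => exists b, represents f w rho b)); auto.
  - intros w x y [b Hb] Hy. exists b. apply represents_mono with x; auto. lra.
  - intros w Hw. destruct (Hloc w) as [rho [b [Hrho Hb]]]; [lra|].
    exists (rho / 2). split; [lra|]. intros k Hk. exists (recenter b k).
    apply represents_mono with (rho - Cmod k); [lra|]. apply represents_recenter; auto. lra.
Qed.

(** On [|w| <= R0] the local radii have a positive lower bound [rho0], and each use of
    [represents_extend] enlarges the disc of the series at 0 by [rho0 / 2] until it passes [R0]. *)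
Lemma local_to_global f :
  (forall z, Cmod z < 1 -> Cmod (f z) <= 1) ->
  (forall w, Cmod w < 1 -> exists rho b, 0 < rho /\ represents f w rho b) ->
  exists a, represents f 0 1 a.
Proof.
  intros Hf Hloc.
  assert (HR : forall R0, 0 < R0 < 1 -> exists a, represents f 0 R0 a).
  { intros R0 HR0. destruct (uniform_radius f R0) as [rho1 [Hrho1 H1]]; [lra|auto|].
    (* The discs of radius [rho0] centred in [|w| <= R0] stay inside the unit disk. *)
    set (rho0 := Rmin rho1 (1 - R0)).
    assert (Hrho0 : 0 < rho0) by (apply Rmin_glb_lt; lra).
    assert (Hle : rho0 <= 1 - R0) by apply Rmin_r.
    assert (H0 : forall w, Cmod w <= R0 -> exists b, represents f w rho0 b).
    { intros w Hw. destruct (H1 w Hw) as [b Hb]. exists b.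
      apply represents_mono with rho1; auto. apply Rmin_l. }
    assert (Hstep : forall n, exists a, represents f 0 (Rmin R0 (rho0 + INR n * (rho0 / 2))) a).
    { induction n as [|n [a IH]].
      - destruct (H0 0%C) as [b Hb]; [rewrite Cmod_0; lra|]. exists b.
        apply represents_mono with rho0; auto. simpl. rewrite Rmult_0_l, Rplus_0_r. apply Rmin_r.
      - exists a. set (s := rho0 + INR n * (rho0 / 2)) in *.
        assert (Hs : rho0 <= s).
        { unfold s. pose proof (pos_INR n).
          assert (0 <= INR n * (rho0 / 2)) by (apply Rmult_le_pos; lra). lra. }
        destruct (Rle_lt_dec R0 s) as [HsR|HsR].
        + apply represents_mono with (Rmin R0 s); auto. rewrite (Rmin_left R0 s) by auto. apply Rmin_l.
        + rewrite Rmin_right in IH by lra.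
          apply represents_mono with (s - rho0 / 2 + rho0).
          * rewrite S_INR. eapply Rle_trans; [apply Rmin_r|]. unfold s. lra.
          * apply represents_extend with s; auto; try lra. intros w Hw. apply H0. lra. }
    destruct (nfloor_ex (2 / rho0)) as [N [_ HN]]; [apply Rdiv_le_0_compat; lra|].
    destruct (Hstep (S N)) as [a Ha]. exists a. rewrite Rmin_left in Ha; auto.
    apply Rmult_lt_compat_r with (r := rho0 / 2) in HN; [|lra].
    rewrite S_INR. replace (2 / rho0 * (rho0 / 2)) with 1 in HN by (field; lra). lra. }
  destruct (HR (1 / 2)) as [a Ha]; [lra|]. exists a.
  intros z Hz. set (R0 := Rmax ((1 + Cmod z) / 2) (1 / 2)).
  assert (HR0 : 1 / 2 <= R0) by apply Rmax_r.
  assert (HR1 : (1 + Cmod z) / 2 <= R0) by apply Rmax_l.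
  assert (HR2 : R0 < 1) by (apply Rmax_lub_lt; lra).
  destruct (HR R0) as [b Hb]; [lra|].
  eapply cser_ext; [|apply (Hb z); lra]. intros n. cbv beta. f_equal.
  apply (represents_unique f 0 (1 / 2)); auto; [lra|]. apply represents_mono with R0; auto.
Qed.

(** * Holomorphic functions on the disk *)

Definition disk_series (a : nat -> C) (F : C -> C) : Prop :=
  forall z, Cmod z < 1 -> pser a z (F z).

(** For bounded functions, [local_to_global] identifies this with local analyticity. In this form
    products and composites are statements on coefficients. *)
Definition holomorphic (F : C -> C) : Prop := exists a, disk_series a F.

Lemma disk_series_geom_bounded a F : disk_series a F -> geom_bounded a 1.
Proof. apply pser_geom_bounded. Qed.

Lemma disk_series_ext a F G : (forall z, Cmod z < 1 -> F z = G z) -> disk_series a F -> disk_series a G.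
Proof. intros H Ha z Hz. rewrite <- H; auto. Qed.

Lemma holomorphic_ext F G : (forall z, Cmod z < 1 -> F z = G z) -> holomorphic F -> holomorphic G.
Proof. intros H [a Ha]. exists a. now apply disk_series_ext with F. Qed.

Lemma disk_series_plus a b F G : disk_series a F -> disk_series b G ->
  disk_series (fun n => a n + b n)%C (fun z => F z + G z)%C.
Proof.
  intros Ha Hb z Hz. eapply cser_ext; [|apply cser_plus; [apply Ha|apply Hb]; auto].
  intros n. cbv beta. ring.
Qed.

Lemma disk_series_scal c a F : disk_series a F -> disk_series (fun n => c * a n)%C (fun z => c * F z)%C.
Proof.
  intros Ha z Hz. eapply cser_ext; [|apply cser_scal, Ha; auto].
  intros n. cbv beta. ring.
Qed.

Lemma holomorphic_plus F G : holomorphic F -> holomorphic G -> holomorphic (fun z => F z + G z)%C.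
Proof. intros [a Ha] [b Hb]. eexists. apply disk_series_plus; eauto. Qed.

Lemma holomorphic_scal c F : holomorphic F -> holomorphic (fun z => c * F z)%C.
Proof. intros [a Ha]. eexists. apply disk_series_scal; eauto. Qed.

Lemma disk_series_finite (a : nat -> C) F m : (forall k, (m <= k)%nat -> a k = 0) ->
  (forall z, Cmod z < 1 -> csum (fun n => a n * z ^ n)%C m = F z) -> disk_series a F.
Proof.
  intros Ha HF z Hz. unfold pser. rewrite <- HF by auto. apply cser_finite.
  intros k Hk. rewrite Ha by auto. ring.
Qed.

Lemma holomorphic_const c : holomorphic (fun _ => c).
Proof.
  exists (fun n => match n with O => c | _ => 0 end). apply disk_series_finite with 1%nat.
  - intros [|k] Hk; [lia|auto].
  - intros z Hz. simpl. ring.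
Qed.

Lemma holomorphic_id : holomorphic (fun z => z).
Proof.
  exists (fun n => if Nat.eq_dec n 1 then 1 else 0). apply disk_series_finite with 2%nat.
  - intros k Hk. destruct (Nat.eq_dec k 1); [lia|auto].
  - intros z Hz. simpl. ring.
Qed.

Lemma Cmod_lt_1_minus_neq b z : Cmod b <= 1 -> Cmod z < 1 -> (1 - b * z)%C <> 0.
Proof.
  intros Hb Hz H. assert (E : (b * z)%C = 1).
  { replace (b * z)%C with (1 - (1 - b * z))%C by ring. rewrite H. ring. }
  apply (f_equal Cmod) in E. rewrite Cmod_mult, Cmod_1 in E.
  pose proof (Cmod_ge_0 z). pose proof (Cmod_ge_0 b).
  assert (Cmod b * Cmod z <= 1 * Cmod z) by (apply Rmult_le_compat_r; auto). lra.
Qed.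

Lemma clim_pow0 (q : C) : Cmod q < 1 -> clim (fun n => q ^ n)%C 0.
Proof.
  intros Hq eps He. pose proof (Cmod_ge_0 q).
  destruct (pow_lt_1_zero (Cmod q)) with eps as [N HN]; auto.
  { rewrite Rabs_pos_eq; auto. }
  exists N. intros n Hn. replace (q ^ n - 0)%C with (q ^ n)%C by ring.
  specialize (HN n Hn). rewrite Rabs_pos_eq in HN by (apply pow_le; auto).
  now rewrite Cmod_pow.
Qed.

Lemma holomorphic_geom b : Cmod b <= 1 -> holomorphic (fun z => / (1 - b * z))%C.
Proof.
  intros Hb. exists (fun n => b ^ n)%C. intros z Hz.
  assert (Hne : (1 - b * z)%C <> 0) by now apply Cmod_lt_1_minus_neq.
  assert (Hbz : Cmod (b * z)%C < 1).
  { rewrite Cmod_mult. pose proof (Cmod_ge_0 z). pose proof (Cmod_ge_0 b).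
    assert (Cmod b * Cmod z <= 1 * Cmod z) by (apply Rmult_le_compat_r; auto). lra. }
  replace (/ (1 - b * z))%C with (/ (1 - b * z) * (1 + - (1) * 0))%C by (field; auto).
  apply (clim_ext (fun n => / (1 - b * z) * (1 + - (1) * (b * z) ^ n))%C).
  - intros n. rewrite (csum_ext _ (fun k => (b * z) ^ k)%C).
    + replace (1 + - (1) * (b * z) ^ n)%C with (1 - (b * z) ^ n)%C by ring.
      rewrite <- csum_geom. field. auto.
    + intros k _. now rewrite Cpow_mult_l.
  - apply clim_scal, clim_plus; [apply clim_const|]. apply clim_scal. now apply clim_pow0.
Qed.

Lemma rsum_split a n m : rsum a (n + m) = rsum a n + rsum (fun k => a (n + k)%nat) m.
Proof.
  induction m as [|m IH]; [rewrite Nat.add_0_r; simpl; ring|].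
  rewrite Nat.add_succ_r. simpl. rewrite IH. ring.
Qed.

Lemma cser_undrop x l k : (forall n, (n < k)%nat -> x n = RtoC 0) ->
  cser (fun j => x (j + k)%nat) l -> cser x l.
Proof.
  intros H Hx eps He. destruct (Hx eps He) as [N HN]. exists (N + k)%nat. intros n Hn.
  replace n with ((n - k) + k)%nat by lia.
  replace (csum x (n - k + k)) with (csum (fun j => x (j + k)%nat) (n - k)).
  - apply HN. lia.
  - generalize (n - k)%nat. intros m. induction m as [|m IH]; simpl.
    + now rewrite (csum_ext x (fun _ => RtoC 0)), csum_zero.
    + now rewrite IH.
Qed.

(** The Cauchy product, as an exchange of sums. *)
Lemma holomorphic_mult F G : holomorphic F -> holomorphic G -> holomorphic (fun z => F z * G z)%C.
Proof.
  intros [a Ha] [b Hb]. exists (fun k => csum (fun n => a n * b (k - n)%nat)%C (S k)).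
  intros z Hz. pose proof (Cmod_ge_0 z).
  pose proof (geom_bounded_bounded_sums a 1 (Cmod z) (disk_series_geom_bounded a F Ha) ltac:(lra)) as Hsa.
  pose proof (geom_bounded_bounded_sums b 1 (Cmod z) (disk_series_geom_bounded b G Hb) ltac:(lra)) as Hsb.
  destruct Hsb as [B HB].
  assert (HB0 : 0 <= B) by exact (HB O).
  set (x := fun n k => if le_dec n k then (a n * z ^ n * (b (k - n)%nat * z ^ (k - n)))%C else RtoC 0).
  assert (Hx0 : forall n j, x n (j + n)%nat = (a n * z ^ n * (b j * z ^ j))%C).
  { intros n j. unfold x. destruct (le_dec n (j + n)); [|lia].
    now replace (j + n - n)%nat with j by lia. }
  assert (Hx1 : forall n k, (k < n)%nat -> x n k = 0).
  { intros n k Hk. unfold x. destruct (le_dec n k); [lia|auto]. }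
  apply (fubini x (fun n => B * (Cmod (a n) * Cmod z ^ n)) (fun n => a n * z ^ n * G z)%C).
  - intros n K. eapply Rle_trans.
    + apply (rsum_mono _ K (n + K)); [intros; apply Cmod_ge_0|lia].
    + rewrite rsum_split, (rsum_ext _ (fun _ => 0) n), rsum_const.
      * rewrite (rsum_ext _ (fun j => Cmod (a n) * Cmod z ^ n * (Cmod (b j) * Cmod z ^ j))).
        -- rewrite rsum_scal, Rmult_0_r, Rplus_0_l, Rmult_comm.
           apply Rmult_le_compat_r; auto. apply Rmult_le_pos; [apply Cmod_ge_0|].
           now apply pow_le.
        -- intros j _. rewrite Nat.add_comm, Hx0, !Cmod_mult, !Cmod_pow. ring.
      * intros k Hk. now rewrite Hx1, Cmod_0.
  - now apply bounded_sums_scal.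
  - intros n. apply (cser_undrop _ _ n); auto.
    eapply cser_ext; [|apply cser_scal, (Hb z Hz)]. intros j. cbv beta. now rewrite Hx0.
  - intros k.
    replace (csum (fun n => a n * b (k - n)%nat)%C (S k) * z ^ k)%C with (csum (fun n => x n k) (S k)).
    + apply cser_finite. intros n Hn. apply Hx1. lia.
    + rewrite Cmult_comm, <- csum_scal. apply csum_ext. intros n Hn.
      unfold x. destruct (le_dec n k); [|lia].
      replace (z ^ k)%C with (z ^ n * z ^ (k - n))%C; [ring|].
      rewrite <- Cpow_add_r. f_equal. lia.
  - rewrite Cmult_comm. eapply cser_ext; [|apply (cser_scal (G z)), (Ha z Hz)].
    intros n. cbv beta. ring.
Qed.

Lemma holomorphic_pow F n : holomorphic F -> holomorphic (fun z => F z ^ n)%C.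
Proof.
  intros HF. induction n as [|n IH]; [apply (holomorphic_const 1)|]. now apply holomorphic_mult.
Qed.

(** The terms of positive degree are at most [2 M |h| / t] together, for [|h| <= t / 2] and [M] a
    bound for [|b n| t ^ n]. *)
Lemma represents_continuous f w rho b : 0 < rho -> represents f w rho b ->
  forall eps, 0 < eps -> exists d, 0 < d /\ forall h, Cmod h < d -> Cmod (f (w + h)%C - f w) < eps.
Proof.
  intros Hrho Hb eps He.
  destruct (represents_geom_bounded f w rho b Hb (rho / 2)) as [M HM]; [lra|].
  assert (HM0 : 0 <= M).
  { eapply Rle_trans; [|apply (HM O)]. simpl. pose proof (Cmod_ge_0 (b O)). lra. }
  assert (Hfw : f w = b O).
  { assert (H0 : pser b 0 (f w)).
    { replace w with (w + 0)%C by ring. apply Hb. rewrite Cmod_0. lra. }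
    apply (cser_unique _ _ _ H0).
    replace (b O) with (csum (fun n => b n * 0 ^ n)%C 1) by (simpl; ring).
    apply cser_finite. intros [|k] Hk; [lia|]. simpl. ring. }
  set (t := rho / 2) in *. set (d := Rmin (t / 2) (t * (eps / (2 * M + 1) / 2))).
  assert (Hd : 0 < d).
  { apply Rmin_glb_lt; unfold t; [lra|]. apply Rmult_lt_0_compat; [lra|].
    apply Rdiv_lt_0_compat; [|lra]. apply Rdiv_lt_0_compat; lra. }
  exists d. split; auto. intros h Hh.
  assert (Hh1 : Cmod h < t / 2) by (eapply Rlt_le_trans; [apply Hh|apply Rmin_l]).
  assert (Hh2 : Cmod h < t * (eps / (2 * M + 1) / 2))
    by (eapply Rlt_le_trans; [apply Hh|apply Rmin_r]).
  pose proof (Cmod_ge_0 h) as Hh0.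
  set (q := Cmod h / t).
  assert (Ht : 0 < t) by (unfold t; lra).
  assert (Hqt : q * t = Cmod h) by (unfold q; field; lra).
  assert (Hq : 0 <= q <= 1 / 2).
  { split; [apply Rdiv_le_0_compat; lra|]. apply Rmult_le_reg_r with t; lra. }
  assert (Hq2 : q < eps / (2 * M + 1) / 2) by (apply Rmult_lt_reg_r with t; lra).
  pose proof (Hb h ltac:(unfold t in *; lra)) as Hs.
  assert (Hs' : exists l, cser (fun n => b (S n) * h ^ S n)%C l).
  { apply cser_ex with (fun n => M * q * q ^ n).
    - intros n. rewrite Cmod_term. replace (M * q * q ^ n) with (M * q ^ S n) by (simpl; ring).
      rewrite <- Hqt, Rpow_mult_distr, (Rmult_comm (q ^ _)), <- Rmult_assoc.
      apply Rmult_le_compat_r; [apply pow_le; lra|auto].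
    - apply bounded_sums_scal; [apply Rmult_le_pos; lra|].
      eexists. intros n. apply geom_sum_le. lra. }
  destruct Hs' as [l Hl].
  assert (El : f (w + h)%C = (b O + l)%C).
  { apply (cser_unique _ _ _ Hs). replace (b O) with (b O * h ^ 0)%C by (simpl; ring).
    now apply (cser_shift (fun n => b n * h ^ n)%C). }
  rewrite El, Hfw. replace (b O + l - b O)%C with l by ring.
  apply Rle_lt_trans with (M * q * / (1 - q)).
  - apply (cser_Cmod_le _ _ _ Hl). intros n.
    apply Rle_trans with (rsum (fun k => M * q * q ^ k) n).
    + apply rsum_le. intros k _. rewrite Cmod_term.
      replace (M * q * q ^ k) with (M * q ^ S k) by (simpl; ring).
      rewrite <- Hqt, Rpow_mult_distr, (Rmult_comm (q ^ _)), <- Rmult_assoc.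
      apply Rmult_le_compat_r; [apply pow_le; lra|auto].
    + rewrite rsum_scal. apply Rmult_le_compat_l; [apply Rmult_le_pos; lra|].
      apply geom_sum_le. lra.
  - apply Rle_lt_trans with (2 * M * q).
    + replace (2 * M * q) with (M * q * 2) by ring.
      apply Rmult_le_compat_l; [apply Rmult_le_pos; lra|].
      replace 2 with (/ / 2) by field. apply Rinv_le_contravar; lra.
    + apply Rle_lt_trans with (2 * M * (eps / (2 * M + 1) / 2)).
      * apply Rmult_le_compat_l; lra.
      * apply Rmult_lt_reg_r with (2 * M + 1); [lra|]. field_simplify; [|lra]. nra.
Qed.

Lemma disk_series_represents a F w : disk_series a F -> Cmod w < 1 ->
  represents F w (1 - Cmod w) (recenter a w).
Proof.
  intros Ha Hw. replace w with (0 + w)%C at 1 by ring. apply represents_recenter; auto.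
  intros h Hh. rewrite Cplus_0_l. auto.
Qed.

Lemma holomorphic_sup_lt f R0 : R0 < 1 -> holomorphic f -> (forall z, Cmod z < 1 -> Cmod (f z) < 1) ->
  exists rho, 0 <= rho < 1 /\ forall z, Cmod z <= R0 -> Cmod (f z) <= rho.
Proof.
  intros HR [a Ha] Hf.
  destruct (closed_disk_compact (fun z d => Cmod (f z) <= 1 - d) R0 HR) as [d [Hd Hsup]].
  - intros z x y Hx Hy. lra.
  - intros w Hw. assert (Hw1 : Cmod w < 1) by lra. pose proof (Hf w Hw1) as Hfw.
    destruct (represents_continuous f w (1 - Cmod w) _ ltac:(lra) (disk_series_represents a f w Ha Hw1)
      ((1 - Cmod (f w)) / 2)) as [d [Hd Hc]]; [lra|].
    pose proof (Rmin_l d ((1 - Cmod (f w)) / 2)). pose proof (Rmin_r d ((1 - Cmod (f w)) / 2)).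
    exists (Rmin d ((1 - Cmod (f w)) / 2)). split; [apply Rmin_glb_lt; lra|].
    intros k Hk. specialize (Hc k ltac:(lra)).
    pose proof (Cmod_triangle (f (w + k)%C - f w) (f w)) as T.
    replace (f (w + k) - f w + f w)%C with (f (w + k)%C) in T by ring. lra.
  - exists (Rmax 0 (1 - d)). split.
    + split; [apply Rmax_l|]. apply Rmax_lub_lt; lra.
    + intros z Hz. eapply Rle_trans; [now apply Hsup|apply Rmax_r].
Qed.

(** If [|phi| <= rho < 1] on [|z| = r], Cauchy's estimate bounds the coefficient of [z ^ k] in
    [phi ^ n] by [rho ^ n / r ^ k]. This dominates the double series of [G (phi z)]. *)
Lemma holomorphic_comp G phi : holomorphic G -> holomorphic phi ->
  (forall z, Cmod z < 1 -> Cmod (phi z) < 1) ->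
  holomorphic (fun z => G (phi z)).
Proof.
  intros [g Hg] Hphi Hlt.
  destruct (choice (fun n p => disk_series p (fun z => phi z ^ n)%C) (fun n => holomorphic_pow phi n Hphi))
    as [p Hp].
  exists (fun k => ctot (fun n => g n * p n k)%C). intros z Hz.
  pose proof (Cmod_ge_0 z) as Hz0. set (r := (1 + Cmod z) / 2).
  assert (Hr : Cmod z < r < 1) by (unfold r; lra).
  destruct (holomorphic_sup_lt phi r ltac:(lra) Hphi Hlt) as [rho [Hrho Hsup]].
  assert (Hpb : forall n k, Cmod (p n k) * r ^ k <= rho ^ n).
  { intros n k.
    destruct (disk_series_geom_bounded _ _ (Hp n) ((r + 1) / 2)) as [M HM]; [lra|].
    apply (cauchy_estimate (p n) (fun z => phi z ^ n)%C M ((r + 1) / 2)); auto; [lra|..].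
    - intros w Hw. apply Hp. lra.
    - intros w Hw. rewrite Cmod_pow. apply pow_incr. split; [apply Cmod_ge_0|].
      apply Hsup. lra. }
  pose proof (geom_bounded_bounded_sums g 1 rho (disk_series_geom_bounded g G Hg) ltac:(lra)) as Hbs.
  assert (Hq : 0 <= Cmod z / r < 1).
  { split; [apply Rdiv_le_0_compat; lra|]. apply Rmult_lt_reg_r with r; [lra|].
    unfold Rdiv. rewrite Rmult_assoc, Rinv_l; lra. }
  assert (Hcol : forall k, cser (fun n => g n * p n k)%C (ctot (fun n => g n * p n k)%C)).
  { intros k. apply ctot_spec with (fun n => / r ^ k * (Cmod (g n) * rho ^ n)).
    - intros n. pose proof (pow_lt r k ltac:(lra)) as Hrk. rewrite Cmod_mult.
      apply Rmult_le_reg_l with (r ^ k); auto.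
      replace (r ^ k * (/ r ^ k * (Cmod (g n) * rho ^ n))) with (Cmod (g n) * rho ^ n)
        by (field; lra).
      rewrite Rmult_comm, Rmult_assoc. apply Rmult_le_compat_l; [apply Cmod_ge_0|apply Hpb].
    - apply bounded_sums_scal; auto. left. apply Rinv_0_lt_compat, pow_lt. lra. }
  apply (fubini (fun n k => g n * p n k * z ^ k)%C
           (fun n => / (1 - Cmod z / r) * (Cmod (g n) * rho ^ n)) (fun n => g n * phi z ^ n)%C).
  - intros n K. apply Rle_trans with (rsum (fun k => Cmod (g n) * rho ^ n * (Cmod z / r) ^ k) K).
    + apply rsum_le. intros k _. rewrite !Cmod_mult, Cmod_pow, !Rmult_assoc.
      apply Rmult_le_compat_l; [apply Cmod_ge_0|].
      replace (Cmod z ^ k) with (r ^ k * (Cmod z / r) ^ k)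
        by (rewrite <- Rpow_mult_distr; f_equal; field; lra).
      rewrite <- Rmult_assoc. apply Rmult_le_compat_r; [apply pow_le; lra|apply Hpb].
    + rewrite rsum_scal, Rmult_comm. apply Rmult_le_compat_r; [|now apply geom_sum_le].
      apply Rmult_le_pos; [apply Cmod_ge_0|apply pow_le; lra].
  - apply bounded_sums_scal; auto. left. apply Rinv_0_lt_compat. lra.
  - intros n. eapply cser_ext; [|apply (cser_scal (g n)), (Hp n z Hz)].
    intros k. cbv beta. ring.
  - intros k. cbv beta. rewrite Cmult_comm.
    eapply cser_ext; [|apply (cser_scal (z ^ k)%C), Hcol].
    intros n. cbv beta. ring.
  - apply Hg. auto.
Qed.

(** * Harmonic majorants and the Hardy norm *)

Lemma csum_conj a n : Cconj (csum a n) = csum (fun k => Cconj (a k)) n.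
Proof.
  induction n as [|n IH]; simpl.
  - apply injective_projections; simpl; ring.
  - now rewrite Cplus_conj, IH.
Qed.

Lemma Cconj_R (x : R) : Cconj x = RtoC x.
Proof. apply injective_projections; simpl; ring. Qed.

(** The limit form of Parseval's formula against a polynomial. *)
Lemma fourier_pairing (b c : nat -> C) F M rho r m :
  0 <= r < rho -> (forall n, Cmod (b n) * rho ^ n <= M) ->
  (forall z, Cmod z = r -> pser b z (F z)) ->
  clim (mean (fun j => F (circle_node r j) * Cconj (csum (fun k => c k * circle_node r j ^ k) m))%C)
       (csum (fun k => b k * r ^ k * Cconj (c k * r ^ k)) m)%C.
Proof.
  intros Hr Hb HF.
  apply (clim_ext (fun N => csum (fun k => Cconj (c k * r ^ k) *
           mean (fun j => F (circle_node r j) * Cconj (zeta ^ k) ^ j) N)%C m)).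
  - intros N. unfold mean.
    rewrite (csum_ext _ (fun k => RtoC (/ INR (S N)) * csum (fun j => Cconj (c k * r ^ k) *
       (F (circle_node r j) * Cconj (zeta ^ k) ^ j)) (S N))%C) by (intros; rewrite csum_scal; ring).
    rewrite csum_scal. f_equal. rewrite csum_exchange. apply csum_ext. intros j _.
    rewrite csum_conj, <- csum_scal. apply csum_ext. intros k _.
    unfold circle_node. rewrite !Cmult_conj, !Cpow_conj, !Cmult_conj, Cpow_mult_l, Cconj_R, !Cpow_conj.
    rewrite <- !Cpow_mult_r, (Nat.mul_comm j k). ring.
  - rewrite (csum_ext _ (fun k => Cconj (c k * r ^ k) * (b k * r ^ k))%C) by (intros; ring).
    apply (clim_csum (fun N k => Cconj (c k * r ^ k) *
           mean (fun j => F (circle_node r j) * Cconj (zeta ^ k) ^ j) N)%C).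
    intros k _. apply clim_scal. eapply fourier_mean; eauto.
Qed.

Lemma bernoulli_le e n : 0 <= e <= 1 -> 1 - INR n * e <= (1 - e) ^ n.
Proof.
  intros He. induction n as [|n IH]; [simpl; lra|]. rewrite S_INR. simpl.
  pose proof (pos_INR n). destruct (Rle_lt_dec (1 - INR n * e) 0) as [Hneg|Hpos].
  - assert (0 <= (1 - e) * (1 - e) ^ n) by (apply Rmult_le_pos; [lra|apply pow_le; lra]).
    lra.
  - apply Rle_trans with ((1 - e) * (1 - INR n * e)).
    + assert (0 <= INR n * e * e) by (apply Rmult_le_pos; [apply Rmult_le_pos|]; lra). lra.
    + apply Rmult_le_compat_l; lra.
Qed.

Lemma Re_mult_conj (x y : C) : 2 * Re (x * Cconj y)%C <= Cmod x ^ 2 + Re (y * Cconj y)%C.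
Proof.
  rewrite <- Cmod2_conj, re_RtoC, !Cmod2_alt. destruct x as [a b], y as [c d]. simpl.
  pose proof (pow2_ge_0 (a - c)). pose proof (pow2_ge_0 (b - d)). simpl in *. nra.
Qed.

(** For a Taylor polynomial [p] of [G], [2 Re (G conj p) <= |G|^2 + |p|^2 <= Re K + |p|^2] on the
    circle of radius [r]. In the mean, both pairings with [p] tend to the sum of
    [|a k|^2 r ^ (2 k)], and [Re K] tends to its value at the centre. *)
Lemma hardy_majorant a G K : disk_series a G -> holomorphic K ->
  (forall z, Cmod z < 1 -> Cmod (G z) ^ 2 <= Re (K z)) ->
  forall n, rsum (fun k => Cmod (a k) ^ 2) n <= Re (K 0).
Proof.
  intros Ha [b Hb] Hmaj n.
  assert (HK0 : K 0 = b O).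
  { assert (H0 : pser b 0 (K 0)) by (apply Hb; rewrite Cmod_0; lra).
    apply (cser_unique _ _ _ H0).
    replace (b O) with (csum (fun n => b n * 0 ^ n)%C 1) by (simpl; ring).
    apply cser_finite. intros [|k] Hk; [lia|]. simpl. ring. }
  assert (HKpos : 0 <= Re (K 0)).
  { eapply Rle_trans; [|apply Hmaj; rewrite Cmod_0; lra]. apply pow2_ge_0. }
  assert (Hr : forall r, 0 <= r < 1 ->
             rsum (fun k => Cmod (a k) ^ 2 * r ^ (2 * k)) n <= Re (K 0)).
  { intros r Hr. set (s := (1 + r) / 2).
    destruct (disk_series_geom_bounded a G Ha s) as [M HM]; [unfold s; lra|].
    destruct (disk_series_geom_bounded b K Hb s) as [M' HM']; [unfold s; lra|].
    set (S := csum (fun k => a k * r ^ k * Cconj (a k * r ^ k))%C n).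
    assert (HS : Re S = rsum (fun k => Cmod (a k) ^ 2 * r ^ (2 * k)) n).
    { unfold S. rewrite csum_Re. apply rsum_ext. intros k _.
      rewrite <- Cmod2_conj, re_RtoC, Cmod_term, Cmod_R, Rabs_pos_eq by lra.
      rewrite Rpow_mult_distr, <- !pow_mult. do 2 f_equal. lia. }
    set (p := fun z => csum (fun k => a k * z ^ k)%C n).
    set (trunc := fun k => if le_dec n k then RtoC 0 else a k).
    assert (Hat : forall k, (k < n)%nat -> trunc k = a k).
    { intros k Hk. unfold trunc. destruct (le_dec n k); [lia|auto]. }
    assert (L1 : clim (mean (fun j => G (circle_node r j) * Cconj (p (circle_node r j)))%C) S).
    { apply (fourier_pairing a a G M s); auto; [unfold s; lra|]. intros z Hz. apply Ha. lra. }
    assert (L2 : clim (mean (fun j => p (circle_node r j) * Cconj (p (circle_node r j)))%C) S).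
    { unfold S. rewrite (csum_ext _ (fun k => trunc k * r ^ k * Cconj (a k * r ^ k))%C)
        by (intros; now rewrite Hat).
      apply (fourier_pairing trunc a p M s); [unfold s; lra|..].
      - intros k. unfold trunc. destruct (le_dec n k); [|auto]. rewrite Cmod_0, Rmult_0_l.
        eapply Rle_trans; [|apply (HM O)]. simpl. pose proof (Cmod_ge_0 (a O)). lra.
      - intros z _. unfold p. rewrite (csum_ext _ (fun k => trunc k * z ^ k)%C)
          by (intros; now rewrite Hat).
        apply cser_finite. intros k Hk. unfold trunc. destruct (le_dec n k); [ring|lia]. }
    assert (L3 : clim (mean (fun j => K (circle_node r j))) (K 0)).
    { rewrite HK0. replace (b O) with (b O * r ^ 0)%C by (simpl; ring).
      eapply clim_ext; [|apply (fourier_mean b K M' s r 0); auto; [unfold s; lra|]].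
      - intros N. apply mean_ext. intros j. simpl. rewrite Cconj_R, Cpow_1_l. ring.
      - intros z Hz. apply Hb. lra. }
    (* The limit of the means of [K + |p|^2 - 2 G conj p], whose real part is non-negative. *)
    pose proof (clim_plus _ _ _ _ L3 (clim_plus _ _ _ _ L2 (clim_scal (-2) _ _ L1))) as L.
    assert (Hpos : 0 <= Re (K 0 + (S + (-2) * S))%C).
    { apply (clim_Re_ge _ _ _ L). intros N. rewrite <- mean_scal, <- !mean_plus, Re_mean.
      apply Rmult_le_pos; [left; apply Rinv_0_lt_compat, INR_S_pos|].
      apply rsum_nonneg. intros j _.
      pose proof (Re_mult_conj (G (circle_node r j)) (p (circle_node r j))) as T.
      assert (T2 := Hmaj (circle_node r j) ltac:(rewrite Cmod_circle_node; lra)).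
      set (x := (G (circle_node r j) * Cconj (p (circle_node r j)))%C) in *.
      set (y := (p (circle_node r j) * Cconj (p (circle_node r j)))%C) in *.
      set (k := K (circle_node r j)) in *.
      replace (Re (k + (y + RtoC (-2) * x))%C) with (Re k + (Re y - 2 * Re x))
        by (unfold Re; simpl; ring). lra. }
    replace (Re (K 0 + (S + RtoC (-2) * S))%C) with (Re (K 0) - Re S) in Hpos
      by (unfold Re; simpl; ring). rewrite <- HS. lra. }
  set (X := rsum (fun k => Cmod (a k) ^ 2) n).
  assert (HX : forall r, 0 <= r < 1 -> X * r ^ (2 * n) <= Re (K 0)).
  { intros r Hr'. eapply Rle_trans; [|apply (Hr r Hr')]. unfold X.
    rewrite Rmult_comm, <- rsum_scal. apply rsum_le. intros k Hk. rewrite Rmult_comm.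
    apply Rmult_le_compat_l; [apply pow2_ge_0|].
    replace (2 * n)%nat with (2 * k + 2 * (n - k))%nat by lia. rewrite pow_add.
    rewrite <- (Rmult_1_r (r ^ (2 * k))) at 2. apply Rmult_le_compat_l; [apply pow_le; lra|].
    rewrite <- (pow1 (2 * (n - k))). apply pow_incr. lra. }
  apply Rnot_lt_le. intros Hlt. fold X in Hlt.
  (* Let [r] tend to 1: for [r = 1 - e] with the small [e] below, Bernoulli's inequality contradicts
     [HX]. *)
  set (D := X * (INR (2 * n) + 1)).
  assert (HXpos : 0 < X) by lra. pose proof (pos_INR (2 * n)) as HI.
  set (e := (X - Re (K 0)) / (2 * D)).
  assert (HD : X <= D).
  { unfold D. rewrite <- (Rmult_1_r X) at 1. apply Rmult_le_compat_l; lra. }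
  assert (HeD : e * D = (X - Re (K 0)) / 2) by (unfold e; field; lra).
  assert (He : 0 < e) by (apply Rdiv_lt_0_compat; lra).
  assert (He1 : e <= 1).
  { apply Rmult_le_reg_r with D; lra. }
  specialize (HX (1 - e) ltac:(lra)).
  assert (Hb' : X * (1 - INR (2 * n) * e) <= X * (1 - e) ^ (2 * n)).
  { apply Rmult_le_compat_l; [lra|]. apply bernoulli_le. lra. }
  assert (X * (INR (2 * n) * e) <= e * D).
  { unfold D. assert (0 <= X * e) by (apply Rmult_le_pos; lra). lra. }
  lra.
Qed.

(** * Square-summable coefficients and division by Blaschke factors *)

Definition l2_le (a : nat -> C) (M : R) : Prop := forall n, rsum (fun k => Cmod (a k) ^ 2) n <= M.

Lemma l2_le_term a M n : l2_le a M -> Cmod (a n) ^ 2 <= M.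
Proof.
  intros H. eapply Rle_trans; [|apply (H (S n))].
  apply (rsum_term_le (fun k => Cmod (a k) ^ 2)); [intros; apply pow2_ge_0|lia].
Qed.

Lemma le_of_sqr_le x M : x ^ 2 <= M -> x <= 1 + M.
Proof. intros H. pose proof (pow2_ge_0 (x - 1)). nra. Qed.

Lemma l2_le_geom_bounded a M : l2_le a M -> geom_bounded a 1.
Proof.
  intros H s Hs. exists (1 + M). intros n.
  pose proof (le_of_sqr_le _ _ (l2_le_term a M n H)).
  pose proof (Cmod_ge_0 (a n)).
  apply Rle_trans with (Cmod (a n) * 1); [|lra].
  apply Rmult_le_compat_l; auto. rewrite <- (pow1 n). apply pow_incr. lra.
Qed.

Definition eval (a : nat -> C) (z : C) : C := ctot (fun n => a n * z ^ n)%C.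

Lemma eval_pser a z : geom_bounded a 1 -> Cmod z < 1 -> pser a z (eval a z).
Proof.
  intros H Hz. pose proof (Cmod_ge_0 z).
  destruct (H ((Cmod z + 1) / 2)) as [M HM]; [lra|]. apply pser_ex with M ((Cmod z + 1) / 2); auto. lra.
Qed.

Lemma cauchy_schwarz a b n : (rsum (fun k => a k * b k) n) ^ 2 <=
  rsum (fun k => a k ^ 2) n * rsum (fun k => b k ^ 2) n.
Proof.
  induction n as [|n IH]; [simpl; lra|]. cbn [rsum].
  set (S := rsum (fun k => a k * b k) n) in *.
  assert (HA : 0 <= rsum (fun k => a k ^ 2) n) by (apply rsum_nonneg; intros; apply pow2_ge_0).
  assert (HB : 0 <= rsum (fun k => b k ^ 2) n) by (apply rsum_nonneg; intros; apply pow2_ge_0).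
  set (A := rsum (fun k => a k ^ 2) n) in *. set (B := rsum (fun k => b k ^ 2) n) in *.
  set (x := a n). set (y := b n).
  assert (H : 2 * (S * (x * y)) <= A * y ^ 2 + B * x ^ 2).
  { apply Rsqr_incr_0_var.
    - unfold Rsqr.
      pose proof (pow2_ge_0 (A * y ^ 2 - B * x ^ 2)).
      assert (0 <= (A * B - S ^ 2) * (x * y) ^ 2) by (apply Rmult_le_pos; [lra|apply pow2_ge_0]).
      nra.
    - pose proof (pow2_ge_0 x). pose proof (pow2_ge_0 y).
      assert (0 <= A * y ^ 2) by (apply Rmult_le_pos; auto).
      assert (0 <= B * x ^ 2) by (apply Rmult_le_pos; auto). lra. }
  nra.
Qed.

(** The Cauchy-Schwarz inequality against the geometric sequence of [z]. *)
Lemma point_evaluation a M z l : l2_le a M -> Cmod z < 1 -> pser a z l ->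
  Cmod l ^ 2 * (1 - Cmod z ^ 2) <= M.
Proof.
  intros Ha Hz Hl. pose proof (Cmod_ge_0 z) as Hz0.
  set (q := Cmod z ^ 2). assert (Hq : 0 <= q < 1) by (unfold q; nra).
  assert (HM0 : 0 <= M) by exact (Ha O).
  assert (Hn : forall n, rsum (fun k => Cmod (a k * z ^ k)%C) n <= sqrt (M * / (1 - q))).
  { intros n.
    rewrite <- (sqrt_pow2 (rsum (fun k => Cmod (a k * z ^ k)%C) n))
      by (apply rsum_nonneg; intros; apply Cmod_ge_0).
    apply sqrt_le_1_alt.
    rewrite (rsum_ext _ (fun k => Cmod (a k) * Cmod z ^ k)) by (intros; apply Cmod_term).
    eapply Rle_trans; [apply (cauchy_schwarz (fun k => Cmod (a k)) (fun k => Cmod z ^ k))|].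
    apply Rmult_le_compat; [apply rsum_nonneg; intros; apply pow2_ge_0..|apply Ha|].
    rewrite (rsum_ext _ (fun k => q ^ k)); [now apply geom_sum_le|].
    intros k _. unfold q. rewrite <- !pow_mult. f_equal. lia. }
  assert (Hle : Cmod l <= sqrt (M * / (1 - q))) by exact (cser_Cmod_le _ _ _ Hl Hn).
  assert (H2 : Cmod l ^ 2 <= M * / (1 - q)).
  { rewrite <- (pow2_sqrt (M * / (1 - q))).
    - apply pow_incr. split; auto. apply Cmod_ge_0.
    - apply Rmult_le_pos; auto. left. apply Rinv_0_lt_compat. lra. }
  apply Rmult_le_compat_r with (r := 1 - q) in H2; [|lra].
  rewrite Rmult_assoc, Rinv_l in H2 by lra. unfold q in *. lra.
Qed.

Lemma l2_le_tail a M n : l2_le a M ->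
  l2_le (fun k => a (n + k)%nat) (M - rsum (fun k => Cmod (a k) ^ 2) n).
Proof.
  intros H m. specialize (H (n + m)%nat). rewrite rsum_split in H. lra.
Qed.

(** The coefficients of [(z f(z) - a f(a)) / (z - a)]; the one of index 0 is [f(a)]. *)
Definition tail_eval (a : C) (f : nat -> C) (n : nat) : C := eval (fun j => f (n + j)%nat) a.

(** The coefficients of the [g] such that [f] is [f(a) (1 - |a|^2) / (1 - conj a z)] plus [g] times
    the Blaschke factor of [a]. The two summands are orthogonal in the Hardy space, which is why [g]
    is no larger than [f]. *)
Definition deflate (a : C) (f : nat -> C) (n : nat) : C :=
  (tail_eval a f (S n) - Cconj a * tail_eval a f n)%C.

Lemma tail_eval_pser a f M n : l2_le f M -> Cmod a < 1 ->
  pser (fun j => f (n + j)%nat) a (tail_eval a f n).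
Proof.
  intros Hf Ha. apply eval_pser; auto. eapply l2_le_geom_bounded, l2_le_tail, Hf.
Qed.

Lemma tail_eval_step a f M n : l2_le f M -> Cmod a < 1 ->
  tail_eval a f n = (f n + a * tail_eval a f (S n))%C.
Proof.
  intros Hf Ha. apply (cser_unique _ _ _ (tail_eval_pser a f M n Hf Ha)).
  replace (f n) with (f (n + 0)%nat * a ^ 0)%C by (rewrite Nat.add_0_r; simpl; ring).
  apply (cser_shift (fun j => f (n + j)%nat * a ^ j)%C).
  eapply cser_ext; [|apply (cser_scal a), (tail_eval_pser a f M (S n) Hf Ha)].
  intros j. cbv beta. replace (n + S j)%nat with (S n + j)%nat by lia. simpl. ring.
Qed.

Lemma tail_eval_bound a f M n : l2_le f M -> Cmod a < 1 ->
  Cmod (tail_eval a f n) ^ 2 * (1 - Cmod a ^ 2) <= M - rsum (fun k => Cmod (f k) ^ 2) n.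
Proof.
  intros Hf Ha. apply (point_evaluation (fun j => f (n + j)%nat)); auto.
  - now apply l2_le_tail.
  - now apply tail_eval_pser with M.
Qed.

Lemma tail_eval_geom_bounded a f M : l2_le f M -> Cmod a < 1 -> geom_bounded (tail_eval a f) 1.
Proof.
  intros Hf Ha s Hs. exists (1 + M / (1 - Cmod a ^ 2)). intros n.
  pose proof (tail_eval_bound a f M n Hf Ha) as H.
  assert (0 <= rsum (fun k => Cmod (f k) ^ 2) n) by (apply rsum_nonneg; intros; apply pow2_ge_0).
  pose proof (Cmod_ge_0 a). assert (Hd : 0 < 1 - Cmod a ^ 2) by nra.
  assert (Hx : Cmod (tail_eval a f n) ^ 2 <= M / (1 - Cmod a ^ 2)).
  { apply Rmult_le_reg_r with (1 - Cmod a ^ 2); auto. unfold Rdiv.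
    rewrite Rmult_assoc, Rinv_l by lra. lra. }
  apply le_of_sqr_le in Hx. pose proof (Cmod_ge_0 (tail_eval a f n)).
  apply Rle_trans with (Cmod (tail_eval a f n) * 1); [|lra].
  apply Rmult_le_compat_l; auto. rewrite <- (pow1 n). apply pow_incr. lra.
Qed.

Lemma blaschke_energy (a x y : C) :
  Cmod (x - a * y) ^ 2 - Cmod (y - Cconj a * x) ^ 2 =
  (1 - Cmod a ^ 2) * (Cmod x ^ 2 - Cmod y ^ 2).
Proof.
  rewrite !Cmod2_alt. destruct a, x, y. unfold Re, Im. simpl. ring.
Qed.

(** By [blaschke_energy] the difference of the energies telescopes, and what remains at the index
    [n] is bounded by the energy of [f] beyond [n]. *)
Lemma deflate_l2_le a f M : l2_le f M -> Cmod a < 1 -> l2_le (deflate a f) M.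
Proof.
  intros Hf Ha n. pose proof (Cmod_ge_0 a). assert (Hd : 0 < 1 - Cmod a ^ 2) by nra.
  assert (H0 : rsum (fun k => Cmod (deflate a f k) ^ 2) n =
    rsum (fun k => Cmod (f k) ^ 2) n
    - (1 - Cmod a ^ 2) * (Cmod (tail_eval a f 0) ^ 2 - Cmod (tail_eval a f n) ^ 2)).
  { induction n as [|n IH]; [simpl; ring|]. cbn [rsum]. rewrite IH.
    pose proof (blaschke_energy a (tail_eval a f n) (tail_eval a f (S n))) as E.
    replace (tail_eval a f n - a * tail_eval a f (S n))%C with (f n) in E
      by (rewrite (tail_eval_step a f M n Hf Ha); ring).
    unfold deflate. lra. }
  rewrite H0. pose proof (tail_eval_bound a f M n Hf Ha).
  assert (0 <= (1 - Cmod a ^ 2) * Cmod (tail_eval a f 0) ^ 2)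
    by (apply Rmult_le_pos; [lra|apply pow2_ge_0]). lra.
Qed.

Lemma deflate_identity a f M z : l2_le f M -> Cmod a < 1 -> Cmod z < 1 ->
  ((1 - Cconj a * z) * eval f z =
   tail_eval a f 0 * (1 - a * Cconj a) + (z - a) * eval (deflate a f) z)%C.
Proof.
  intros Hf Ha Hz.
  set (Q := tail_eval a f).
  pose proof (tail_eval_geom_bounded a f M Hf Ha) as HQ.
  pose proof (eval_pser _ z HQ Hz) as HQz. fold Q in HQ, HQz.
  set (E := eval (fun n => Q (S n)) z).
  assert (HE : pser (fun n => Q (S n)) z E).
  { apply eval_pser; auto. intros s Hs. destruct (HQ ((s + 1) / 2)) as [K HK]; [lra|].
    assert (Hs2 : 0 < (s + 1) / 2) by lra.
    exists (K / ((s + 1) / 2)). intros n. apply Rmult_le_reg_r with ((s + 1) / 2); auto.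
    replace (K / ((s + 1) / 2) * ((s + 1) / 2)) with K by (field; lra).
    eapply Rle_trans; [|apply (HK (S n))]. rewrite Rmult_assoc. simpl.
    apply Rmult_le_compat_l; [apply Cmod_ge_0|]. rewrite Rmult_comm.
    apply Rmult_le_compat_l; [lra|]. apply pow_incr. lra. }
  assert (EQ : eval Q z = (Q O + z * E)%C).
  { apply (cser_unique _ _ _ HQz). replace (Q O) with (Q O * z ^ 0)%C by (simpl; ring).
    apply (cser_shift (fun n => Q n * z ^ n)%C).
    eapply cser_ext; [|apply (cser_scal z), HE]. intros n. cbv beta. simpl. ring. }
  assert (EF : eval f z = (eval Q z + - a * E)%C).
  { apply (cser_unique _ _ _ (eval_pser f z (l2_le_geom_bounded f M Hf) Hz)).
    eapply cser_ext; [|apply cser_plus; [apply HQz|apply (cser_scal (- a)%C), HE]].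
    intros n. cbv beta. unfold Q. rewrite (tail_eval_step a f M n Hf Ha). ring. }
  assert (EG : eval (deflate a f) z = (E + - Cconj a * eval Q z)%C).
  { apply (cser_unique _ _ _ (eval_pser _ z (l2_le_geom_bounded _ M (deflate_l2_le a f M Hf Ha)) Hz)).
    eapply cser_ext; [|apply cser_plus; [apply HE|apply (cser_scal (- Cconj a)%C), HQz]].
    intros n. cbv beta. unfold deflate, Q. ring. }
  rewrite EF, EG, EQ. fold Q. ring.
Qed.

Definition blaschke_factor (a z : C) : C := ((z - a) / (1 - Cconj a * z))%C.

Fixpoint blaschke (l : list C) (z : C) : C :=
  match l with nil => RtoC 1 | cons a l => (blaschke_factor a z * blaschke l z)%C end.

Fixpoint deflates (l : list C) (f : nat -> C) : nat -> C :=
  match l with nil => f | a :: l => deflates l (deflate a f) end.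

(** The values at the successive zeros, each taken after the preceding deflations. They are linear
    in [f], and when they all vanish the Blaschke product divides [f]. *)
Fixpoint obstruction (l : list C) (i : nat) (f : nat -> C) : C :=
  match l, i with
  | nil, _ => RtoC 0
  | a :: _, O => tail_eval a f 0
  | a :: l, S i => obstruction l i (deflate a f)
  end.

Lemma deflates_l2_le l : Forall (fun a => Cmod a < 1) l ->
  forall f M, l2_le f M -> l2_le (deflates l f) M.
Proof.
  induction 1 as [|a l Ha _ IH]; intros f M Hf; simpl; auto using deflate_l2_le.
Qed.

Lemma deflates_divides l : Forall (fun a => Cmod a < 1) l ->
  forall f M z, l2_le f M -> (forall i, (i < length l)%nat -> obstruction l i f = RtoC 0) -> Cmod z < 1 ->
  eval f z = (blaschke l z * eval (deflates l f) z)%C.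
Proof.
  induction 1 as [|a l Ha _ IH]; intros f M z Hf H0 Hz; simpl; [ring|].
  rewrite <- Cmult_assoc, <- (IH (deflate a f) M); auto.
  - pose proof (deflate_identity a f M z Hf Ha Hz) as E.
    change (tail_eval a f 0) with (obstruction (a :: l) 0 f) in E.
    rewrite H0 in E by (simpl; lia).
    assert (Hne : (1 - Cconj a * z)%C <> 0).
    { apply Cmod_lt_1_minus_neq; auto. rewrite Cmod_conj. lra. }
    unfold blaschke_factor. apply (f_equal (fun w => / (1 - Cconj a * z) * w)%C) in E.
    replace (/ (1 - Cconj a * z) * ((1 - Cconj a * z) * eval f z))%C with (eval f z) in E
      by (field; auto).
    rewrite E. field. auto.
  - now apply deflate_l2_le.
  - intros i Hi. apply (H0 (S i)). simpl. lia.
Qed.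

Definition coef_comb (c d : C) (f g : nat -> C) : nat -> C := fun n => (c * f n + d * g n)%C.

Lemma l2_le_coef_comb c d f g M K : l2_le f M -> l2_le g K ->
  l2_le (coef_comb c d f g) (2 * Cmod c ^ 2 * M + 2 * Cmod d ^ 2 * K).
Proof.
  intros Hf Hg n.
  apply Rle_trans with (rsum (fun k => 2 * Cmod c ^ 2 * Cmod (f k) ^ 2 + 2 * Cmod d ^ 2 * Cmod (g k) ^ 2) n).
  - apply rsum_le. intros k _. unfold coef_comb.
    pose proof (Cmod_triangle (c * f k) (d * g k)) as T. rewrite !Cmod_mult in T.
    set (x := Cmod c * Cmod (f k)) in *. set (y := Cmod d * Cmod (g k)) in *.
    apply Rle_trans with ((x + y) ^ 2).
    + apply pow_incr. split; auto. apply Cmod_ge_0.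
    + pose proof (pow2_ge_0 (x - y)).
      replace (2 * Cmod c ^ 2 * Cmod (f k) ^ 2 + 2 * Cmod d ^ 2 * Cmod (g k) ^ 2)
        with (2 * x ^ 2 + 2 * y ^ 2) by (unfold x, y; ring). nra.
  - rewrite rsum_plus, !rsum_scal. apply Rplus_le_compat; apply Rmult_le_compat_l; auto.
    + pose proof (pow2_ge_0 (Cmod c)). lra.
    + pose proof (pow2_ge_0 (Cmod d)). lra.
Qed.

Lemma eval_coef_comb c d f g z : geom_bounded f 1 -> geom_bounded g 1 -> Cmod z < 1 ->
  eval (coef_comb c d f g) z = (c * eval f z + d * eval g z)%C.
Proof.
  intros Hf Hg Hz. apply cser_ctot.
  eapply cser_ext; [|apply cser_plus; apply cser_scal; apply eval_pser; eauto].
  intros n. cbv beta. unfold coef_comb. ring.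
Qed.

Lemma tail_eval_coef_comb a c d f g M K n : l2_le f M -> l2_le g K -> Cmod a < 1 ->
  tail_eval a (coef_comb c d f g) n = (c * tail_eval a f n + d * tail_eval a g n)%C.
Proof.
  intros Hf Hg Ha. unfold tail_eval.
  apply (eval_coef_comb c d (fun j => f (n + j)%nat) (fun j => g (n + j)%nat)); auto;
    eapply l2_le_geom_bounded, l2_le_tail; eauto.
Qed.

Lemma deflate_coef_comb a c d f g M K : l2_le f M -> l2_le g K -> Cmod a < 1 ->
  deflate a (coef_comb c d f g) = coef_comb c d (deflate a f) (deflate a g).
Proof.
  intros Hf Hg Ha. apply functional_extensionality. intros n. unfold deflate.
  rewrite !(tail_eval_coef_comb a c d f g M K) by auto. unfold coef_comb. ring.
Qed.

Lemma deflates_coef_comb c d l : Forall (fun a => Cmod a < 1) l ->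
  forall f g M K, l2_le f M -> l2_le g K ->
  deflates l (coef_comb c d f g) = coef_comb c d (deflates l f) (deflates l g).
Proof.
  induction 1 as [|a l Ha _ IH]; intros f g M K Hf Hg; simpl; auto.
  rewrite (deflate_coef_comb a c d f g M K) by auto.
  apply IH with M K; now apply deflate_l2_le.
Qed.

Lemma obstruction_coef_comb c d l : Forall (fun a => Cmod a < 1) l ->
  forall i f g M K, l2_le f M -> l2_le g K ->
  obstruction l i (coef_comb c d f g) = (c * obstruction l i f + d * obstruction l i g)%C.
Proof.
  induction 1 as [|a l Ha _ IH]; intros i f g M K Hf Hg; simpl; [ring|].
  destruct i as [|i].
  - now apply tail_eval_coef_comb with M K.
  - rewrite (deflate_coef_comb a c d f g M K) by auto.
    apply IH with M K; now apply deflate_l2_le.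
Qed.

(** * Functions on the disk, the Hardy norm and operators *)

Lemma sum_n_csum (a : nat -> C) n : sum_n a n = csum a (S n).
Proof.
  induction n as [|n IH].
  - rewrite sum_O. simpl. ring.
  - rewrite sum_Sn, IH. reflexivity.
Qed.

Lemma is_series_cser (a : nat -> C) (l : C) : @is_series C_AbsRing C_NormedModule a l <-> cser a l.
Proof.
  unfold is_series, cser. split; intros H.
  - apply clim_decr. apply (clim_ext (sum_n a)); [apply sum_n_csum|]. intros eps He.
    assert (Hs : 0 < sqrt 2) by (apply sqrt_lt_R0; lra).
    assert (Hp : 0 < eps / sqrt 2) by (apply Rdiv_lt_0_compat; lra).
    destruct (proj1 (filterlim_locally _ _) H (mkposreal _ Hp)) as [N HN].
    exists N. intros n Hn. specialize (HN n Hn). apply C_NormedModule_mixin_compat2 in HN.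
    simpl in HN. replace (sqrt 2 * (eps / sqrt 2)) with eps in HN by (field; lra). exact HN.
  - apply filterlim_locally. intros eps.
    destruct (clim_incr _ _ H eps (cond_pos eps)) as [N HN]. exists N. intros n Hn.
    apply C_NormedModule_mixin_compat1. specialize (HN n Hn). cbv beta in HN.
    rewrite <- sum_n_csum in HN. exact HN.
Qed.

Lemma pow_n_Cpow (z : C) n : @pow_n C_Ring z n = (z ^ n)%C.
Proof. induction n as [|n IH]; simpl; [|rewrite IH]; reflexivity. Qed.

Lemma is_pseries_pser a (z l : C) : @is_pseries C_AbsRing C_NormedModule a z l <-> pser a z l.
Proof.
  unfold is_pseries. rewrite is_series_cser. unfold pser.
  assert (E : forall n, @scal C_AbsRing C_NormedModule (@pow_n C_Ring z n) (a n) = (a n * z ^ n)%C).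
  { intros n. transitivity (z ^ n * a n)%C; [|apply Cmult_comm].
    exact (f_equal (fun x => Cmult x (a n)) (pow_n_Cpow z n)). }
  split; apply cser_ext; intros n; [|symmetry]; apply E.
Qed.

(** An extension to all of [C], so that arguments such as [w + h] carry no membership proof. *)
Definition extend (f : disk -> C) (z : C) : C :=
  match Rlt_dec (Cmod z) 1 with left h => f (exist _ z h) | right _ => RtoC 0 end.

Lemma extend_eq f z (h : Cmod z < 1) : extend f z = f (exist _ z h).
Proof.
  unfold extend. destruct (Rlt_dec (Cmod z) 1) as [h'|]; [|easy].
  do 2 f_equal. apply proof_irrelevance.
Qed.

Lemma extend_disk f (z : disk) : extend f z = f z.
Proof. destruct z as [z h]. apply extend_eq. Qed.

Lemma disk_lt (z : disk) : Cmod z < 1.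
Proof. exact (proj2_sig z). Qed.

Lemma extend_holds (P : C -> Prop) f : (forall z : disk, P (f z)) ->
  forall z, Cmod z < 1 -> P (extend f z).
Proof. intros H z Hz. rewrite (extend_eq f z Hz). apply H. Qed.

Lemma analytic_represents f : analytic f ->
  forall w, Cmod w < 1 -> exists rho b, 0 < rho /\ represents (extend f) w rho b.
Proof.
  intros H w Hw. destruct (H (exist _ w Hw)) as [a [r [Hr Ha]]]. simpl in Ha.
  exists (Rmin r (1 - Cmod w)), a. split; [apply Rmin_glb_lt; lra|].
  intros h Hh.
  pose proof (Rmin_l r (1 - Cmod w)). pose proof (Rmin_r r (1 - Cmod w)).
  assert (Hwh : Cmod (w + h)%C < 1) by (eapply Rle_lt_trans; [apply Cmod_triangle|]; lra).
  rewrite (extend_eq f (w + h)%C Hwh).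
  replace h with (w + h - w)%C at 1 by ring. apply is_pseries_pser.
  apply (Ha (exist _ (w + h)%C Hwh)). simpl. replace (w + h - w)%C with h by ring. lra.
Qed.

Lemma disk_series_disk f a :
  (forall z : disk, @is_pseries C_AbsRing C_NormedModule a (disk_val z) (f z)) <->
  disk_series a (extend f).
Proof.
  split; intros H.
  - intros z Hz. rewrite (extend_eq f z Hz). apply is_pseries_pser.
    apply (H (exist _ z Hz)).
  - intros z. apply is_pseries_pser. rewrite <- (extend_disk f z). apply H, disk_lt.
Qed.

Lemma sum_n_rsum (a : nat -> R) n : sum_n a n = rsum a (S n).
Proof.
  induction n as [|n IH].
  - rewrite sum_O. simpl. ring.
  - rewrite sum_Sn, IH. reflexivity.
Qed.

Lemma rsum_le_series b : (forall n, 0 <= b n) -> ex_series b -> forall n, rsum b n <= Series b.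
Proof.
  intros H0 Hb n. apply Series_correct in Hb.
  apply (is_lim_seq_le_loc (fun _ => rsum b n) (fun k => sum_n b k) (rsum b n) (Series b)).
  - exists n. intros k Hk. rewrite sum_n_rsum. apply (rsum_mono b n (S k)); auto.
  - apply is_lim_seq_const.
  - exact Hb.
Qed.

Lemma series_le_of_rsum b M : (forall n, 0 <= b n) -> (forall n, rsum b n <= M) ->
  ex_series b /\ Series b <= M.
Proof.
  intros H0 HM.
  assert (Hex : ex_series b).
  { destruct (ex_finite_lim_seq_incr (sum_n b) M) as [l Hl].
    - intros n. rewrite !sum_n_rsum. apply rsum_mono; auto.
    - intros n. now rewrite sum_n_rsum.
    - now exists l. }
  split; auto. apply Series_correct in Hex.
  apply (is_lim_seq_le (fun k => sum_n b k) (fun _ => M) (Series b) M).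
  - intros n. now rewrite sum_n_rsum.
  - exact Hex.
  - apply is_lim_seq_const.
Qed.

Lemma H2_coef_iff f a : H2_coef f a <-> (exists M, l2_le a M) /\ disk_series a (extend f).
Proof.
  unfold H2_coef. rewrite disk_series_disk. split; intros [H1 H2]; split; auto.
  - exists (Series (fun n => Cmod (a n) ^ 2)). intros n. apply rsum_le_series; auto.
    intros k. apply pow2_ge_0.
  - destruct H1 as [M HM]. apply (series_le_of_rsum _ M); auto. intros k. apply pow2_ge_0.
Qed.

Lemma H2_coef_unique f a b : H2_coef f a -> H2_coef f b -> a = b.
Proof.
  intros Ha Hb. apply H2_coef_iff in Ha. apply H2_coef_iff in Hb.
  destruct Ha as [_ Ha], Hb as [_ Hb]. apply functional_extensionality.
  apply (pser_unique a b (extend f) 1); auto. lra.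
Qed.

Lemma H2_norm_eq f a : H2_coef f a ->
  H2_norm f = Finite (sqrt (Series (fun n => Cmod (a n) ^ 2))).
Proof.
  intros Ha. apply Rbar_is_glb_unique. split.
  - intros y [b [Hb ->]]. rewrite (H2_coef_unique f b a) by auto. apply Rbar_le_refl.
  - intros y Hy. apply Hy. eauto.
Qed.

Lemma H2_norm_le f a M : l2_le a M -> disk_series a (extend f) -> Rbar_le (H2_norm f) (Finite (sqrt M)).
Proof.
  intros HM Ha. rewrite (H2_norm_eq f a) by (apply H2_coef_iff; eauto).
  apply sqrt_le_1_alt. apply series_le_of_rsum; auto. intros k. apply pow2_ge_0.
Qed.

Lemma H2_unit_ball f a : H2_coef f a -> Rbar_le (H2_norm f) 1 -> l2_le a 1.
Proof.
  intros Ha Hf. rewrite (H2_norm_eq f a Ha) in Hf. simpl in Hf.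
  assert (H0 : 0 <= Series (fun n => Cmod (a n) ^ 2)).
  { eapply Rle_trans; [|apply (rsum_le_series _ (fun k => pow2_ge_0 _) (proj1 Ha) O)]. simpl. lra. }
  intros n. eapply Rle_trans; [apply (rsum_le_series (fun k => Cmod (a k) ^ 2))|].
  - intros k. apply pow2_ge_0.
  - apply Ha.
  - rewrite <- (pow2_sqrt _ H0), <- (pow1 2). apply pow_incr. split; auto. apply sqrt_pos.
Qed.

Lemma op_norm_le T M :
  (forall f a, H2_coef f a -> l2_le a 1 -> exists b, disk_series b (extend (T f)) /\ l2_le b M) ->
  Rbar_le (op_norm T) (Finite (sqrt M)).
Proof.
  intros H. unfold op_norm, Rbar_lub. destruct (Rbar_ex_lub _) as [s Hs]. simpl. apply Hs.
  intros y [f [[a Ha] [Hf ->]]].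
  destruct (H f a Ha (H2_unit_ball f a Ha Hf)) as [b [Hb HM]].
  now apply H2_norm_le with b.
Qed.

(** * Finite rank from finitely many functionals *)

Definition combination (c d : C) (f g : disk -> C) : disk -> C := fun z => (c * f z + d * g z)%C.

Lemma extend_combination c d f g z : extend (combination c d f g) z = (c * extend f z + d * extend g z)%C.
Proof. unfold extend, combination. destruct (Rlt_dec (Cmod z) 1); ring. Qed.

Lemma H2_coef_combination c d f g a b : H2_coef f a -> H2_coef g b ->
  H2_coef (combination c d f g) (coef_comb c d a b).
Proof.
  rewrite !H2_coef_iff. intros [[M HM] Ha] [[K HK] Hb]. split.
  - eexists. apply l2_le_coef_comb; eauto.
  - intros z Hz. rewrite extend_combination.
    exact (disk_series_plus _ _ _ _ (disk_series_scal c _ _ Ha) (disk_series_scal d _ _ Hb) z Hz).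
Qed.

Lemma H2_combination c d f g : H2 f -> H2 g -> H2 (combination c d f g).
Proof. intros [a Ha] [b Hb]. eexists. apply H2_coef_combination; eauto. Qed.

Lemma H2_zero : H2 (fun _ => RtoC 0).
Proof.
  exists (fun _ => RtoC 0). apply H2_coef_iff. split.
  - exists 0. intros n. rewrite (rsum_ext _ (fun _ => 0)), rsum_const; [lra|].
    intros k _. rewrite Cmod_0. ring.
  - apply disk_series_finite with O; auto. intros z Hz. simpl. unfold extend.
    now destruct (Rlt_dec (Cmod z) 1).
Qed.

Definition lincomb (d : nat -> C) (h : nat -> disk -> C) (k : nat) : disk -> C :=
  fun z => csum (fun l => d l * h l z)%C k.

Lemma lincomb_S d h k : lincomb d h (S k) = combination 1 (d k) (lincomb d h k) (h k).
Proof. apply functional_extensionality. intros z. unfold lincomb, combination. simpl. ring. Qed.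

Lemma H2_lincomb d h k : (forall i, H2 (h i)) -> H2 (lincomb d h k).
Proof.
  intros H. induction k as [|k IH]; [apply H2_zero|]. rewrite lincomb_S. now apply H2_combination.
Qed.

Definition linear_on_H2 (c : (disk -> C) -> C) : Prop :=
  forall a b f g, H2 f -> H2 g -> c (combination a b f g) = (a * c f + b * c g)%C.

Lemma linear_zero c : linear_on_H2 c -> c (fun _ => RtoC 0) = RtoC 0.
Proof.
  intros H. transitivity (c (combination 0 0 (fun _ => RtoC 0) (fun _ => RtoC 0))).
  - f_equal. apply functional_extensionality. intros z. unfold combination. ring.
  - rewrite H by apply H2_zero. ring.
Qed.

Lemma linear_lincomb c d h k : linear_on_H2 c -> (forall i, H2 (h i)) ->
  c (lincomb d h k) = csum (fun l => d l * c (h l))%C k.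
Proof.
  intros Hc Hh. induction k as [|k IH]; [now apply linear_zero|].
  rewrite lincomb_S, Hc, IH by auto using H2_lincomb. simpl. ring.
Qed.

(** By induction on the number of functionals: a new one either is determined by the earlier ones,
    or is non-zero at an element of their common kernel, which is added to the list. *)
Lemma functionals_spanned (c : nat -> (disk -> C) -> C) N :
  (forall i, linear_on_H2 (c i)) ->
  exists (k : nat) (h : nat -> disk -> C), (k <= N)%nat /\ (forall i, H2 (h i)) /\
    forall f, H2 f -> exists d, forall i, (i < N)%nat ->
      c i f = csum (fun l => d l * c i (h l))%C k.
Proof.
  intros Hc. induction N as [|N [k [h [Hk [Hh Hspan]]]]].
  - exists O, (fun _ _ => RtoC 0). repeat split; auto using H2_zero.
    intros f _. exists (fun _ => RtoC 0). intros i Hi. lia.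
  - destruct (classic (exists f0, H2 f0 /\ (forall i, (i < N)%nat -> c i f0 = RtoC 0) /\ c N f0 <> 0))
      as [[f0 [Hf0 [Hz Hnz]]]|Hno].
    + exists (S k), (fun l => if Nat.eq_dec l k then f0 else h l). split; [lia|]. split.
      { intros i. destruct (Nat.eq_dec i k); auto. }
      intros f Hf. destruct (Hspan f Hf) as [d Hd].
      set (e := ((c N f - csum (fun l => d l * c N (h l)) k) / c N f0)%C).
      exists (fun l => if Nat.eq_dec l k then e else d l). intros i Hi. cbn [csum].
      rewrite (csum_ext _ (fun l => d l * c i (h l))%C).
      2:{ intros l Hl. destruct (Nat.eq_dec l k); [lia|auto]. }
      destruct (Nat.eq_dec k k) as [_|]; [|easy].
      destruct (Nat.eq_dec i N) as [->|Hne].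
      * unfold e. field. auto.
      * rewrite Hz, <- Hd by lia. ring.
    + exists k, h. split; [lia|]. split; auto. intros f Hf. destruct (Hspan f Hf) as [d Hd].
      exists d. intros i Hi. destruct (Nat.eq_dec i N) as [->|Hne]; [|apply Hd; lia].
      apply NNPP. intros Hneq. apply Hno. exists (combination 1 (-1) f (lincomb d h k)).
      assert (Hl : H2 (lincomb d h k)) by now apply H2_lincomb.
      split; [now apply H2_combination|]. split.
      * intros j Hj. rewrite Hc, linear_lincomb, <- Hd by auto. ring.
      * rewrite Hc, linear_lincomb by auto. intros E. apply Hneq.
        apply Ceq_minus. rewrite <- E. ring.
Qed.

Lemma sum_n_m_csum (a : nat -> C) k : sum_n_m a 1 k = csum (fun l => a (S l)) k.
Proof.
  induction k as [|k IH].
  - rewrite sum_n_m_zero by lia. reflexivity.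
  - rewrite sum_n_Sm by lia. rewrite IH. reflexivity.
Qed.

(** A combination of the [h l] brings [f] into the common kernel of the functionals, where [T]
    vanishes. *)
Lemma rank_lt_of_functionals (T : operator) (c : nat -> (disk -> C) -> C) N n :
  (forall z, linear_on_H2 (fun f => T f z)) ->
  (forall i, linear_on_H2 (c i)) ->
  (forall f, H2 f -> (forall i, (i < N)%nat -> c i f = RtoC 0) -> forall z, T f z = RtoC 0) ->
  (N < n)%nat -> rank_lt T n.
Proof.
  intros HT Hc Hker Hn. destruct (functionals_spanned c N Hc) as [k [h [Hk [Hh Hspan]]]].
  exists k, (fun l => h (pred l)). split; [lia|]. split; auto.
  intros f Hf. destruct (Hspan f Hf) as [d Hd]. exists (fun l => d (pred l)). intros z.
  rewrite sum_n_m_csum. cbn [pred].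
  assert (Hl : H2 (lincomb d h k)) by now apply H2_lincomb.
  assert (E : T (combination 1 (-1) f (lincomb d h k)) z = RtoC 0).
  { apply Hker; [now apply H2_combination|]. intros i Hi.
    rewrite Hc, linear_lincomb, <- Hd by auto. ring. }
  rewrite HT in E by auto.
  rewrite (linear_lincomb (fun f => T f z) d h k (HT z) Hh) in E.
  apply Ceq_minus. rewrite <- E. ring.
Qed.

(** * Inscribed polygons *)

(** For [|v| = 1] the modulus is the distance from [w] to [v], and the real part measures how far
    [w] lies below the tangent at [v]. *)
Definition gap (v w : C) : C := (1 - Cconj v * w)%C.

(** The first condition puts [w] in a sector of opening less than a half-plane at each [v i]; the
    second keeps it away from the circle in proportion to its distance to some [v i]. *)
Definition in_corners (c : R) (v : nat -> C) (m : nat) (w : C) : Prop :=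
  (forall i, (i <= m)%nat -> c * Cmod (gap (v i) w) <= Re (gap (v i) w)) /\
  exists i, (i <= m)%nat /\ c * Cmod (gap (v i) w) <= 1 - Cmod w ^ 2.

Lemma finite_positive (Q : nat -> R -> Prop) n :
  (forall k x y, Q k x -> y <= x -> Q k y) ->
  (forall k, (k < n)%nat -> exists x, 0 < x /\ Q k x) ->
  exists x, 0 < x /\ forall k, (k < n)%nat -> Q k x.
Proof.
  intros Hm. induction n as [|n IH]; intros H.
  - exists 1. split; [lra|]. intros k Hk. lia.
  - destruct IH as [x [Hx HQ]]; [auto|]. destruct (H n) as [y [Hy HQy]]; [lia|].
    exists (Rmin x y). split; [now apply Rmin_glb_lt|]. intros k Hk.
    destruct (Nat.eq_dec k n) as [->|Hne].
    + apply Hm with y; auto. apply Rmin_r.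
    + apply Hm with x; [apply HQ; lia|apply Rmin_l].
Qed.

Lemma finite_argmax (t : nat -> R) n :
  exists i, (i <= n)%nat /\ forall j, (j <= n)%nat -> t j <= t i.
Proof.
  induction n as [|n [i [Hi IH]]].
  - exists O. split; auto. intros j Hj. replace j with O by lia. lra.
  - destruct (Rle_lt_dec (t (S n)) (t i)) as [H|H].
    + exists i. split; [lia|]. intros j Hj.
      destruct (Nat.eq_dec j (S n)) as [->|]; [auto|apply IH; lia].
    + exists (S n). split; auto. intros j Hj.
      destruct (Nat.eq_dec j (S n)) as [->|]; [lra|]. specialize (IH j ltac:(lia)). lra.
Qed.

Lemma rsum_minus_term (t : nat -> R) n i : (i < n)%nat ->
  rsum (fun j => if Nat.eq_dec j i then 0 else t j) n = rsum t n - t i.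
Proof.
  induction n as [|n IH]; intros Hi; [lia|]. simpl. destruct (Nat.eq_dec n i) as [->|Hne].
  - rewrite (rsum_ext _ t); [lra|]. intros k Hk. destruct (Nat.eq_dec k i); [lia|auto].
  - rewrite IH by lia. lra.
Qed.

(** Write [w] as a convex combination of the vertices with weights [t]. Then [gap (v i) w] is the same
    combination of the [gap (v i) (v j)], whose real parts are [|v i - v j|^2 / 2], so that its
    modulus and its real part are both comparable to [1 - t i]. Moreover [1 - |w|^2] is the
    combination of the real parts of the [gap (v i) w]; comparing with the largest weight gives the
    second condition. *)
Lemma polygon_corners P : inscribed_polygon P ->
  exists (m : nat) (v : nat -> C) (c : R), 0 < c <= 1 /\
    (forall i, (i <= m)%nat -> Cmod (v i) = 1) /\
    forall w, P w -> in_corners c v m w.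
Proof.
  intros [m [v [_ [Hv [Hinj HP]]]]].
  destruct (finite_positive (fun i x => forall j, (j < S m)%nat -> j <> i ->
              x <= Cmod (v i - v j) ^ 2) (S m)) as [d0 [Hd0 Hdist0]].
  { intros k x y H Hy j Hj Hne. specialize (H j Hj Hne). lra. }
  { intros i Hi.
    destruct (finite_positive (fun j x => j <> i -> x <= Cmod (v i - v j) ^ 2) (S m))
      as [x [Hx HQ]].
    - intros k x y H Hy Hne. specialize (H Hne). lra.
    - intros j Hj. destruct (Nat.eq_dec j i) as [->|Hne]; [exists 1; split; [lra|easy]|].
      exists (Cmod (v i - v j) ^ 2). split; [|lra].
      apply pow_lt, Cmod_gt_0. intros E. apply Hne. apply Hinj; try lia.
      apply Ceq_minus in E. auto.
    - exists x. split; auto. }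
  set (d := Rmin d0 1).
  assert (Hd : 0 < d <= 1) by (split; [apply Rmin_glb_lt; lra|apply Rmin_r]).
  assert (Hdist : forall i j, (i <= m)%nat -> (j <= m)%nat -> j <> i -> d <= Cmod (v i - v j) ^ 2).
  { intros i j Hi Hj Hne. apply Rle_trans with d0; [apply Rmin_l|]. apply Hdist0; auto; lia. }
  exists m, v, (d / 4). split; [lra|]. split; auto. intros w Hw.
  apply HP in Hw. destruct Hw as [t [Ht [Hsum Hw]]].
  rewrite sum_n_rsum in Hsum. rewrite sum_n_csum in Hw.
  assert (Hgap : forall i, (i <= m)%nat -> gap (v i) w = csum (fun j => t j * gap (v i) (v j))%C (S m)).
  { intros i Hi.
    rewrite (csum_ext _ (fun j => t j + - Cconj (v i) * (t j * v j))%C)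
      by (intros; unfold gap; ring).
    rewrite csum_plus, csum_scal, <- Hw.
    replace (csum (fun j => RtoC (t j)) (S m)) with (RtoC (rsum t (S m))).
    - rewrite Hsum. unfold gap. ring.
    - generalize (S m). intros n. induction n as [|n IH]; simpl; auto. now rewrite RtoC_plus, IH. }
  assert (Hvv : forall i j, (i <= m)%nat -> (j <= m)%nat ->
            Re (gap (v i) (v j)) = Cmod (v i - v j) ^ 2 / 2).
  { intros i j Hi Hj. pose proof (Hv i Hi) as H1. pose proof (Hv j Hj) as H2.
    apply (f_equal (fun x => x ^ 2)) in H1. apply (f_equal (fun x => x ^ 2)) in H2.
    rewrite Cmod2_alt in H1, H2. rewrite Cmod2_alt. unfold gap.
    destruct (v i), (v j). unfold Re, Im in *. simpl in *. lra. }
  assert (Hself : forall i, (i <= m)%nat -> gap (v i) (v i) = 0).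
  { intros i Hi. unfold gap. rewrite Cmult_comm, <- Cmod2_conj, (Hv i Hi), pow1. ring. }
  assert (HRe : forall i, (i <= m)%nat -> d / 2 * (1 - t i) <= Re (gap (v i) w)).
  { intros i Hi. rewrite (Hgap i Hi), csum_Re, <- Hsum, <- (rsum_minus_term t (S m) i), <- rsum_scal by lia.
    apply rsum_le. intros j Hj. specialize (Ht j ltac:(lia)). rewrite re_scal_l.
    destruct (Nat.eq_dec j i) as [->|Hne].
    - rewrite Hself by auto. simpl. lra.
    - rewrite Hvv by lia. specialize (Hdist i j Hi ltac:(lia) Hne).
      rewrite Rmult_comm. apply Rmult_le_compat_l; auto. lra. }
  assert (Hmod : forall i, (i <= m)%nat -> Cmod (gap (v i) w) <= 2 * (1 - t i)).
  { intros i Hi. rewrite (Hgap i Hi), <- Hsum, <- (rsum_minus_term t (S m) i), <- rsum_scal by lia.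
    eapply Rle_trans; [apply Cmod_csum_le|]. apply rsum_le. intros j Hj.
    specialize (Ht j ltac:(lia)). rewrite Cmod_mult, Cmod_R, Rabs_pos_eq by auto.
    destruct (Nat.eq_dec j i) as [->|Hne].
    - rewrite Hself, Cmod_0 by auto. lra.
    - rewrite Rmult_comm. apply Rmult_le_compat_r; auto. unfold gap, Cminus.
      eapply Rle_trans; [apply Cmod_triangle|].
      rewrite Cmod_1, Cmod_opp, Cmod_mult, Cmod_conj, !Hv by lia. lra. }
  split.
  - intros i Hi. specialize (HRe i Hi). specialize (Hmod i Hi). nra.
  - destruct (finite_argmax t m) as [i [Hi Hmax]]. exists i. split; auto.
    assert (Hw2 : 1 - Cmod w ^ 2 = rsum (fun j => t j * Re (gap (v j) w)) (S m)).
    { assert (E : Cmod w ^ 2 = rsum (fun j => t j * Re (Cconj (v j) * w)%C) (S m)).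
      { rewrite <- (re_RtoC (Cmod w ^ 2)), Cmod2_conj, Cmult_comm. rewrite Hw at 1.
        rewrite csum_conj, Cmult_comm, <- csum_scal, csum_Re.
        apply rsum_ext. intros j _. rewrite <- re_scal_l. f_equal.
        rewrite Cmult_conj, Cconj_R. ring. }
      rewrite E, <- Hsum.
      rewrite (rsum_ext (fun j => t j * Re (gap (v j) w))
                 (fun j => t j + (-1) * (t j * Re (Cconj (v j) * w)%C))).
      - rewrite rsum_plus, rsum_scal. ring.
      - intros j _. unfold gap. unfold Re. simpl. ring. }
    rewrite Hw2. specialize (Hmod i Hi).
    assert (Hti : t i <= 1).
    { rewrite <- Hsum. apply (rsum_term_le t); [intros; apply Ht; lia|lia]. }
    apply Rle_trans with (rsum (fun j => d / 2 * (1 - t i) * t j) (S m)).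
    + rewrite rsum_scal, Hsum. nra.
    + apply rsum_le. intros j Hj. specialize (Ht j ltac:(lia)).
      specialize (HRe j ltac:(lia)). specialize (Hmax j ltac:(lia)).
      rewrite Rmult_comm. apply Rmult_le_compat_l; auto. nra.
Qed.

(** * Kernels with positive real part at a corner *)

Definition scale (c : R) (k : nat) : R := 2 / c * (/ 2) ^ k.
(** This ratio exceeds 1 by so little that in the kernel below the terms with real part at least
    [c / 2 / |u|] before weighting outweigh those whose real part may be negative. *)
Definition growth (c : R) : R := 1 + c ^ 2 / 32.

(** A stand-in for [u ^ (-1 - s)] with [2 ^ s = growth c], smoothed at the distance [2 ^ (-M)]: the
    term of index [k] is about [growth c ^ k / u] when [|u|] is well below [scale c k], and decays
    above it. As a sum of resolvents it is visibly a power series in the variable of the disk, and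
    its real part stays positive in the sector although [u ^ (-1)] is raised to a power above 1. The
    coefficient of [/ u] makes up for the 1 subtracted in [corner_sum_head]. *)
Definition corner_kernel (c : R) (M : nat) (u : C) : C :=
  (RtoC (16 / c ^ 2) * / u +
   csum (fun k => RtoC (growth c ^ k) * (/ u - / (u + RtoC (scale c k)))) M)%C.

Lemma scale_pos c k : 0 < c -> 0 < scale c k.
Proof.
  intros Hc. apply Rmult_lt_0_compat; [apply Rdiv_lt_0_compat; lra|]. apply pow_lt. lra.
Qed.

Lemma Re_inv_ge (u : C) c : 0 < Cmod u -> c * Cmod u <= Re u -> c <= Cmod u * Re (/ u)%C.
Proof.
  intros Hu Hc.
  assert (E : Re (/ u)%C = Re u / Cmod u ^ 2).
  { rewrite Cmod2_alt. unfold Re, Im, Cinv. reflexivity. }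
  rewrite E. apply Rmult_le_reg_r with (Cmod u); auto.
  replace (Cmod u * (Re u / Cmod u ^ 2) * Cmod u) with (Re u) by (field; lra). auto.
Qed.

Lemma Cmod_plus_R_ge (u : C) t : 0 <= Re u -> 0 <= t -> t <= Cmod (u + t)%C /\ Cmod u <= Cmod (u + t)%C.
Proof.
  intros Hu Ht. split.
  - eapply Rle_trans; [|apply Re_le_Cmod]. unfold Re in *. simpl. lra.
  - apply Rsqr_incr_0_var; [|apply Cmod_ge_0]. rewrite !Rsqr_pow2, !Cmod2_alt.
    unfold Re, Im in *. simpl. nra.
Qed.

Lemma resolvent_difference (u : C) t : 0 < Cmod u -> 0 <= Re u -> 0 < t ->
  Cmod (/ u - / (u + t))%C <= t / Cmod u ^ 2.
Proof.
  intros Hu HR Ht. destruct (Cmod_plus_R_ge u t HR ltac:(lra)) as [H1 H2].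
  assert (Hne : u <> 0) by now apply Cmod_gt_0.
  assert (Hne2 : (u + t)%C <> 0) by (apply Cmod_gt_0; lra).
  replace (/ u - / (u + t))%C with (t / (u * (u + t)))%C by (field; auto).
  rewrite Cmod_div, Cmod_mult, Cmod_R, Rabs_pos_eq by (try apply Cmult_neq_0; auto; lra).
  apply Rmult_le_compat_l; [lra|]. apply Rinv_le_contravar; [apply pow_lt; auto|]. nra.
Qed.

(** The first bound is useful for [|u|] below [t], the second one above. *)
Lemma corner_term_bounds (u : C) c t : 0 < Cmod u -> 0 < c -> c * Cmod u <= Re u -> 0 < t ->
  c - Cmod u / t <= Cmod u * Re (/ u - / (u + t))%C /\
  - (t / Cmod u) <= Cmod u * Re (/ u - / (u + t))%C.
Proof.
  intros Hu Hc HR Ht.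
  assert (HR0 : 0 <= Re u) by (eapply Rle_trans; [|apply HR]; nra).
  destruct (Cmod_plus_R_ge u t HR0 ltac:(lra)) as [H1 H2]. split.
  - replace (Re (/ u - / (u + t))%C) with (Re (/ u)%C - Re (/ (u + t))%C)
      by (unfold Re; simpl; ring).
    pose proof (Re_inv_ge u c Hu HR) as H3.
    assert (H4 : Re (/ (u + t))%C <= / t).
    { eapply Rle_trans; [apply Re_le_Cmod|].
      rewrite Cmod_inv by (apply Cmod_gt_0; lra). apply Rinv_le_contravar; auto. }
    unfold Rdiv. nra.
  - pose proof (resolvent_difference u t Hu HR0 Ht) as H3.
    assert (H4 : - (t / Cmod u ^ 2) <= Re (/ u - / (u + t))%C).
    { pose proof (re_le_Cmod (/ u - / (u + t))%C) as H5. apply Rabs_le_between in H5. lra. }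
    apply (Rmult_le_compat_l (Cmod u)) in H4; [|lra].
    replace (Cmod u * - (t / Cmod u ^ 2)) with (- (t / Cmod u)) in H4 by (field; lra). auto.
Qed.

Lemma least_index (Q : nat -> Prop) M : ~ Q M ->
  exists J, (J <= M)%nat /\ ~ Q J /\ forall k, (k < J)%nat -> Q k.
Proof.
  intros HM.
  induction M as [M IH] using lt_wf_ind.
  destruct (classic (exists k, (k < M)%nat /\ ~ Q k)) as [[k [Hk Hq]]|Hno].
  - destruct (IH k Hk Hq) as [J [HJ [H1 H2]]]. exists J. split; [lia|auto].
  - exists M. split; auto. split; auto. intros k Hk. apply NNPP. intros Hq. apply Hno. eauto.
Qed.

(** At the scales above [x] every term is at least [c / 2], and
    [c / 2 = 16 / c * (growth c - 1)]. *)
Lemma corner_sum_head (a : nat -> R) c x J : 0 < c <= 1 -> 0 < x ->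
  (forall k, c - x / scale c k <= a k) -> (forall k, (k < J)%nat -> x * 2 ^ k <= 1) ->
  16 / c * (growth c ^ J - 1) <= rsum (fun k => growth c ^ k * a k) J.
Proof.
  intros Hc Hx Ha HJ. set (L := growth c).
  assert (HL : 1 < L) by (unfold L, growth; assert (0 < c ^ 2) by (apply pow_lt; lra); lra).
  apply Rle_trans with (rsum (fun k => c / 2 * L ^ k) J).
  - rewrite rsum_scal. pose proof (rsum_geom L J) as H.
    set (S := rsum (fun k => L ^ k) J) in *.
    replace (L ^ J - 1) with ((L - 1) * S) by lra. right. unfold L, growth. field. lra.
  - apply rsum_le. intros k Hk. rewrite Rmult_comm.
    apply Rmult_le_compat_l; [apply pow_le; lra|]. eapply Rle_trans; [|apply Ha].
    assert (E : x / scale c k = c / 2 * (x * 2 ^ k)).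
    { unfold scale. rewrite pow_inv. field. split; [apply pow_nonzero; lra|lra]. }
    rewrite E. specialize (HJ k Hk). nra.
Qed.

(** At the scales below [x] the terms are bounded below by those of a geometric sequence whose ratio
    [growth c / 2] is at most [3 / 4]. *)
Lemma corner_sum_tail (a : nat -> R) c x J n : 0 < c <= 1 -> 0 < x ->
  (forall k, - (scale c k / x) <= a k) -> 1 < x * 2 ^ J ->
  - (8 / c * growth c ^ J) <= rsum (fun k => growth c ^ (J + k) * a (J + k)%nat) n.
Proof.
  intros Hc Hx Ha HJ. set (L := growth c).
  assert (Hc2 : 0 < c ^ 2 <= 1) by (split; [apply pow_lt; lra|rewrite <- (pow1 2); apply pow_incr; lra]).
  assert (HL : 1 < L <= 3 / 2) by (unfold L, growth; lra).
  assert (HLJ : 0 < L ^ J) by (apply pow_lt; lra).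
  apply Rle_trans with (rsum (fun k => - (2 / c * L ^ J) * (L / 2) ^ k) n).
  - rewrite rsum_scal.
    pose proof (geom_sum_le (L / 2) n ltac:(lra)) as H.
    assert (H4 : / (1 - L / 2) <= 4).
    { replace 4 with (/ / 4) by field. apply Rinv_le_contravar; lra. }
    assert (0 < 2 / c * L ^ J) by (apply Rmult_lt_0_compat; auto; apply Rdiv_lt_0_compat; lra).
    replace (8 / c * L ^ J) with (2 / c * L ^ J * 4) by (field; lra).
    set (X := 2 / c * L ^ J) in *. set (S := rsum _ n) in *.
    assert (X * S <= X * 4) by (apply Rmult_le_compat_l; lra). lra.
  - apply rsum_le. intros k _.
    assert (H : - (2 / c * (/ 2) ^ k) <= a (J + k)%nat).
    { eapply Rle_trans; [|apply Ha]. apply Ropp_le_contravar. unfold scale.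
      rewrite pow_add. pose proof (pow_lt (/ 2) k ltac:(lra)).
      assert (E : (/ 2) ^ J / x <= 1).
      { rewrite pow_inv. pose proof (pow_lt 2 J ltac:(lra)).
        apply Rmult_le_reg_r with (x * 2 ^ J); [nra|]. field_simplify; lra. }
      replace (2 / c * ((/ 2) ^ J * (/ 2) ^ k) / x) with (2 / c * (/ 2) ^ k * ((/ 2) ^ J / x))
        by (field; lra).
      assert (0 < 2 / c * (/ 2) ^ k) by (apply Rmult_lt_0_compat; auto; apply Rdiv_lt_0_compat; lra).
      rewrite <- (Rmult_1_r (2 / c * (/ 2) ^ k)) at 2. apply Rmult_le_compat_l; lra. }
    apply (Rmult_le_compat_l (L ^ (J + k))) in H; [|apply pow_le; lra].
    eapply Rle_trans; [|apply H]. right. rewrite pow_add. unfold Rdiv at 2.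
    rewrite Rpow_mult_distr. ring.
Qed.

(** With [J] the first index such that [|u| * 2 ^ J > 1], the head yields [16 / c * (growth c ^ J - 1)],
    the tail costs at most [8 / c * growth c ^ J], and the term in [/ u] adds [16 / c]. When
    [|u| <= 2 ^ (-M)] there is no tail and [J = M]. *)
Lemma corner_kernel_lower c M (u : C) : 0 < c <= 1 -> 0 < Cmod u -> c * Cmod u <= Re u ->
  8 / c <= Cmod u * Re (corner_kernel c M u) /\
  (Cmod u * 2 ^ M <= 1 -> 8 / c * growth c ^ M <= Cmod u * Re (corner_kernel c M u)).
Proof.
  intros Hc Hu HR. set (x := Cmod u) in *.
  set (a := fun k => x * Re (/ u - / (u + RtoC (scale c k)))%C).
  assert (Hb : forall k, c - x / scale c k <= a k /\ - (scale c k / x) <= a k).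
  { intros k. apply corner_term_bounds; auto; [lra|]. apply scale_pos. lra. }
  assert (E : x * Re (corner_kernel c M u) =
              16 / c ^ 2 * (x * Re (/ u)%C) + rsum (fun k => growth c ^ k * a k) M).
  { unfold corner_kernel.
    change (Re (?p + ?q)%C) with (Re p + Re q). rewrite re_scal_l, csum_Re, Rmult_plus_distr_l.
    rewrite <- rsum_scal. f_equal; [ring|]. apply rsum_ext. intros k _.
    rewrite re_scal_l. unfold a. ring. }
  assert (H1 : 16 / c <= 16 / c ^ 2 * (x * Re (/ u)%C)).
  { replace (16 / c) with (16 / c ^ 2 * c) by (field; lra).
    apply Rmult_le_compat_l; [|now apply Re_inv_ge].
    left. apply Rdiv_lt_0_compat; [lra|apply pow_lt; lra]. }
  assert (Hg : 1 <= growth c).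
  { unfold growth. pose proof (pow2_ge_0 c). lra. }
  assert (H8 : 0 < 8 / c) by (apply Rdiv_lt_0_compat; lra).
  assert (E16 : 16 / c = 2 * (8 / c)) by (field; lra).
  assert (Hlow : forall J, 8 / c <= 8 / c * growth c ^ J).
  { intros J. rewrite <- (Rmult_1_r (8 / c)) at 1. apply Rmult_le_compat_l; [lra|].
    now apply pow_R1_Rle. }
  assert (Hsmall : x * 2 ^ M <= 1 -> 8 / c * growth c ^ M <= x * Re (corner_kernel c M u)).
  { intros HM. rewrite E.
    assert (H2 := corner_sum_head a c x M Hc Hu (fun k => proj1 (Hb k))).
    specialize (Hlow M). rewrite E16 in H2.
    enough (16 / c * (growth c ^ M - 1) <= rsum (fun k => growth c ^ k * a k) M) by lra.
    rewrite E16. apply H2. intros k Hk. eapply Rle_trans; [|apply HM].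
    apply Rmult_le_compat_l; [lra|]. apply Rle_pow; [lra|lia]. }
  split; auto.
  destruct (Rle_lt_dec (x * 2 ^ M) 1) as [HM|HM].
  { eapply Rle_trans; [apply (Hlow M)|auto]. }
  destruct (least_index (fun k => x * 2 ^ k <= 1) M) as [J [HJ [HJ1 HJ2]]]; [lra|].
  rewrite E. replace M with (J + (M - J))%nat by lia. rewrite rsum_split.
  assert (H2 := corner_sum_head a c x J Hc Hu (fun k => proj1 (Hb k)) HJ2).
  assert (H3 := corner_sum_tail a c x J (M - J) Hc Hu (fun k => proj2 (Hb k)) ltac:(lra)).
  cbv beta in *. specialize (Hlow J). rewrite E16 in H1, H2. lra.
Qed.

(** The bound does not depend on [M]: at a fixed point the weights [growth c ^ k] are beaten by the
    scales [2 ^ (-k)]. *)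
Lemma corner_kernel_upper c M (u : C) : 0 < c <= 1 -> 0 < Cmod u -> 0 <= Re u ->
  Re (corner_kernel c M u) <= 16 / c ^ 2 / Cmod u + 8 / c / Cmod u ^ 2.
Proof.
  intros Hc Hu HR. set (L := growth c).
  assert (Hc2 : 0 < c ^ 2 <= 1) by (split; [apply pow_lt; lra|rewrite <- (pow1 2); apply pow_incr; lra]).
  assert (HL : 1 < L <= 3 / 2) by (unfold L, growth; lra).
  assert (Hu2 : 0 < Cmod u ^ 2) by now apply pow_lt.
  eapply Rle_trans; [apply Re_le_Cmod|]. unfold corner_kernel.
  eapply Rle_trans; [apply Cmod_triangle|]. apply Rplus_le_compat.
  - rewrite Cmod_mult, Cmod_R, Cmod_inv, Rabs_pos_eq; [right; reflexivity| |now apply Cmod_gt_0].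
    left. apply Rdiv_lt_0_compat; lra.
  - eapply Rle_trans; [apply Cmod_csum_le|].
    apply Rle_trans with (rsum (fun k => 2 / c / Cmod u ^ 2 * (L / 2) ^ k) M).
    + apply rsum_le. intros k _. fold L.
      rewrite Cmod_mult, Cmod_R, Rabs_pos_eq by (apply pow_le; lra).
      pose proof (resolvent_difference u (scale c k) Hu HR (scale_pos c k ltac:(lra))) as H.
      apply (Rmult_le_compat_l (L ^ k)) in H; [|apply pow_le; lra].
      eapply Rle_trans; [apply H|]. right. unfold scale.
      replace ((L / 2) ^ k) with (L ^ k * (/ 2) ^ k) by (rewrite <- Rpow_mult_distr; reflexivity).
      field. lra.
    + rewrite rsum_scal. pose proof (geom_sum_le (L / 2) M ltac:(lra)) as H.
      assert (H4 : / (1 - L / 2) <= 4).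
      { replace 4 with (/ / 4) by field. apply Rinv_le_contravar; lra. }
      replace (8 / c / Cmod u ^ 2) with (2 / c / Cmod u ^ 2 * 4) by (field; lra).
      apply Rmult_le_compat_l; [|exact (Rle_trans _ _ _ H H4)]. left. apply Rdiv_lt_0_compat; auto.
      apply Rdiv_lt_0_compat; lra.
Qed.

Lemma holomorphic_csum (F : nat -> C -> C) n : (forall k, (k < n)%nat -> holomorphic (F k)) ->
  holomorphic (fun z => csum (fun k => F k z) n).
Proof.
  intros H. induction n as [|n IH]; simpl; [apply holomorphic_const|].
  apply holomorphic_plus; [apply IH; auto|apply H; lia].
Qed.

Lemma gap_pos v w : Cmod v = 1 -> Cmod w < 1 -> 0 < Cmod (gap v w).
Proof.
  intros Hv Hw. apply Cmod_gt_0. apply Cmod_lt_1_minus_neq; auto. rewrite Cmod_conj. lra.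
Qed.

Lemma holomorphic_resolvent v t : Cmod v = 1 -> 0 <= t -> holomorphic (fun w => / (gap v w + RtoC t))%C.
Proof.
  intros Hv Ht.
  assert (Hnz : RtoC (1 + t) <> 0) by (intros E; apply RtoC_inj in E; lra).
  assert (Hb : Cmod (Cconj v / RtoC (1 + t))%C <= 1).
  { rewrite Cmod_div, Cmod_conj, Hv, Cmod_R, Rabs_pos_eq by (auto; lra).
    unfold Rdiv. rewrite Rmult_1_l, <- Rinv_1. apply Rinv_le_contravar; lra. }
  apply (holomorphic_ext (fun w => / RtoC (1 + t) * / (1 - (Cconj v / RtoC (1 + t)) * w))%C).
  - intros w Hw. pose proof (Cmod_lt_1_minus_neq _ w Hb Hw) as Hne.
    assert (E : (gap v w + t = RtoC (1 + t) * (1 - Cconj v / RtoC (1 + t) * w))%C).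
    { unfold gap. rewrite RtoC_plus in *. field. auto. }
    assert (Hinv : forall x y : C, x <> 0 -> y <> 0 -> (/ x * / y = / (x * y))%C)
      by (intros; field; auto).
    rewrite E. now apply Hinv.
  - apply holomorphic_scal. now apply holomorphic_geom.
Qed.

Lemma holomorphic_corner_kernel c M v : 0 < c -> Cmod v = 1 ->
  holomorphic (fun w => corner_kernel c M (gap v w)).
Proof.
  intros Hc Hv.
  assert (H0 : holomorphic (fun w => / gap v w)%C).
  { apply (holomorphic_ext (fun w => / (gap v w + RtoC 0))%C); [|apply holomorphic_resolvent; auto; lra].
    intros w _. f_equal. ring. }
  unfold corner_kernel. apply holomorphic_plus; [now apply holomorphic_scal|].
  apply (holomorphic_csum (fun k w => RtoC (growth c ^ k) * (/ gap v w - / (gap v w + RtoC (scale c k))))%C).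
  intros k _. apply holomorphic_scal.
  apply (holomorphic_ext (fun w => / gap v w + (- (1)) * / (gap v w + RtoC (scale c k)))%C).
  { intros w _. ring. }
  apply holomorphic_plus; auto. apply holomorphic_scal. apply holomorphic_resolvent; auto.
  left. now apply scale_pos.
Qed.

(** * Blaschke products with zeros near the vertices *)

(** This yields the classical formula for the pseudo-hyperbolic distance. *)
Lemma blaschke_factor_identity (a z : C) : Cmod (1 - Cconj a * z) ^ 2 - Cmod (z - a) ^ 2 =
  (1 - Cmod a ^ 2) * (1 - Cmod z ^ 2).
Proof. rewrite !Cmod2_alt. destruct a, z. unfold Re, Im. simpl. ring. Qed.

Lemma blaschke_factor_mod2 a z : Cmod a < 1 -> Cmod z < 1 ->
  Cmod (blaschke_factor a z) ^ 2 = 1 - (1 - Cmod a ^ 2) * (1 - Cmod z ^ 2) / Cmod (1 - Cconj a * z) ^ 2.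
Proof.
  intros Ha Hz.
  assert (Hne : (1 - Cconj a * z)%C <> 0).
  { apply Cmod_lt_1_minus_neq; auto. rewrite Cmod_conj. lra. }
  pose proof (proj1 (Cmod_gt_0 _) Hne) as Hpos.
  rewrite <- blaschke_factor_identity. unfold blaschke_factor. rewrite Cmod_div by auto.
  unfold Rdiv at 1. rewrite Rpow_mult_distr, pow_inv. field. lra.
Qed.

Lemma one_minus_sq_pos z : Cmod z < 1 -> 0 < 1 - Cmod z ^ 2.
Proof. intros Hz. pose proof (Cmod_ge_0 z). nra. Qed.

Lemma blaschke_factor_le_1 a z : Cmod a < 1 -> Cmod z < 1 -> Cmod (blaschke_factor a z) <= 1.
Proof.
  intros Ha Hz. apply Rsqr_incr_0_var; [|lra]. rewrite !Rsqr_pow2, pow1, blaschke_factor_mod2 by auto.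
  assert (Hne : (1 - Cconj a * z)%C <> 0).
  { apply Cmod_lt_1_minus_neq; auto. rewrite Cmod_conj. lra. }
  pose proof (proj1 (Cmod_gt_0 _) Hne) as Hpos.
  pose proof (one_minus_sq_pos a Ha). pose proof (one_minus_sq_pos z Hz).
  assert (0 <= (1 - Cmod a ^ 2) * (1 - Cmod z ^ 2) / Cmod (1 - Cconj a * z) ^ 2); [|lra].
  apply Rdiv_le_0_compat; [|now apply pow_lt]. apply Rmult_le_pos; lra.
Qed.

Lemma blaschke_le_1 l z : Forall (fun a => Cmod a < 1) l -> Cmod z < 1 -> Cmod (blaschke l z) <= 1.
Proof.
  intros Hl Hz. induction Hl as [|a l Ha _ IH]; simpl; [rewrite Cmod_1; lra|].
  rewrite Cmod_mult. pose proof (blaschke_factor_le_1 a z Ha Hz).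
  pose proof (Cmod_ge_0 (blaschke_factor a z)). pose proof (Cmod_ge_0 (blaschke l z)). nra.
Qed.

Lemma blaschke_app l1 l2 z : blaschke (l1 ++ l2) z = (blaschke l1 z * blaschke l2 z)%C.
Proof. induction l1 as [|a l1 IH]; simpl; [|rewrite IH]; ring. Qed.

Lemma blaschke_repeat a n z : blaschke (repeat a n) z = (blaschke_factor a z ^ n)%C.
Proof. induction n as [|n IH]; simpl; [|rewrite IH]; reflexivity. Qed.

Lemma blaschke_flat_map_le (g : nat -> list C) l i z :
  Forall (fun a => Cmod a < 1) (flat_map g l) -> Cmod z < 1 -> In i l ->
  Cmod (blaschke (flat_map g l) z) <= Cmod (blaschke (g i) z).
Proof.
  intros Hl Hz Hi. induction l as [|j l IH]; [easy|]. simpl in *.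
  apply Forall_app in Hl. destruct Hl as [Hj Hl]. rewrite blaschke_app, Cmod_mult.
  pose proof (blaschke_le_1 _ z Hj Hz). pose proof (blaschke_le_1 _ z Hl Hz).
  pose proof (Cmod_ge_0 (blaschke (g j) z)). pose proof (Cmod_ge_0 (blaschke (flat_map g l) z)).
  destruct Hi as [->|Hi]; [nra|]. specialize (IH Hl Hi). nra.
Qed.

Definition corner_point (v : C) (k : nat) : C := (v * RtoC (1 - (/ 2) ^ k))%C.

(** Zeros at each dyadic distance from each vertex make one factor bounded away from 1 at every point
    of the polygon farther than [2 ^ (-M)] from the vertices; repeating them [M] times makes the
    product exponentially small in [M]. The degree is quadratic in [M], whence the square root of
    [n] in the final estimate. *)
Definition corner_zeros (v : nat -> C) (m M : nat) : list C :=
  flat_map (fun i => flat_map (fun k => repeat (corner_point (v i) k) M) (seq 0 M)) (seq 0 (S m)).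

Lemma half_pow k : 0 < (/ 2) ^ k <= 1.
Proof.
  split; [apply pow_lt; lra|]. rewrite <- (pow1 k). apply pow_incr. lra.
Qed.

Lemma Cmod_corner_point v k : Cmod v = 1 -> Cmod (corner_point v k) < 1.
Proof.
  intros Hv. pose proof (half_pow k). unfold corner_point.
  rewrite Cmod_mult, Hv, Cmod_R, Rabs_pos_eq; lra.
Qed.

Lemma corner_zeros_in_disk v m M : (forall i, (i <= m)%nat -> Cmod (v i) = 1) ->
  Forall (fun a => Cmod a < 1) (corner_zeros v m M).
Proof.
  intros Hv. apply Forall_forall. intros a Ha. unfold corner_zeros in Ha.
  apply in_flat_map in Ha. destruct Ha as [i [Hi Ha]].
  apply in_flat_map in Ha. destruct Ha as [k [_ Ha]]. apply repeat_spec in Ha. subst a.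
  apply in_seq in Hi. apply Cmod_corner_point, Hv. lia.
Qed.

Lemma flat_map_length_const (g : nat -> list C) l n : (forall i, length (g i) = n) ->
  length (flat_map g l) = (length l * n)%nat.
Proof.
  intros H. induction l as [|i l IH]; simpl; auto. now rewrite length_app, H, IH.
Qed.

Lemma corner_zeros_length v m M : length (corner_zeros v m M) = (S m * (M * M))%nat.
Proof.
  unfold corner_zeros. rewrite (flat_map_length_const _ _ (M * M)%nat), length_seq; auto.
  intros i. rewrite (flat_map_length_const _ _ M), length_seq; auto.
  intros k. apply repeat_length.
Qed.

Lemma nearby_scale x M : / 2 ^ M < x <= 2 -> (0 < M)%nat ->
  exists k, (k < M)%nat /\ (/ 2) ^ k / 2 <= x <= 2 * (/ 2) ^ k.
Proof.
  intros Hx. rewrite <- pow_inv in Hx. induction M as [|M IH]; intros HM; [lia|].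
  destruct (Nat.eq_dec M 0) as [->|HM0].
  { exists O. split; auto. simpl in *. lra. }
  destruct (Rlt_le_dec ((/ 2) ^ M) x) as [Hlt|Hle].
  - destruct IH as [k [Hk H]]; [lra|lia|]. exists k. split; auto.
  - exists M. split; auto. simpl in Hx. pose proof (half_pow M). lra.
Qed.

(** In [1 - |b|^2 = (1 - |a|^2) (1 - |w|^2) / |1 - conj a w|^2], the numerator is at least
    [t * (c * x)] and the denominator at most [(t + 2 * x) ^ 2], where [t] and [x] are the distances
    of [a] and [w] to the vertex, within a factor 2 of one another. *)
Lemma blaschke_factor_corner_point v k w c : Cmod v = 1 -> Cmod w < 1 -> 0 < c ->
  c * Cmod (gap v w) <= 1 - Cmod w ^ 2 ->
  (/ 2) ^ k / 2 <= Cmod (gap v w) <= 2 * (/ 2) ^ k ->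
  Cmod (blaschke_factor (corner_point v k) w) ^ 2 <= 1 - c / 25.
Proof.
  intros Hv Hw Hc HP Hx. set (t := (/ 2) ^ k) in *. set (x := Cmod (gap v w)) in *.
  pose proof (half_pow k) as Ht. fold t in Ht.
  rewrite blaschke_factor_mod2 by (auto; now apply Cmod_corner_point).
  set (D := Cmod (1 - Cconj (corner_point v k) * w)).
  assert (HD : D <= t + 2 * x).
  { unfold D, corner_point. fold t.
    replace (1 - Cconj (v * RtoC (1 - t)) * w)%C with (RtoC t + RtoC (1 - t) * gap v w)%C.
    - eapply Rle_trans; [apply Cmod_triangle|].
      rewrite Cmod_mult, !Cmod_R, !Rabs_pos_eq by lra. fold x. nra.
    - rewrite Cmult_conj, Cconj_R. unfold gap. rewrite RtoC_minus. ring. }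
  assert (HD0 : 0 < D).
  { apply Cmod_gt_0. apply Cmod_lt_1_minus_neq; auto.
    rewrite Cmod_conj. left. now apply Cmod_corner_point. }
  assert (Ha : t <= 1 - Cmod (corner_point v k) ^ 2).
  { unfold corner_point. fold t. rewrite Cmod_mult, Hv, Cmod_R, Rabs_pos_eq by lra. nra. }
  enough (c / 25 <= (1 - Cmod (corner_point v k) ^ 2) * (1 - Cmod w ^ 2) / D ^ 2) by lra.
  apply Rmult_le_reg_r with (D ^ 2); [now apply pow_lt|].
  unfold Rdiv at 2. rewrite Rmult_assoc, Rinv_l, Rmult_1_r by (apply pow_nonzero; lra).
  apply Rle_trans with (t * (c * x)).
  - assert (HD2 : D ^ 2 <= 25 * (t * x)).
    { apply Rle_trans with ((t + 2 * x) ^ 2); [apply pow_incr; lra|].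
      assert (0 <= (x - t / 2) * (2 * t - x)) by (apply Rmult_le_pos; lra). nra. }
    apply (Rmult_le_compat_l (c / 25)) in HD2; [|lra]. lra.
  - apply Rmult_le_compat; try lra. apply Rmult_le_pos; lra.
Qed.

Lemma blaschke_corner_le v m M w c i :
  (forall i, (i <= m)%nat -> Cmod (v i) = 1) -> 0 < c <= 1 -> Cmod w < 1 -> (i <= m)%nat ->
  c * Cmod (gap (v i) w) <= 1 - Cmod w ^ 2 -> 1 < Cmod (gap (v i) w) * 2 ^ M ->
  Cmod (blaschke (corner_zeros v m M) w) ^ 2 <= (1 - c / 25) ^ M.
Proof.
  intros Hv Hc Hw Hi HP Hx.
  destruct (Nat.eq_dec M 0) as [->|HM].
  { pose proof (blaschke_le_1 _ w (corner_zeros_in_disk v m 0 Hv) Hw).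
    simpl (_ ^ 0). rewrite <- (pow1 2). apply pow_incr. split; auto. apply Cmod_ge_0. }
  assert (H2M : 0 < 2 ^ M) by (apply pow_lt; lra).
  destruct (nearby_scale (Cmod (gap (v i) w)) M) as [k [Hk Hxk]]; [split| |]; [| |lia|].
  { apply Rmult_lt_reg_r with (2 ^ M); auto. rewrite Rinv_l; lra. }
  { unfold gap, Cminus. eapply Rle_trans; [apply Cmod_triangle|].
    rewrite Cmod_1, Cmod_opp, Cmod_mult, Cmod_conj, Hv by auto. lra. }
  pose proof (corner_zeros_in_disk v m M Hv) as Hl.
  assert (H1 : Cmod (blaschke (corner_zeros v m M) w) <= Cmod (blaschke_factor (corner_point (v i) k) w ^ M)).
  { unfold corner_zeros in *. eapply Rle_trans.
    - apply (blaschke_flat_map_le _ _ i w Hl Hw). apply in_seq. lia.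
    - rewrite <- blaschke_repeat.
      apply (blaschke_flat_map_le (fun k => repeat (corner_point (v i) k) M) _ k w); auto.
      + apply Forall_forall. intros a Ha. rewrite Forall_forall in Hl. apply Hl.
        apply in_flat_map. exists i. split; auto. apply in_seq. lia.
      + apply in_seq. lia. }
  apply Rle_trans with (Cmod (blaschke_factor (corner_point (v i) k) w ^ M)%C ^ 2).
  - apply pow_incr. split; auto. apply Cmod_ge_0.
  - rewrite Cmod_pow, <- pow_mult, Nat.mul_comm, pow_mult. apply pow_incr.
    split; [apply pow2_ge_0|]. apply blaschke_factor_corner_point; auto. lra.
Qed.

(** * Approximation of the composition operator *)

Definition coef (f : disk -> C) : nat -> C := epsilon (inhabits (fun _ => RtoC 0)) (H2_coef f).

Lemma coef_spec f : H2 f -> H2_coef f (coef f).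
Proof. apply epsilon_spec. Qed.

Lemma coef_combination c d f g : H2 f -> H2 g -> coef (combination c d f g) = coef_comb c d (coef f) (coef g).
Proof.
  intros Hf Hg. apply (H2_coef_unique (combination c d f g)).
  - now apply coef_spec, H2_combination.
  - apply H2_coef_combination; now apply coef_spec.
Qed.

Lemma coef_l2_le f : H2 f -> exists M, l2_le (coef f) M.
Proof. intros Hf. apply coef_spec, H2_coef_iff in Hf. apply Hf. Qed.

Lemma eval_coef f (z : disk) : H2 f -> eval (coef f) z = f z.
Proof.
  intros Hf. apply coef_spec in Hf. apply cser_ctot, is_pseries_pser, Hf.
Qed.

Lemma eval_disk_series a M : l2_le a M -> disk_series a (eval a).
Proof. intros H z Hz. apply eval_pser; auto. now apply l2_le_geom_bounded with M. Qed.

Lemma holomorphic_blaschke l : Forall (fun a => Cmod a < 1) l -> holomorphic (blaschke l).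
Proof.
  induction 1 as [|a l Ha _ IH]; simpl; [apply holomorphic_const|].
  apply holomorphic_mult; auto. unfold blaschke_factor, Cdiv. apply holomorphic_mult.
  - apply holomorphic_plus; [apply holomorphic_id|apply holomorphic_const].
  - apply holomorphic_geom. rewrite Cmod_conj. lra.
Qed.

Definition corner_sum (c : R) (v : nat -> C) (m M : nat) (w : C) : C :=
  csum (fun i => corner_kernel c M (gap (v i) w)) (S m).

(** The larger of the losses per unit of [M] near the vertices and away from them. *)
Definition decay (c : R) : R := Rmax (/ growth c) (1 - c / 25).

Lemma growth_gt_1 c : 0 < c -> 1 < growth c.
Proof. intros Hc. unfold growth. assert (0 < c ^ 2) by now apply pow_lt. lra. Qed.

Lemma corner_sum_ge c v m M w i : 0 < c <= 1 -> (forall i, (i <= m)%nat -> Cmod (v i) = 1) ->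
  Cmod w < 1 -> in_corners c v m w -> (i <= m)%nat ->
  Re (corner_kernel c M (gap (v i) w)) <= Re (corner_sum c v m M w).
Proof.
  intros Hc Hv Hw [HR _] Hi. unfold corner_sum. rewrite csum_Re.
  apply (rsum_term_le (fun i => Re (corner_kernel c M (gap (v i) w)))); [|lia].
  intros j Hj. assert (Hj' : (j <= m)%nat) by lia.
  pose proof (gap_pos (v j) w (Hv j Hj') Hw) as Hg.
  destruct (corner_kernel_lower c M (gap (v j) w) Hc Hg (HR j Hj')) as [H _].
  assert (0 < 8 / c) by (apply Rdiv_lt_0_compat; lra).
  apply Rmult_le_reg_l with (Cmod (gap (v j) w)); auto. lra.
Qed.

(** Point evaluation costs [1 / (1 - |w|^2)], that is [1 / x] up to a constant, where [x] is the
    distance to a vertex; the factor [x] comes back with the bound on [B]. *)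
Lemma corner_product_bound c v m M w (B G : C) e N i : 0 < c <= 1 ->
  (forall i, (i <= m)%nat -> Cmod (v i) = 1) -> Cmod w < 1 -> in_corners c v m w ->
  0 <= e -> (i <= m)%nat -> c * Cmod (gap (v i) w) <= 1 - Cmod w ^ 2 ->
  Cmod B ^ 2 <= e * (c / 8 * (Cmod (gap (v i) w) * Re (corner_kernel c M (gap (v i) w)))) ->
  Cmod G ^ 2 * (1 - Cmod w ^ 2) <= N ->
  Cmod (B * G)%C ^ 2 <= N * e / 8 * Re (corner_sum c v m M w).
Proof.
  intros Hc Hv Hw HC He Hi HP HB HG.
  pose proof (gap_pos (v i) w (Hv i Hi) Hw) as Hg.
  pose proof (corner_sum_ge c v m M w i Hc Hv Hw HC Hi) as Hsum.
  destruct (corner_kernel_lower c M (gap (v i) w) Hc Hg (proj1 HC i Hi)) as [Hlow _].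
  set (x := Cmod (gap (v i) w)) in *. set (k := Re (corner_kernel c M (gap (v i) w))) in *.
  assert (H8 : 0 < 8 / c) by (apply Rdiv_lt_0_compat; lra).
  assert (Hk : 0 < k) by (apply Rmult_lt_reg_l with x; lra).
  pose proof (pow2_ge_0 (Cmod G)) as HG0.
  assert (HGx : Cmod G ^ 2 * (c * x) <= N).
  { eapply Rle_trans; [|apply HG]. now apply Rmult_le_compat_l. }
  rewrite Cmod_mult, Rpow_mult_distr.
  apply Rle_trans with (e * (c / 8 * (x * k)) * Cmod G ^ 2); [now apply Rmult_le_compat_r|].
  replace (e * (c / 8 * (x * k)) * Cmod G ^ 2) with (e / 8 * k * (Cmod G ^ 2 * (c * x)))
    by field.
  assert (HN : 0 <= N).
  { eapply Rle_trans; [|apply HGx]. apply Rmult_le_pos; auto. apply Rmult_le_pos; lra. }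
  apply Rle_trans with (e / 8 * k * N).
  - apply Rmult_le_compat_l; auto. apply Rmult_le_pos; lra.
  - replace (e / 8 * k * N) with (N * e / 8 * k) by field.
    apply Rmult_le_compat_l; auto. apply Rmult_le_pos; [apply Rmult_le_pos; auto|lra].
Qed.

Lemma corner_trivial_bound c v m M w (B G : C) N : 0 < c <= 1 ->
  (forall i, (i <= m)%nat -> Cmod (v i) = 1) -> Cmod w < 1 -> in_corners c v m w ->
  Cmod B <= 1 -> Cmod G ^ 2 * (1 - Cmod w ^ 2) <= N ->
  Cmod (B * G)%C ^ 2 <= N / 8 * Re (corner_sum c v m M w).
Proof.
  intros Hc Hv Hw HC HB HG. destruct (proj2 HC) as [i [Hi HP]].
  replace (N / 8) with (N * 1 / 8) by field.
  apply (corner_product_bound c v m M w B G 1 N i); auto; [lra|].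
  pose proof (gap_pos (v i) w (Hv i Hi) Hw) as Hg.
  destruct (corner_kernel_lower c M (gap (v i) w) Hc Hg (proj1 HC i Hi)) as [Hlow _].
  apply Rle_trans with 1.
  - rewrite <- (pow1 2). apply pow_incr. split; auto. apply Cmod_ge_0.
  - rewrite Rmult_1_l. apply (Rmult_le_compat_l (c / 8)) in Hlow; [|lra].
    replace (c / 8 * (8 / c)) with 1 in Hlow by (field; lra). auto.
Qed.

(** Within [2 ^ (-M)] of a vertex the kernel itself exceeds [growth c ^ M / x], and elsewhere the
    Blaschke product is small. *)
Lemma corner_blaschke_bound c v m M w (G : C) N : 0 < c <= 1 ->
  (forall i, (i <= m)%nat -> Cmod (v i) = 1) -> Cmod w < 1 -> in_corners c v m w ->
  Cmod G ^ 2 * (1 - Cmod w ^ 2) <= N ->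
  Cmod (blaschke (corner_zeros v m M) w * G)%C ^ 2 <=
    N * decay c ^ M / 8 * Re (corner_sum c v m M w).
Proof.
  intros Hc Hv Hw HC HG. destruct (proj2 HC) as [i [Hi HP]].
  pose proof (growth_gt_1 c ltac:(lra)) as Hgr.
  assert (Hd0 : 0 < / growth c) by (apply Rinv_0_lt_compat; lra).
  assert (Hd1 : / growth c <= decay c) by apply Rmax_l.
  assert (Hd2 : 1 - c / 25 <= decay c) by apply Rmax_r.
  apply (corner_product_bound c v m M w _ G (decay c ^ M) N i); auto; [apply pow_le; lra|].
  pose proof (gap_pos (v i) w (Hv i Hi) Hw) as Hg.
  destruct (corner_kernel_lower c M (gap (v i) w) Hc Hg (proj1 HC i Hi)) as [Hlow Htip].
  set (x := Cmod (gap (v i) w)) in *. set (k := Re (corner_kernel c M (gap (v i) w))) in *.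
  assert (Hscale : forall y, 8 / c * y <= x * k -> y <= c / 8 * (x * k)).
  { intros y Hy. apply (Rmult_le_compat_l (c / 8)) in Hy; [|lra].
    replace (c / 8 * (8 / c * y)) with y in Hy by (field; lra). auto. }
  destruct (Rle_lt_dec (x * 2 ^ M) 1) as [Hx|Hx].
  - specialize (Htip Hx). apply Hscale in Htip.
    apply Rle_trans with 1.
    + rewrite <- (pow1 2). apply pow_incr. split; [apply Cmod_ge_0|].
      apply blaschke_le_1; auto. now apply corner_zeros_in_disk.
    + apply Rle_trans with (decay c ^ M * growth c ^ M).
      * rewrite <- Rpow_mult_distr. apply pow_R1_Rle.
        replace 1 with (/ growth c * growth c) by (field; lra).
        apply Rmult_le_compat_r; lra.
      * apply Rmult_le_compat_l; auto. apply pow_le. lra.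
  - apply Rle_trans with ((1 - c / 25) ^ M).
    + now apply blaschke_corner_le with i.
    + apply Rle_trans with (decay c ^ M * 1).
      * rewrite Rmult_1_r. apply pow_incr. lra.
      * apply Rmult_le_compat_l; [apply pow_le; lra|]. apply Hscale. lra.
Qed.

(** The majorant [K] is composed with [phi] as well, and [hardy_majorant] reads off its value at
    the image of the centre. *)
Lemma composed_H2 (phi : disk -> disk) F K (g : disk -> C) :
  holomorphic (extend (fun z => phi z)) -> holomorphic F -> holomorphic K ->
  (forall z : disk, g z = F (phi z)) ->
  (forall z : disk, Cmod (F (phi z)) ^ 2 <= Re (K (phi z))) ->
  exists b, disk_series b (extend g) /\ l2_le b (Re (K (extend (fun z => phi z) 0))).
Proof.
  intros Hphi HF HK Hg Hmaj. set (p := extend (fun z => phi z)) in *.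
  assert (Hp : forall z, Cmod z < 1 -> Cmod (p z) < 1).
  { apply (extend_holds (fun w => Cmod w < 1)). intros z. apply disk_lt. }
  destruct (holomorphic_comp F p HF Hphi Hp) as [b Hb]. exists b. split.
  - apply disk_series_ext with (fun z => F (p z)); auto.
    intros z Hz. rewrite (extend_eq g z Hz), Hg. unfold p. now rewrite (extend_eq _ z Hz).
  - intros n. apply (hardy_majorant b (fun z => F (p z)) (fun z => K (p z))); auto.
    + now apply holomorphic_comp.
    + intros z Hz. unfold p. rewrite (extend_eq _ z Hz). apply Hmaj.
Qed.

(** Composition with [phi], after the orthogonal projection along the multiples of the Blaschke
    product; the projection of [f] is [f] minus its multiple of the product. *)
Definition approximant (l : list C) (phi : disk -> disk) : operator :=
  fun f z => (f (phi z) - blaschke l (phi z) * eval (deflates l (coef f)) (phi z))%C.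

Lemma approximant_linear l phi z : Forall (fun a => Cmod a < 1) l ->
  linear_on_H2 (fun f => approximant l phi f z).
Proof.
  intros Hl c d f g Hf Hg. unfold approximant. rewrite coef_combination by auto.
  destruct (coef_l2_le f Hf) as [M HM]. destruct (coef_l2_le g Hg) as [K HK].
  rewrite (deflates_coef_comb c d l Hl _ _ M K HM HK), eval_coef_comb.
  - unfold combination. ring.
  - apply l2_le_geom_bounded with M. now apply deflates_l2_le.
  - apply l2_le_geom_bounded with K. now apply deflates_l2_le.
  - apply disk_lt.
Qed.

Lemma approximant_rank l phi n : Forall (fun a => Cmod a < 1) l -> (length l < n)%nat ->
  rank_lt (approximant l phi) n.
Proof.
  intros Hl Hn. apply (rank_lt_of_functionals _ (fun i f => obstruction l i (coef f)) (length l)); auto.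
  - intros z. now apply approximant_linear.
  - intros i c d f g Hf Hg. rewrite coef_combination by auto.
    destruct (coef_l2_le f Hf) as [M HM]. destruct (coef_l2_le g Hg) as [K HK].
    now apply obstruction_coef_comb with M K.
  - intros f Hf H0 z. unfold approximant. destruct (coef_l2_le f Hf) as [M HM].
    rewrite <- (eval_coef f (phi z) Hf), (deflates_divides l Hl (coef f) M) by auto using disk_lt.
    ring.
Qed.

Lemma Cmod_minus_sq_le (x y : C) : Cmod (x - y) ^ 2 <= 2 * Cmod x ^ 2 + 2 * Cmod y ^ 2.
Proof.
  apply Rle_trans with ((Cmod x + Cmod y) ^ 2).
  - apply pow_incr. split; [apply Cmod_ge_0|]. unfold Cminus. rewrite <- (Cmod_opp y). apply Cmod_triangle.
  - pose proof (pow2_ge_0 (Cmod x - Cmod y)). nra.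
Qed.

(** On a unit vector [f] the error is [(B * g)] composed with [phi], where [B] is the Blaschke product
    and [g] is the deflation of [f], of norm at most 1; [corner_blaschke_bound] majorizes it. *)
Lemma approximation_error (P : C -> Prop) c v m (phi : disk -> disk) M n :
  0 < c <= 1 -> (forall i, (i <= m)%nat -> Cmod (v i) = 1) ->
  (forall w, P w -> in_corners c v m w) ->
  holomorphic (extend (fun z => phi z)) -> (forall z : disk, P (phi z)) ->
  (S m * (M * M) < n)%nat ->
  Rbar_le (approx_number n (composition_operator phi))
    (Finite (sqrt (decay c ^ M / 8 * Re (corner_sum c v m M (extend (fun z => phi z) 0))))).
Proof.
  intros Hc Hv HP Hphi Himg Hn.
  set (l := corner_zeros v m M).
  assert (Hl : Forall (fun a => Cmod a < 1) l) by now apply corner_zeros_in_disk.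
  set (k0 := Re (corner_sum c v m M (extend (fun z => phi z) 0))).
  assert (HK : holomorphic (corner_sum c v m M)).
  { apply (holomorphic_csum (fun i w => corner_kernel c M (gap (v i) w))).
    intros i Hi. apply holomorphic_corner_kernel; [lra|]. apply Hv. lia. }
  assert (HPw : forall z : disk, in_corners c v m (phi z)) by (intros; now apply HP).
  assert (Hbound : forall f a N, H2_coef f a -> l2_le a N ->
    exists b, disk_series b (extend (approximant l phi f)) /\ l2_le b (N / 2 * k0)).
  { intros f a N Ha HN. assert (Hf : H2 f) by now exists a.
    pose proof (H2_coef_unique f (coef f) a (coef_spec f Hf) Ha) as Ec.
    pose proof (deflates_l2_le l Hl a N HN) as HD.
    unfold k0. rewrite <- re_scal_l.
    apply (composed_H2 phi (fun w => eval a w + (- (1)) * (blaschke l w * eval (deflates l a) w))%C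
             (fun w => RtoC (N / 2) * corner_sum c v m M w)%C); auto.
    - apply holomorphic_plus; [eexists; eapply eval_disk_series, HN|]. apply holomorphic_scal.
      apply holomorphic_mult; [now apply holomorphic_blaschke|]. eexists; eapply eval_disk_series, HD.
    - now apply holomorphic_scal.
    - intros z. unfold approximant. rewrite Ec, <- (eval_coef f (phi z) Hf), Ec. ring.
    - intros z. rewrite re_scal_l. set (w := disk_val (phi z)).
      assert (Hw : Cmod w < 1) by apply disk_lt.
      pose proof (corner_trivial_bound c v m M w 1 (eval a w) N Hc Hv Hw (HPw z)) as H1.
      rewrite Cmult_1_l, Cmod_1 in H1.
      specialize (H1 (Rle_refl _) (point_evaluation a N w _ HN Hw (eval_disk_series a N HN w Hw))).
      pose proof (corner_trivial_bound c v m M w (blaschke l w) (eval (deflates l a) w) N Hc Hv Hw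
        (HPw z) (blaschke_le_1 l w Hl Hw)
        (point_evaluation _ N w _ HD Hw (eval_disk_series _ N HD w Hw))) as H2.
      replace (eval a w + - (1) * (blaschke l w * eval (deflates l a) w))%C
        with (eval a w - blaschke l w * eval (deflates l a) w)%C by ring.
      eapply Rle_trans; [apply Cmod_minus_sq_le|]. lra. }
  assert (Hle : Rbar_le (op_norm (op_sub (composition_operator phi) (approximant l phi)))
                  (Finite (sqrt (decay c ^ M / 8 * k0)))).
  { apply op_norm_le. intros f a Ha HN. assert (Hf : H2 f) by now exists a.
    pose proof (H2_coef_unique f (coef f) a (coef_spec f Hf) Ha) as Ec.
    pose proof (deflates_l2_le l Hl a 1 HN) as HD.
    unfold k0. rewrite <- re_scal_l.
    apply (composed_H2 phi (fun w => blaschke l w * eval (deflates l a) w)%C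
             (fun w => RtoC (decay c ^ M / 8) * corner_sum c v m M w)%C); auto.
    - apply holomorphic_mult; [now apply holomorphic_blaschke|]. eexists; eapply eval_disk_series, HD.
    - now apply holomorphic_scal.
    - intros z. unfold op_sub, composition_operator, approximant. rewrite Ec. ring.
    - intros z. rewrite re_scal_l. set (w := disk_val (phi z)).
      assert (Hw : Cmod w < 1) by apply disk_lt.
      replace (decay c ^ M / 8) with (1 * decay c ^ M / 8) by field.
      apply corner_blaschke_bound; auto; [apply HPw|].
      exact (point_evaluation _ 1 w _ HD Hw (eval_disk_series _ 1 HD w Hw)). }
  eapply Rbar_le_trans; [|apply Hle].
  unfold approx_number, Rbar_glb. destruct (Rbar_ex_glb _) as [s Hs]. simpl. apply Hs.
  exists (approximant l phi). split; [|split; auto].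
  - repeat split.
    + intros f [a Ha]. pose proof (proj1 (H2_coef_iff f a) Ha) as [[N HN] _].
      destruct (Hbound f a N Ha HN) as [b [Hb HbN]]. exists b. apply H2_coef_iff. eauto.
    + intros a b f g Hf Hg z. now apply (approximant_linear l phi z Hl a b f g).
    + eapply Rbar_le_lt_trans; [apply (op_norm_le _ (1 / 2 * k0))|].
      { intros f a Ha HN. now apply (Hbound f a 1). }
      exact I.
  - apply approximant_rank; auto. unfold l. now rewrite corner_zeros_length.
Qed.

Lemma square_below q n : (1 <= n)%nat -> (1 <= q)%nat ->
  exists M, (q * (M * M) < n)%nat /\ (n <= q * (S M * S M))%nat.
Proof.
  intros Hn Hq. induction Hn as [|n Hn [M [H1 H2]]].
  - exists O. split; nia.
  - destruct (le_lt_dec (S n) (q * (S M * S M))) as [H|H].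
    + exists M. split; lia.
    + exists (S M). split; nia.
Qed.

Theorem theorem2p4 (P : C -> Prop) (hP : inscribed_polygon P) :
  exists beta : R, 0 < beta /\
    forall phi : disk -> disk,
      analytic (fun z : disk => disk_val (phi z)) ->
      (forall z : disk, P (phi z)) ->
      exists alpha : R, 0 < alpha /\
        forall n : nat, (1 <= n)%nat ->
          Rbar_le (approx_number n (composition_operator phi))
                  (Finite (alpha * exp (- beta * sqrt (INR n)))).
Proof.
  destruct (polygon_corners P hP) as [m [v [c [Hc [Hv HPc]]]]].
  set (s := decay c).
  pose proof (growth_gt_1 c ltac:(lra)) as Hgr.
  assert (Hs : 0 < s < 1).
  { split.
    - eapply Rlt_le_trans; [|apply Rmax_l]. apply Rinv_0_lt_compat. lra.
    - apply Rmax_lub_lt; [|lra]. rewrite <- Rinv_1. apply Rinv_lt_contravar; lra. }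
  (* The error is the square root of a constant times [s ^ M], hence the half. *)
  set (kappa := - ln s / 2).
  assert (Hk : 0 < kappa).
  { unfold kappa. pose proof (ln_increasing s 1 (proj1 Hs) (proj2 Hs)) as H.
    rewrite ln_1 in H. lra. }
  assert (Hq : 0 < INR (S m)) by apply INR_S_pos.
  assert (Hsq : 0 < sqrt (INR (S m))) by now apply sqrt_lt_R0.
  exists (kappa / sqrt (INR (S m))). split; [now apply Rdiv_lt_0_compat|].
  intros phi Hphi Himg.
  assert (Hp : holomorphic (extend (fun z => phi z))).
  { destruct (local_to_global (extend (fun z => phi z))) as [a Ha].
    - apply (extend_holds (fun w => Cmod w <= 1)). intros z. left. apply disk_lt.
    - now apply analytic_represents.
    - exists a. intros z Hz. replace z with (0 + z)%C at 2 by ring. auto. }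
  set (w0 := extend (fun z => phi z) 0).
  assert (Hw0 : Cmod w0 < 1).
  { apply (extend_holds (fun w => Cmod w < 1)); [intros; apply disk_lt|rewrite Cmod_0; lra]. }
  assert (HP0 : P w0) by (apply (extend_holds P); auto; rewrite Cmod_0; lra).
  set (K := rsum (fun i => 16 / c ^ 2 / Cmod (gap (v i) w0) + 8 / c / Cmod (gap (v i) w0) ^ 2) (S m)).
  assert (HK : forall M, Re (corner_sum c v m M w0) <= K).
  { intros M. unfold corner_sum, K. rewrite csum_Re. apply rsum_le. intros i Hi.
    assert (Hi' : (i <= m)%nat) by lia.
    pose proof (gap_pos (v i) w0 (Hv i Hi') Hw0) as Hg.
    apply corner_kernel_upper; auto.
    eapply Rle_trans; [|apply (proj1 (HPc w0 HP0) i Hi')]. nra. }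
  (* [exp kappa] absorbs the rounding of [sqrt (n / (m + 1))] down to the integer [M]. *)
  exists ((sqrt (K / 8) + 1) * exp kappa). split.
  { apply Rmult_lt_0_compat; [|apply exp_pos]. pose proof (sqrt_pos (K / 8)). lra. }
  intros n Hn. destruct (square_below (S m) n Hn) as [M [HM1 HM2]]; [lia|].
  eapply Rbar_le_trans; [apply (approximation_error P c v m phi M n); auto|].
  fold w0. fold s.
  match goal with |- Rbar_le (Finite ?x) (Finite ?y) => change (x <= y) end.
  set (t := exp (- kappa * INR M)).
  assert (Hpow : s ^ M = t ^ 2).
  { rewrite <- Rpower_pow by lra. unfold Rpower, t. simpl. rewrite Rmult_1_r, <- exp_plus.
    f_equal. unfold kappa. field. }
  assert (Ht : 0 < t) by apply exp_pos.
  apply Rle_trans with (t * sqrt (K / 8)).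
  - rewrite <- (sqrt_pow2 t) by lra. rewrite <- sqrt_mult_alt by apply pow2_ge_0.
    apply sqrt_le_1_alt. rewrite Hpow. pose proof (HK M) as H.
    pose proof (pow2_ge_0 t) as Ht2.
    apply (Rmult_le_compat_l (t ^ 2 / 8)) in H; lra.
  - rewrite Rmult_comm, Rmult_assoc, <- exp_plus.
    apply Rmult_le_compat; [apply sqrt_pos|lra|lra|].
    assert (Hexp : forall x y, x <= y -> exp x <= exp y).
    { intros x y [Hxy| ->]; [left; now apply exp_increasing|lra]. }
    apply Hexp.
    assert (Hroot : sqrt (INR n) <= sqrt (INR (S m)) * INR (S M)).
    { rewrite <- (sqrt_pow2 (INR (S M))) by apply pos_INR.
      rewrite <- sqrt_mult_alt by apply pos_INR. apply sqrt_le_1_alt.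
      apply le_INR in HM2. rewrite !mult_INR in HM2. lra. }
    rewrite (S_INR M) in Hroot.
    replace (- (kappa / sqrt (INR (S m))) * sqrt (INR n))
      with (- kappa * (sqrt (INR n) / sqrt (INR (S m)))) by (field; lra).
    assert (Hdiv : sqrt (INR n) / sqrt (INR (S m)) <= INR M + 1).
    { apply Rmult_le_reg_r with (sqrt (INR (S m))); auto.
      unfold Rdiv. rewrite Rmult_assoc, Rinv_l; lra. }
    apply (Rmult_le_compat_l kappa) in Hdiv; lra.
Qed.
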